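(* Let Assumptions (A1), (A2), (A3), (A4), (A5) of the context hold (and, for the fixed-point method, (A6)). The equations (P), (K), ($\varphi$) of the direct method and the equations for $\check P,\check K,\check\varphi$ of the fixed-point method have the same form, and, by the unique solvability of (P), (K), ($\varphi$) under these assumptions, $P(\cdot)=\check P(\cdot)$, $K(\cdot)=\check K(\cdot)$, $\varphi(\cdot)=\check\varphi(\cdot)$. Therefore the decentralized strategy obtained by the direct method, $$\bar u_i^*=-\mathcal R^{-1}\widetilde P\,\bar x_i^*+\big[\mathcal R^{-1}\widetilde P-(\mathcal R+\widetilde D^\top K\widetilde D)^{-1}(\widetilde P+\widetilde K)\big]\bar x^*-(\mathcal R+\widetilde D^\top K\widetilde D)^{-1}\Phi,$$ is identical to the decentralized strategy obtained by the fixed-point method, $$\check u_i^*=-\check{\mathcal R}^{-1}\check{\widetilde P}\check x_i^*+\big[\check{\mathcal R}^{-1}\check{\widetilde P}-(\check{\mathcal R}+\widetilde D^\top\check K\widetilde D)^{-1}(\check{\widetilde P}+\check{\widetilde K})\big]\mathbb E[\check x_i^*\mid\mathcal F_t^0]-(\check{\mathcal R}+\widetilde D^\top\check K\widetilde D)^{-1}\check\Phi.$$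
   Context: Setting. $T>0$ is fixed, $(\Omega,\mathcal F,\mathbb P)$ is a complete probability space carrying a standard $(N+1)$-dimensional Brownian motion $(W_0,W_1,\dots,W_N)$ and random initial states $\xi_1,\dots,\xi_N$ in $\mathbb R^n$. $\mathcal F_t=\sigma\{\xi_i,W_0(s),W_i(s):0\le s\le t,1\le i\le N\}$, $\mathcal F_t^i=\sigma\{\xi_i,W_i(s),W_0(s):0\le s\le t\}$, $\mathcal F_t^0=\sigma\{W_0(s):0\le s\le t\}$. $L^2_{\mathcal H_t}(0,T;\mathbb R^m)$ denotes $\mathcal H_t$-adapted $\mathbb R^m$-valued processes $h$ with $\mathbb E\int_0^T|h|^2dt<\infty$. $\mathcal S^n$ is the set of symmetric $n\times n$ matrices, $\|x\|_Q^2=\langle Qx,x\rangle$, and $\mathcal M>0$ means $\langle\mathcal Mx,x\rangle>0$ for $x\ne0$. The time argument is often suppressed. $N$-player game: for $i=1,\dots,N$, $$dx_i=(Ax_i+Bu_i+Ex^{(N)}+f)dt+(Cx_i+Du_i+Fx^{(N)}+g)dW_i+(\widetilde Cx_i+\widetilde Du_i+\widetilde Fx^{(N)}+\widetilde g)dW_0,\quad x_i(0)=\xi_i,$$ with $x^{(N)}=\frac1N\sum_{i=1}^Nx_i$, $u_i\in L^2_{\mathcal F_t}(0,T;\mathbb R^k)$, and costs $$\mathcal J_i(u_i,u_{-i})=\tfrac12\mathbb E\Big[\int_0^T\big(\|x_i-\Gamma_1x^{(N)}-\eta_1\|_Q^2+\|u_i-\eta_2\|_R^2\big)dt+\|x_i(T)-\Gamma_0x^{(N)}(T)-\eta_0\|_G^2\Big].$$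 (A1): (i) $A,C,\widetilde C,E,F,\widetilde F\in L^\infty(0,T;\mathbb R^{n\times n})$, $B,D,\widetilde D\in L^\infty(0,T;\mathbb R^{n\times k})$ deterministic; $f,g,\widetilde g\in L^2_{\mathcal F_t^0}(0,T;\mathbb R^n)$. (ii) $Q\in L^\infty(0,T;\mathcal S^n)$, $R\in L^\infty(0,T;\mathcal S^k)$ ($R$ possibly indefinite), $\Gamma_1\in L^\infty(0,T;\mathbb R^{n\times n})$ deterministic, $\eta_1\in L^2_{\mathcal F_t^0}(0,T;\mathbb R^n)$, $\eta_2\in L^2_{\mathcal F_t^0}(0,T;\mathbb R^k)$, $G\in\mathcal S^n$, $\Gamma_0\in\mathbb R^{n\times n}$, $\eta_0\in L^2(\Omega,\mathcal F_T^0;\mathbb R^n)$, $Q(\cdot)\ge0$, $G\ge0$. (iii) $\xi_1,\dots,\xi_N$ are mutually independent, identically distributed (square-integrable), and independent of the Brownian motions. (A2): for every $i$, $\mathcal J_i(u_i,u_{-i})$ is uniformly convex in $u_i$. (A3): $R+D^\top(P_N+\frac{K_N}{N})D+\widetilde D^\top P_N\widetilde D>0$ and $R+D^\top(P_N+\frac{K_N}{N})D+\widetilde D^\top(P_N+K_N)\widetilde D>0$, with $P_N,K_N$ from the system (RN) below. (A4): $R+D^\top PD+\widetilde D^\top P\widetilde D>0$ and $R+D^\top PD+\widetilde D^\top(P+K)\widetilde D>0$. (A5): equation (K) below admits a unique solution in $C^1([0,T];\mathbb R^{n\times n})$. (A6): $R+D^\top\check PD+\widetilde D^\top\check P\widetilde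 D>0$ and $R+D^\top\check PD+\widetilde D^\top(\check P+\check K)\widetilde D>0$. Direct method. Put $\mathcal R=R+D^\top PD+\widetilde D^\top P\widetilde D$; $\widetilde P=B^\top P+D^\top PC+\widetilde D^\top P\widetilde C$; $\widetilde K=B^\top K+D^\top PF+\widetilde D^\top P\widetilde F+\widetilde D^\top K(\widetilde C+\widetilde F)$; $\Phi=B^\top\varphi+D^\top Pg+\widetilde D^\top(P+K)\widetilde g+\widetilde D^\top\beta-R\eta_2$, where $$\begin{aligned} \text{(P)}\ &\dot P+PA+A^\top P+C^\top PC+\widetilde C^\top P\widetilde C-\widetilde P^\top\mathcal R^{-1}\widetilde P+Q=0,\quad P(T)=G;\\ \text{(K)}\ &\dot K+K(A+E)+PE+A^\top K+C^\top PF+\widetilde C^\top(P+K)\widetilde F+\widetilde P^\top\mathcal R^{-1}\widetilde P\\ &-(\widetilde P^\top+KB+\widetilde C^\top K\widetilde D)(\mathcal R+\widetilde D^\top K\widetilde D)^{-1}(\widetilde P+\widetilde K)-Q\Gamma_1=0,\quad K(T)=-G\Gamma_0;\\ (\varphi)\ &d\varphi=-\{A^\top\varphi+(P+K)f-[(P+K)B-C^\top PD-\widetilde C^\top(P+K)\widetilde D](\mathcal R+\widetilde D^\top K\widetilde D)^{-1}\Phi\\ &\qquad+C^\top Pg+\widetilde C^\top(P+K)\widetilde g+\widetilde C^\top\beta-Q\eta_1\}dt+\beta dW_0,\quad\varphi(T)=-G\eta_0, \end{aligned}$$ with $(\varphi,\beta)$ $\mathcal F_t^0$-adapted. With $\Theta=(\mathcal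 R+\widetilde D^\top K\widetilde D)^{-1}(\widetilde P+\widetilde K)$ and $\ell=(\mathcal R+\widetilde D^\top K\widetilde D)^{-1}\Phi$, the processes in $\bar u_i^*$ solve $$d\bar x^*=\{(A+E-B\Theta)\bar x^*+f-B\ell\}dt+\{(\widetilde C+\widetilde F-\widetilde D\Theta)\bar x^*+\widetilde g-\widetilde D\ell\}dW_0,\quad\bar x^*(0)=\mathbb E\xi_i,$$ $$d\bar x_i^*=(A\bar x_i^*+B\bar u_i^*+E\bar x^*+f)dt+(C\bar x_i^*+D\bar u_i^*+F\bar x^*+g)dW_i+(\widetilde C\bar x_i^*+\widetilde D\bar u_i^*+\widetilde F\bar x^*+\widetilde g)dW_0,\quad\bar x_i^*(0)=\xi_i.$$ Fixed-point method. For an $\mathcal F^0_t$-adapted process $z$ (approximating $x^{(N)}$) consider $$d\check x_i=(A\check x_i+Bu_i+Ez+f)dt+(C\check x_i+Du_i+Fz+g)dW_i+(\widetilde C\check x_i+\widetilde Du_i+\widetilde Fz+\widetilde g)dW_0,\quad\check x_i(0)=\xi_i,$$ minimize $\frac12\mathbb E[\int_0^T(\|\check x_i-\Gamma_1z-\eta_1\|_Q^2+\|u_i-\eta_2\|_R^2)dt+\|\check x_i(T)-\Gamma_0z(T)-\eta_0\|_G^2]$ over $u_i\in L^2_{\mathcal F_t^i}(0,T;\mathbb R^k)$, and impose the consistency condition $z(t)=\mathbb E[\check x_i^*(t)\mid\mathcal F_t^0]$, where $\check x_i^*$ is the optimal state. Decoupling the adjoint process as $\check P\check x_i^*+\check K\,\mathbb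 E[\check x_i^*\mid\mathcal F^0_t]+\check\varphi$, with $d\check\varphi=\check\alpha dt+\check\beta dW_0$, leads to the strategy $\check u_i^*$ of the claim, where $\check P$, $\check K$, $(\check\varphi,\check\beta)$ solve the equations obtained from (P), (K), ($\varphi$) by replacing $P,K,\varphi,\beta$ by $\check P,\check K,\check\varphi,\check\beta$ throughout (terminal values $\check P(T)=G$, $\check K(T)=-G\Gamma_0$, $\check\varphi(T)=-G\eta_0$), $\check{\mathcal R},\check{\widetilde P},\check{\widetilde K},\check\Phi$ are the same expressions as $\mathcal R,\widetilde P,\widetilde K,\Phi$ in the checked quantities, and $\check x_i^*$ is the state under $u_i=\check u_i^*$, $z=\mathbb E[\check x_i^*\mid\mathcal F_t^0]$. $N$-level system (needed only for (A3)). Put $\mathcal R_N=R+D^\top(P_N+\frac{K_N}{N})D+\widetilde D^\top P_N\widetilde D$; $\widetilde P_N=B^\top P_N+D^\top(P_N+\frac{K_N}{N})C+\widetilde D^\top P_N\widetilde C$; $\widetilde K_N=B^\top K_N+D^\top(P_N+\frac{K_N}{N})F+\widetilde D^\top P_N\widetilde F+\widetilde D^\top K_N(\widetilde C+\widetilde F)$; $\Theta_N=(\mathcal R_N+\widetilde D^\top K_N\widetilde D)^{-1}(\widetilde P_N+\widetilde K_N)$; $a_N=\frac{P_N}{N}+\frac{N-1}{N}\Pi_N-\frac{S_N}{N}$, $b_N=\frac{K_N}{N}+S_N+\frac{N-1}{N}M_N$, $c_N=\frac{P_N}{N}+\frac{K_N}{N^2}-\frac{S_N}{N}-\frac{M_N}{N^2}$,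 $d_N=S_N+\frac{M_N}{N}$, $e_N=\frac{P_N}{N}+\frac{K_N}{N^2}+\frac{N-1}{N}S_N+\frac{N-1}{N^2}M_N$, $h_N=\frac{P_N}{N}+\frac{K_N}{N}+\frac{N-1}{N}(\Pi_N+S_N+M_N)$. System (RN): $$\begin{aligned} &\dot P_N+P_NA+A^\top P_N+C^\top(P_N+\tfrac{K_N}{N})C+\widetilde C^\top P_N\widetilde C-\widetilde P_N^\top\mathcal R_N^{-1}\widetilde P_N+E^\top a_N+F^\top c_N(C-D\mathcal R_N^{-1}\widetilde P_N)\\ &\quad+\widetilde F^\top a_N(\widetilde C-\widetilde D\mathcal R_N^{-1}\widetilde P_N)+(I_n-\tfrac{\Gamma_1}{N})^\top Q=0,\\ &\dot K_N+K_N(A+E)+P_NE+A^\top K_N+C^\top(P_N+\tfrac{K_N}{N})F+\widetilde C^\top K_N\widetilde C+\widetilde C^\top(P_N+K_N)\widetilde F+\widetilde P_N^\top\mathcal R_N^{-1}\widetilde P_N\\ &\quad-(\widetilde P_N^\top+K_NB+\widetilde C^\top K_N\widetilde D)\Theta_N+E^\top b_N+F^\top d_NC+\widetilde F^\top b_N\widetilde C+F^\top e_NF+\widetilde F^\top h_N\widetilde F\\ &\quad+[F^\top c_ND+\widetilde F^\top a_N\widetilde D]\mathcal R_N^{-1}\widetilde P_N-[F^\top e_ND+\widetilde F^\top h_N\widetilde D]\Theta_N-(I_n-\tfrac{\Gamma_1}{N})^\top Q\Gamma_1=0,\\ &\dot\Pi_N+\Pi_NA+A^\top\Pi_N+\widetilde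 C^\top\Pi_N\widetilde C+E^\top a_N+F^\top c_NC+\widetilde F^\top a_N\widetilde C\\ &\quad+(\Pi_NB+\widetilde C^\top\Pi_N\widetilde D+F^\top c_ND+\widetilde F^\top a_N\widetilde D)\mathcal R_N^{-1}\widetilde P_N-\tfrac{\Gamma_1^\top}{N}Q=0,\\ &\dot S_N+S_NA+A^\top S_N+C^\top d_NC+\widetilde C^\top S_N\widetilde C-[S_NB+C^\top d_ND+\widetilde C^\top S_N\widetilde D]\mathcal R_N^{-1}\widetilde P_N=0,\\ &\dot M_N+A^\top M_N+M_N(A+E)+C^\top d_NF+\widetilde C^\top(\Pi_N+S_N)\widetilde F+\widetilde C^\top M_N(\widetilde C+\widetilde F)+E^\top b_N+F^\top c_NF\\ &\quad+F^\top d_N(C+F)+\widetilde F^\top a_N\widetilde F+\widetilde F^\top b_N(\widetilde C+\widetilde F)+(\Pi_N+S_N)E\\ &\quad+\{(\Pi_N+S_N)B+C^\top d_ND+\widetilde C^\top(\Pi_N+S_N)\widetilde D+F^\top c_ND+\widetilde F^\top a_N\widetilde D\}\mathcal R_N^{-1}\widetilde P_N\\ &\quad-\{(\Pi_N+S_N)B+M_NB+C^\top d_ND+\widetilde C^\top(\Pi_N+S_N+M_N)\widetilde D+F^\top e_ND+\widetilde F^\top h_N\widetilde D\}\Theta_N+\tfrac{\Gamma_1^\top}{N}Q\Gamma_1=0, \end{aligned}$$ with $P_N(T)=(I_n-\frac{\Gamma_0}{N})^\top G$, $K_N(T)=-(I_n-\frac{\Gamma_0}{N})^\top G\Gamma_0$,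 $\Pi_N(T)=-\frac{\Gamma_0^\top}{N}G$, $S_N(T)=0$, $M_N(T)=\frac{\Gamma_0^\top}{N}G\Gamma_0$.
   Formalization: Solutions of (P), (K) and their checked versions are also required to have essentially bounded inverses of the matrices inverted in them (automatic for continuous coefficients); with L^∞ coefficients and only pointwise positivity in (A4), (A6), uniqueness of (P) can fail. *)

(* Defs.v *)
(* MathComp-Analysis; R is an arbitrary realType. *)
From mathcomp Require Import all_boot all_order all_algebra.
From mathcomp Require Import all_classical all_reals all_analysis.

Set Implicit Arguments.
Unset Strict Implicit.
Unset Printing Implicit Defensive.

Import Order.TTheory GRing.Theory Num.Theory.
Import numFieldNormedType.Exports.

Local Open Scope classical_set_scope.
Local Open Scope ring_scope.

Section matrices.
Context {R : realType}.

Definition qform n (M : 'M[R]_n) (x : 'cV[R]_n) : R :=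
  ((M *m x)^T *m x) ord0 ord0.

Definition posdef n (M : 'M[R]_n) := forall x, x != 0 -> 0 < qform M x.
Definition possemidef n (M : 'M[R]_n) := forall x, 0 <= qform M x.
Definition symmetric n (M : 'M[R]_n) := M^T = M.

Definition sqnorm n (x : 'cV[R]_n) : R := \sum_l (x l ord0) ^+ 2.

End matrices.

Section time_functions.
Context {R : realType} (T : R).

Definition ae_time (Q : R -> Prop) :=
  {ae @lebesgue_measure R, forall t, 0 <= t <= T -> Q t}.

Definition Linfty m n (M : R -> 'M[R]_(m, n)) := forall i j,
  measurable_fun `[0, T] (fun t => M t i j) /\
  exists c : R, ae_time (fun t => `|M t i j| <= c).

Definition bounded_inverse n (M : R -> 'M[R]_n) :=
  ae_time (fun t => M t \in unitmx) /\ Linfty (fun t => invmx (M t)).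

(* Caratheodory solution (absolutely continuous, equation a.e.) of the backward
   equation Y' + H = 0, Y(T) = YT; H is the value along Y of the other terms. *)
Definition backward_ode m n (Y H : R -> 'M[R]_(m, n)) (YT : 'M[R]_(m, n)) :=
  (forall i j,
    (@lebesgue_measure R).-integrable `[0, T] (fun s => (H s i j)%:E)) /\
  (forall t, 0 <= t <= T -> forall i j,
    Y t i j = YT i j + \int[@lebesgue_measure R]_(s in `[t, T]) (H s i j)).

(* Y is C^1 on [0, T] with derivative dY (one-sided at the end points, since
   dY is continuous up to them). *)
Definition C1_with_derivative m n (Y dY : R -> 'M[R]_(m, n)) := forall i j,
  [/\ {within `[0, T], continuous (fun t => Y t i j)},
      {within `[0, T], continuous (fun t => dY t i j)} &
      forall t, 0 < t < T -> is_derive t 1 (fun s => Y s i j) (dY t i j)].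

End time_functions.

Section probability.
Context {R : realType} {d : measure_display} {Omega : measurableType d}.
Variable Pr : probability Omega R.

(* sigma-algebra generated by a set of real random variables *)
Definition sigma_of (S : set (Omega -> R)) : set (set Omega) :=
  <<s [set A | exists X B, [/\ S X, measurable B & A = X @^-1` B]] >>.

Definition coords n (X : Omega -> 'cV[R]_n) : set (Omega -> R) :=
  [set Y | exists l, Y = fun w => X w l ord0].

Definition measurable_wrt (G : set (set Omega)) (X : Omega -> R) :=
  forall B, measurable B -> G (X @^-1` B).

Definition measurable_vec n (G : set (set Omega)) (X : Omega -> 'cV[R]_n) :=
  forall l, measurable_wrt G (fun w => X w l ord0).

Definition square_integrable n (X : Omega -> 'cV[R]_n) :=
  (\int[Pr]_w (sqnorm (X w))%:E < +oo)%E.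

Definition independent (G H : set (set Omega)) :=
  forall A B, G A -> H B -> (Pr (A `&` B) = Pr A * Pr B)%E.

Definition mutually_independent (I : finType) (G : I -> set (set Omega)) :=
  forall (J : {set I}) (A : I -> set Omega),
    (forall i, i \in J -> G i (A i)) ->
    (Pr (\big[setI/setT]_(i in J) A i) = \prod_(i in J) Pr (A i))%E.

(* Borel sigma-algebra of R^n *)
Definition borel_vec n : set (set 'cV[R]_n) :=
  <<s [set A | exists l (B : set R),
        measurable B /\ A = [set x : 'cV[R]_n | B (x l ord0)]] >>.

Definition same_law n (X Y : Omega -> 'cV[R]_n) :=
  forall B, borel_vec B -> Pr (X @^-1` B) = Pr (Y @^-1` B).

Definition mean_vec n (X : Omega -> 'cV[R]_n) : 'cV[R]_n :=
  \col_l \int[Pr]_w (X w l ord0).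

(* Y is a version of E[X | G] *)
Definition is_cond_exp (G : set (set Omega)) (X Y : Omega -> R) :=
  [/\ Pr.-integrable setT (fun w => (X w)%:E),
      Pr.-integrable setT (fun w => (Y w)%:E),
      measurable_wrt G Y &
      forall A, G A -> \int[Pr]_(w in A) Y w = \int[Pr]_(w in A) X w].

Definition is_cond_exp_vec n (G : set (set Omega)) (X Y : Omega -> 'cV[R]_n) :=
  forall l, is_cond_exp G (fun w => X w l ord0) (fun w => Y w l ord0).

Definition brownian (W : R -> Omega -> R) :=
  [/\ forall t, 0 <= t -> measurable_fun setT (W t),
      {ae Pr, forall w, W 0 w = 0},
      {ae Pr, forall w, {within [set t | 0 <= t], continuous (W ^~ w)}},
      (forall s t, 0 <= s -> s < t ->
        independent
          (sigma_of [set X | exists2 r, 0 <= r <= s & X = W r])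
          (sigma_of [set fun w => W t w - W s w])) &
      (forall s t, 0 <= s -> s < t -> forall B, measurable B ->
        Pr ((fun w => W t w - W s w) @^-1` B)
          = normal_prob 0 (Num.sqrt (t - s)) B)].

Definition standard_brownian N (W : 'I_N -> R -> Omega -> R) :=
  (forall j, brownian (W j)) /\
  mutually_independent
    (fun j => sigma_of [set X | exists2 r, 0 <= r & X = W j r]).

End probability.

Section ito.
Context {R : realType} {d : measure_display} {Omega : measurableType d}.
Variables (Pr : probability Omega R) (T : R) (F : R -> set (set Omega)).

(* The simple process sum_(l < m) zeta_l 1_(]t_l, t_(l+1)]). *)
Record simple_process := SimpleProcess {
  sp_size : nat;
  sp_time : nat -> R;
  sp_val : nat -> Omega -> R }.

Definition is_simple (h : simple_process) :=
  forall l, (l < sp_size h)%N ->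
    [/\ 0 <= sp_time h l, sp_time h l <= sp_time h l.+1, sp_time h l.+1 <= T,
        measurable_wrt (F (sp_time h l)) (sp_val h l) &
        exists c : R, forall w, `|sp_val h l w| <= c].

Definition simple_eval (h : simple_process) (t : R) (w : Omega) : R :=
  \sum_(l < sp_size h | sp_time h l < t <= sp_time h l.+1) sp_val h l w.

Definition simple_ito (W : R -> Omega -> R) (h : simple_process)
    (t : R) (w : Omega) : R :=
  \sum_(l < sp_size h) sp_val h l w *
    (W (Num.min (sp_time h l.+1) t) w - W (Num.min (sp_time h l) t) w).

(* L^2_F(0, T; R^n): jointly measurable, F-adapted, E int_0^T |h|^2 dt < oo *)
Definition L2_adapted n (h : R -> Omega -> 'cV[R]_n) :=
  [/\ forall l, measurable_fun (`[0, T] `*` setT)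
        (fun p : measurableTypeR R * Omega => h p.1 p.2 l ord0),
      forall t, 0 <= t <= T -> measurable_vec (F t) (h t) &
      (\int[Pr]_w \int[@lebesgue_measure R]_(t in `[0%R, T])
         (sqnorm (h t w))%:E < +oo)%E].

(* I t is a version of int_0^t h dW for every t in [0, T]: an L^2-limit of the
   elementary integrals of simple processes converging to h. *)
Definition is_ito1 (W : R -> Omega -> R) (h I : R -> Omega -> R) :=
  (forall t, 0 <= t <= T -> measurable_fun setT (I t)) /\
  exists hs : nat -> simple_process,
    [/\ forall q, is_simple (hs q),
        (fun q => \int[Pr]_w \int[@lebesgue_measure R]_(t in `[0%R, T])
           ((simple_eval (hs q) t w - h t w) ^+ 2)%R%:E)%E @ \oo --> 0%E &
        forall t, 0 <= t <= T ->
          (fun q => \int[Pr]_w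
             ((simple_ito W (hs q) t w - I t w) ^+ 2)%R%:E)%E @ \oo --> 0%E].

Definition is_ito n (W : R -> Omega -> R) (h I : R -> Omega -> 'cV[R]_n) :=
  L2_adapted h /\
  forall l, is_ito1 W (fun t w => h t w l ord0) (fun t w => I t w l ord0).

Definition as_continuous n (x : R -> Omega -> 'cV[R]_n) :=
  {ae Pr, forall w, forall l,
    {within `[0, T], continuous (fun t => x t w l ord0)}}.

Definition time_integral n (s t : R) (h : R -> 'cV[R]_n) : 'cV[R]_n :=
  \col_l \int[@lebesgue_measure R]_(r in `[s, t]) (h r l ord0).

End ito.

(* Values at a given time of the deterministic coefficients; cCt, cDt, cFt are
   the coefficients written with a tilde. *)
Record coeffs (R : realType) (n k : nat) := Coeffs {
  cA : 'M[R]_n; cB : 'M[R]_(n, k); cE : 'M[R]_n;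
  cC : 'M[R]_n; cD : 'M[R]_(n, k); cF : 'M[R]_n;
  cCt : 'M[R]_n; cDt : 'M[R]_(n, k); cFt : 'M[R]_n;
  cQ : 'M[R]_n; cR : 'M[R]_k; cGam1 : 'M[R]_n }.

(* Values at a given time and outcome of the random inputs. *)
Record inputs (R : realType) (n k : nat) := Inputs {
  in_f : 'cV[R]_n; in_g : 'cV[R]_n; in_gt : 'cV[R]_n;
  in_eta1 : 'cV[R]_n; in_eta2 : 'cV[R]_k }.

(* noise ord0 is W_0 and noise (lift ord0 i) is the private noise of player i *)
Record game (R : realType) (d : measure_display) (Omega : measurableType d)
    (N n k : nat) := Game {
  horizon : R;
  coef : R -> coeffs R n k;
  input : R -> Omega -> inputs R n k;
  costG : 'M[R]_n;
  Gam0 : 'M[R]_n;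
  eta0 : Omega -> 'cV[R]_n;
  noise : 'I_N.+1 -> R -> Omega -> R;
  init : 'I_N -> Omega -> 'cV[R]_n }.

(* The direct method uses these expressions at (P, K, phi, beta), the fixed-point
   method at its own (checked) quantities. *)
Section limit_expressions.
Context {R : realType} {n k : nat}.
Variables (c : coeffs R n k) (a : inputs R n k).
Local Notation A := (cA c). Local Notation B := (cB c).
Local Notation C := (cC c). Local Notation D := (cD c).
Local Notation E := (cE c). Local Notation F := (cF c).
Local Notation Ct := (cCt c). Local Notation Dt := (cDt c).
Local Notation Ft := (cFt c). Local Notation Q := (cQ c).
Local Notation G1 := (cGam1 c).
Variables (P K : 'M[R]_n) (phi beta : 'cV[R]_n).

Definition calR : 'M[R]_k := cR c + D^T *m P *m D + Dt^T *m P *m Dt.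

Definition calRK : 'M[R]_k := calR + Dt^T *m K *m Dt.

Definition Ptilde : 'M[R]_(k, n) :=
  B^T *m P + D^T *m P *m C + Dt^T *m P *m Ct.

Definition Ktilde : 'M[R]_(k, n) :=
  B^T *m K + D^T *m P *m F + Dt^T *m P *m Ft + Dt^T *m K *m (Ct + Ft).

Definition Phi : 'cV[R]_k :=
  B^T *m phi + D^T *m P *m in_g a + Dt^T *m (P + K) *m in_gt a
  + Dt^T *m beta - cR c *m in_eta2 a.

Definition P_terms : 'M[R]_n :=
  P *m A + A^T *m P + C^T *m P *m C + Ct^T *m P *m Ct
  - Ptilde^T *m invmx calR *m Ptilde + Q.

Definition K_terms : 'M[R]_n :=
  K *m (A + E) + P *m E + A^T *m K + C^T *m P *m F + Ct^T *m (P + K) *m Ft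
  + Ptilde^T *m invmx calR *m Ptilde
  - (Ptilde^T + K *m B + Ct^T *m K *m Dt) *m invmx calRK *m (Ptilde + Ktilde)
  - Q *m G1.

Definition phi_terms : 'cV[R]_n :=
  A^T *m phi + (P + K) *m in_f a
  - ((P + K) *m B - C^T *m P *m D - Ct^T *m (P + K) *m Dt)
      *m invmx calRK *m Phi
  + C^T *m P *m in_g a + Ct^T *m (P + K) *m in_gt a + Ct^T *m beta
  - Q *m in_eta1 a.

Definition Theta : 'M[R]_(k, n) := invmx calRK *m (Ptilde + Ktilde).

Definition ell : 'cV[R]_k := invmx calRK *m Phi.

(* feedback strategy in the own state x and the mean-field term z *)
Definition feedback (x z : 'cV[R]_n) : 'cV[R]_k :=
  - (invmx calR *m Ptilde *m x)
  + (invmx calR *m Ptilde - invmx calRK *m (Ptilde + Ktilde)) *m z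
  - invmx calRK *m Phi.

Definition drift (x z : 'cV[R]_n) (u : 'cV[R]_k) : 'cV[R]_n :=
  A *m x + B *m u + E *m z + in_f a.

Definition private_diffusion (x z : 'cV[R]_n) (u : 'cV[R]_k) : 'cV[R]_n :=
  C *m x + D *m u + F *m z + in_g a.

Definition common_diffusion (x z : 'cV[R]_n) (u : 'cV[R]_k) : 'cV[R]_n :=
  Ct *m x + Dt *m u + Ft *m z + in_gt a.

End limit_expressions.

Section N_level_expressions.
Context {R : realType} {n k : nat}.
Variables (N : nat) (c : coeffs R n k) (P K Pi S M : 'M[R]_n).
Local Notation A := (cA c). Local Notation B := (cB c).
Local Notation C := (cC c). Local Notation D := (cD c).
Local Notation E := (cE c). Local Notation F := (cF c).
Local Notation Ct := (cCt c). Local Notation Dt := (cDt c).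
Local Notation Ft := (cFt c). Local Notation Q := (cQ c).
Local Notation G1 := (cGam1 c).
Local Notation iN := (N%:R^-1 : R).
Local Notation rN := (N.-1%:R / N%:R : R).

Definition calR_N : 'M[R]_k :=
  cR c + D^T *m (P + iN *: K) *m D + Dt^T *m P *m Dt.

Definition Ptilde_N : 'M[R]_(k, n) :=
  B^T *m P + D^T *m (P + iN *: K) *m C + Dt^T *m P *m Ct.

Definition Ktilde_N : 'M[R]_(k, n) :=
  B^T *m K + D^T *m (P + iN *: K) *m F + Dt^T *m P *m Ft
  + Dt^T *m K *m (Ct + Ft).

Definition Theta_N : 'M[R]_(k, n) :=
  invmx (calR_N + Dt^T *m K *m Dt) *m (Ptilde_N + Ktilde_N).

Definition a_N : 'M[R]_n := iN *: P + rN *: Pi - iN *: S.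
Definition b_N : 'M[R]_n := iN *: K + S + rN *: M.
Definition c_N : 'M[R]_n :=
  iN *: P + iN ^+ 2 *: K - iN *: S - iN ^+ 2 *: M.
Definition d_N : 'M[R]_n := S + iN *: M.
Definition e_N : 'M[R]_n :=
  iN *: P + iN ^+ 2 *: K + rN *: S + (rN * iN) *: M.
Definition h_N : 'M[R]_n := iN *: P + iN *: K + rN *: (Pi + S + M).

Local Notation RP := (invmx calR_N *m Ptilde_N).

Definition PN_terms : 'M[R]_n :=
  P *m A + A^T *m P + C^T *m (P + iN *: K) *m C + Ct^T *m P *m Ct
  - Ptilde_N^T *m RP
  + E^T *m a_N + F^T *m c_N *m (C - D *m RP) + Ft^T *m a_N *m (Ct - Dt *m RP)
  + (1%:M - iN *: G1)^T *m Q.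

Definition KN_terms : 'M[R]_n :=
  K *m (A + E) + P *m E + A^T *m K + C^T *m (P + iN *: K) *m F
  + Ct^T *m K *m Ct + Ct^T *m (P + K) *m Ft + Ptilde_N^T *m RP
  - (Ptilde_N^T + K *m B + Ct^T *m K *m Dt) *m Theta_N
  + E^T *m b_N + F^T *m d_N *m C + Ft^T *m b_N *m Ct
  + F^T *m e_N *m F + Ft^T *m h_N *m Ft
  + (F^T *m c_N *m D + Ft^T *m a_N *m Dt) *m RP
  - (F^T *m e_N *m D + Ft^T *m h_N *m Dt) *m Theta_N
  - (1%:M - iN *: G1)^T *m Q *m G1.

Definition PiN_terms : 'M[R]_n :=
  Pi *m A + A^T *m Pi + Ct^T *m Pi *m Ct + E^T *m a_N + F^T *m c_N *m C
  + Ft^T *m a_N *m Ct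
  + (Pi *m B + Ct^T *m Pi *m Dt + F^T *m c_N *m D + Ft^T *m a_N *m Dt) *m RP
  - (iN *: G1^T) *m Q.

Definition SN_terms : 'M[R]_n :=
  S *m A + A^T *m S + C^T *m d_N *m C + Ct^T *m S *m Ct
  - (S *m B + C^T *m d_N *m D + Ct^T *m S *m Dt) *m RP.

Definition MN_terms : 'M[R]_n :=
  A^T *m M + M *m (A + E) + C^T *m d_N *m F + Ct^T *m (Pi + S) *m Ft
  + Ct^T *m M *m (Ct + Ft) + E^T *m b_N + F^T *m c_N *m F
  + F^T *m d_N *m (C + F) + Ft^T *m a_N *m Ft + Ft^T *m b_N *m (Ct + Ft)
  + (Pi + S) *m E
  + ((Pi + S) *m B + C^T *m d_N *m D + Ct^T *m (Pi + S) *m Dt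
     + F^T *m c_N *m D + Ft^T *m a_N *m Dt) *m RP
  - ((Pi + S) *m B + M *m B + C^T *m d_N *m D + Ct^T *m (Pi + S + M) *m Dt
     + F^T *m e_N *m D + Ft^T *m h_N *m Dt) *m Theta_N
  + (iN *: G1^T) *m Q *m G1.

End N_level_expressions.

Section game.
Context {R : realType} {d : measure_display} {Omega : measurableType d}.
Context {N n k : nat}.
Variables (Pr : probability Omega R) (m : game R Omega N n k).

Local Notation T := (horizon m).
Local Notation co := (coef m).
Local Notation vproc q := (R -> Omega -> 'cV[R]_q).

Definition W0 : R -> Omega -> R := noise m ord0.
Definition Wi (i : 'I_N) : R -> Omega -> R := noise m (lift ord0 i).

Definition path_upto (W : R -> Omega -> R) (t : R) : set (Omega -> R) :=
  [set X | exists2 s, 0 <= s <= t & X = W s].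

(* the filtrations of all the players, of player i, of the common noise *)
Definition Fall (t : R) : set (set Omega) :=
  sigma_of (path_upto W0 t `|`
    \bigcup_(i in [set: 'I_N]) (coords (init m i) `|` path_upto (Wi i) t)).
Definition Fplayer (i : 'I_N) (t : R) : set (set Omega) :=
  sigma_of (coords (init m i) `|` path_upto (Wi i) t `|` path_upto W0 t).
Definition Fcommon (t : R) : set (set Omega) := sigma_of (path_upto W0 t).

Record A1 : Prop := {
  A1_A : Linfty T (fun t => cA (co t));
  A1_C : Linfty T (fun t => cC (co t));
  A1_Ct : Linfty T (fun t => cCt (co t));
  A1_E : Linfty T (fun t => cE (co t));
  A1_F : Linfty T (fun t => cF (co t));
  A1_Ft : Linfty T (fun t => cFt (co t));
  A1_B : Linfty T (fun t => cB (co t));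
  A1_D : Linfty T (fun t => cD (co t));
  A1_Dt : Linfty T (fun t => cDt (co t));
  A1_f : L2_adapted Pr T Fcommon (fun t w => in_f (input m t w));
  A1_g : L2_adapted Pr T Fcommon (fun t w => in_g (input m t w));
  A1_gt : L2_adapted Pr T Fcommon (fun t w => in_gt (input m t w));
  A1_Q : Linfty T (fun t => cQ (co t));
  A1_Qsym : ae_time T (fun t => symmetric (cQ (co t)));
  A1_R : Linfty T (fun t => cR (co t));
  A1_Rsym : ae_time T (fun t => symmetric (cR (co t)));
  A1_Gam1 : Linfty T (fun t => cGam1 (co t));
  A1_eta1 : L2_adapted Pr T Fcommon (fun t w => in_eta1 (input m t w));
  A1_eta2 : L2_adapted Pr T Fcommon (fun t w => in_eta2 (input m t w));
  A1_Gsym : symmetric (costG m);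
  A1_eta0 : measurable_vec (Fcommon T) (eta0 m);
  A1_eta0_L2 : square_integrable Pr (eta0 m);
  A1_Qpos : ae_time T (fun t => possemidef (cQ (co t)));
  A1_Gpos : possemidef (costG m);
  A1_init_meas : forall i l, measurable_fun setT (fun w => init m i w l ord0);
  A1_init_indep : mutually_independent Pr (fun i => sigma_of (coords (init m i)));
  A1_init_law : forall i j, same_law Pr (init m i) (init m j);
  A1_init_L2 : forall i, square_integrable Pr (init m i);
  A1_init_noise : independent Pr
    (sigma_of (\bigcup_(i in [set: 'I_N]) coords (init m i)))
    (sigma_of [set X | exists j, exists2 s, 0 <= s & X = noise m j s]) }.

(* x solves, with respect to the filtration F,
   dx = (A x + B u + E z + f) dt + (C x + D u + F z + g) dW_i
        + (Ct x + Dt u + Ft z + gt) dW_0,  x(0) = xi_i. *)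
Definition state_sde (F : R -> set (set Omega)) (i : 'I_N)
    (u : vproc k) (z x : vproc n) :=
  [/\ L2_adapted Pr T F x, as_continuous Pr T x &
    exists Ii I0 : vproc n,
    [/\ is_ito Pr T F (Wi i)
          (fun t w => private_diffusion (co t) (input m t w)
                        (x t w) (z t w) (u t w)) Ii,
        is_ito Pr T F W0
          (fun t w => common_diffusion (co t) (input m t w)
                        (x t w) (z t w) (u t w)) I0 &
        forall t, 0 <= t <= T -> {ae Pr, forall w,
          x t w = init m i w
            + time_integral 0 t (fun s => drift (co s) (input m s w)
                                   (x s w) (z s w) (u s w))
            + Ii t w + I0 t w}]].

Definition average (x : 'I_N -> vproc n) : vproc n :=
  fun t w => N%:R^-1 *: \sum_j x j t w.

Definition game_states (u : 'I_N -> vproc k) (x : 'I_N -> vproc n) :=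
  forall i, state_sde Fall i (u i) (average x) (x i).

(* J_i, as a function of the controls and of the resulting states *)
Definition game_cost (i : 'I_N) (u : 'I_N -> vproc k) (x : 'I_N -> vproc n)
    : R :=
  2^-1 * \int[Pr]_w
   ((\int[@lebesgue_measure R]_(t in `[0, T])
      (qform (cQ (co t))
         (x i t w - cGam1 (co t) *m average x t w - in_eta1 (input m t w))
       + qform (cR (co t)) (u i t w - in_eta2 (input m t w))))
    + qform (costG m) (x i T w - Gam0 m *m average x T w - eta0 m w)).

Definition admissible (v : vproc k) := L2_adapted Pr T Fall v.

Definition dist2 (v v' : vproc k) : R :=
  \int[Pr]_w \int[@lebesgue_measure R]_(t in `[0, T])
    sqnorm (v t w - v' t w).

Definition update (u : 'I_N -> vproc k) (i : 'I_N) (v : vproc k) :=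
  fun j => if j == i then v else u j.

(* v |-> J_i(v, u_{-i}) is uniformly (strongly) convex on L^2_F(0, T; R^k);
   the value u i is irrelevant. *)
Definition uniformly_convex (i : 'I_N) (u : 'I_N -> vproc k) :=
  exists2 delta : R, 0 < delta &
  forall (v v' : vproc k) (lam : R), admissible v -> admissible v' ->
    0 <= lam <= 1 ->
    let v'' : vproc k := fun t w => lam *: v t w + (1 - lam) *: v' t w in
    forall x x' x'', game_states (update u i v) x ->
      game_states (update u i v') x' -> game_states (update u i v'') x'' ->
    game_cost i (update u i v'') x'' <=
      lam * game_cost i (update u i v) x
      + (1 - lam) * game_cost i (update u i v') x'
      - delta * lam * (1 - lam) * dist2 v v'.

Definition A2 := forall (i : 'I_N) (u : 'I_N -> vproc k),
  (forall j, j != i -> admissible (u j)) -> uniformly_convex i u.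

Definition solves_RN (P K Pi S M : R -> 'M[R]_n) :=
  let iN := N%:R^-1 : R in
  let G0 := Gam0 m in
  let G := costG m in
  [/\ backward_ode T P
        (fun t => PN_terms N (co t) (P t) (K t) (Pi t) (S t) (M t))
        ((1%:M - iN *: G0)^T *m G),
      backward_ode T K
        (fun t => KN_terms N (co t) (P t) (K t) (Pi t) (S t) (M t))
        (- ((1%:M - iN *: G0)^T *m G *m G0)),
      backward_ode T Pi
        (fun t => PiN_terms N (co t) (P t) (K t) (Pi t) (S t) (M t))
        (- ((iN *: G0^T) *m G)),
      backward_ode T S
        (fun t => SN_terms N (co t) (P t) (K t) (S t) (M t)) 0 &
      backward_ode T M
        (fun t => MN_terms N (co t) (P t) (K t) (Pi t) (S t) (M t))
        ((iN *: G0^T) *m G *m G0)].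

Definition A3 (PN KN : R -> 'M[R]_n) := ae_time T (fun t =>
  let D := cD (co t) in let Dt := cDt (co t) in
  let common := cR (co t) + D^T *m (PN t + N%:R^-1 *: KN t) *m D in
  posdef (common + Dt^T *m PN t *m Dt) /\
  posdef (common + Dt^T *m (PN t + KN t) *m Dt)).

(* used at (P, K) and at the checked pair of the fixed-point method *)
Definition positivity (P K : R -> 'M[R]_n) := ae_time T (fun t =>
  let D := cD (co t) in let Dt := cDt (co t) in
  let common := cR (co t) + D^T *m P t *m D in
  posdef (common + Dt^T *m P t *m Dt) /\
  posdef (common + Dt^T *m (P t + K t) *m Dt)).

(* The coefficients being only L^infty, a solution is required to have
   essentially bounded inverses, i.e. bounded feedback gains: when the matrix to
   be inverted is merely positive definite for a.e. t, uniqueness fails.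
   For instance P' = P^2 / (T - t), P(T) = 0 has the solutions 0 and
   - 1 / (1 + ln (T / (T - t))). *)
Definition solves_P (P : R -> 'M[R]_n) :=
  backward_ode T P (fun t => P_terms (co t) (P t)) (costG m) /\
  bounded_inverse T (fun t => calR (co t) (P t)).

Definition solves_K (P K : R -> 'M[R]_n) :=
  (exists dK : R -> 'M[R]_n,
     C1_with_derivative T K dK /\
     ae_time T (fun t => dK t + K_terms (co t) (P t) (K t) = 0)) /\
  K T = - (costG m *m Gam0 m) /\
  bounded_inverse T (fun t => calRK (co t) (P t) (K t)).

Definition A5 (P : R -> 'M[R]_n) :=
  exists2 K, solves_K P K &
  forall K', solves_K P K' -> forall t, 0 <= t <= T -> K' t = K t.

Definition solves_phi (P K : R -> 'M[R]_n) (phi beta : vproc n) :=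
  [/\ L2_adapted Pr T Fcommon phi, as_continuous Pr T phi &
    exists2 I0 : vproc n, is_ito Pr T Fcommon W0 beta I0 &
    forall t, 0 <= t <= T -> {ae Pr, forall w,
      phi t w = - (costG m *m eta0 m w)
        + time_integral t T (fun s => phi_terms (co s) (input m s w)
                               (P s) (K s) (phi s w) (beta s w))
        - (I0 T w - I0 t w)}].

Definition strategy (P K : R -> 'M[R]_n) (phi beta x z : vproc n) : vproc k :=
  fun t w => feedback (co t) (input m t w) (P t) (K t) (phi t w) (beta t w)
               (x t w) (z t w).

(* the limiting mean-field state of the direct method *)
Definition mean_field_sde (P K : R -> 'M[R]_n) (phi beta xbar : vproc n) :=
  let Th s := Theta (co s) (P s) (K s) in
  let el s w := ell (co s) (input m s w) (P s) (K s) (phi s w) (beta s w) in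
  [/\ L2_adapted Pr T Fcommon xbar, as_continuous Pr T xbar &
    exists2 I0 : vproc n,
      is_ito Pr T Fcommon W0
        (fun s w =>
           (cCt (co s) + cFt (co s) - cDt (co s) *m Th s) *m xbar s w
           + in_gt (input m s w) - cDt (co s) *m el s w) I0 &
    forall t, 0 <= t <= T -> forall i, {ae Pr, forall w,
      xbar t w = mean_vec Pr (init m i)
        + time_integral 0 t (fun s =>
            (cA (co s) + cE (co s) - cB (co s) *m Th s) *m xbar s w
            + in_f (input m s w) - cB (co s) *m el s w)
        + I0 t w}].

Definition direct_states (P K : R -> 'M[R]_n) (phi beta xbar : vproc n)
    (x : 'I_N -> vproc n) :=
  mean_field_sde P K phi beta xbar /\
  forall i,
    state_sde (Fplayer i) i (strategy P K phi beta (x i) xbar) xbar (x i).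

(* z i is the process E[x i (t) | F_t^0], which is also the process z of the
   control problem by the consistency condition. *)
Definition fixed_point_states (P K : R -> 'M[R]_n) (phi beta : vproc n)
    (x z : 'I_N -> vproc n) :=
  forall i,
  [/\ L2_adapted Pr T Fcommon (z i),
      forall t, 0 <= t <= T -> is_cond_exp_vec Pr (Fcommon t) (x i t) (z i t) &
      state_sde (Fplayer i) i (strategy P K phi beta (x i) (z i)) (z i) (x i)].

Definition indistinguishable n' (X Y : vproc n') :=
  {ae Pr, forall w, forall t, 0 <= t <= T -> X t w = Y t w}.

(* equality in L^2_F(0, T; R^q): dt x dPr almost everywhere *)
Definition same_process q (X Y : vproc q) :=
  ae_time T (fun t => {ae Pr, forall w, X t w = Y t w}).

End game.

(* Main.v *)
(* Differences of two solutions are controlled in L^2 norms on short time intervals,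
   where every linear equation is a contraction; iterating over [0, T] replaces the
   Ito formula and Gronwall's lemma.

   P = Pc because the Riccati right-hand side is Lipschitz along solutions with
   bounded inverses; then Kc solves the equation of K and (A5) applies.  In the
   linear BSDE of phi - phic, phi_t - phic_t is orthogonal to the later increment of
   the martingale, and the Ito isometry bounds both by the time integral.

   For the states, x_i - xbar solves a linear SDE without inhomogeneous term whose
   initial value is centred and independent of W_0, so E[x_i - xbar | F^0_T] = 0: the
   private integral is orthogonal to F^0_T, and the conditional mean of an integral
   with respect to W_0 is bounded by that of its integrand.  With the consistency
   condition this makes zc_i - xbar orthogonal to both xc_i - zc_i and x_i - xbar.
   Hence zc_i - xbar is at most xc_i - x_i in norm, and xc_i - x_i, which solves a
   linear SDE with zero initial value, vanishes. *)
From HB Require Import structures.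
Require Import Defs.
From mathcomp Require Import all_boot all_order all_algebra.
From mathcomp Require Import all_classical all_reals all_analysis.
From mathcomp Require Import measurable_realfun ring lra.
From mathcomp Require finmap.

Set Implicit Arguments.
Unset Strict Implicit.
Unset Printing Implicit Defensive.

Import Order.TTheory GRing.Theory Num.Theory.
Import numFieldNormedType.Exports.

Local Open Scope classical_set_scope.
Local Open Scope ring_scope.

(** * Square-integrable functions *)

(** The fixed-point method provides no equation for [zc i], only that it is a conditional mean;
    deriving one would mean commuting conditional expectation with stochastic integrals. This is
    avoided: only the state of the direct method is projected on the common noise, since its
    mean-field term has an equation of its own, and the projection is weak, by pairing with test
    variables, so that no conditional expectation of a process is ever constructed.

    Ito integrals are known only as L2 limits at each fixed time, up to null sets that depend on the
    time. All estimates are therefore made at fixed times or at almost every time, and null sets are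
    united only at the end, over rational times, by continuity of the paths.

    A time integral over [s, t] gains sqrt(t - s) by Cauchy-Schwarz, a stochastic integral gains
    nothing, and passing from bounds at fixed times to L2 in time gains another sqrt(t - s).
    Contraction thus asks for C (del + sqrt del) <= 1/2, where C depends only on bounds of the
    coefficients, so finitely many steps of one length cover [0, T]. *)

Section L2_space.
Context {d} {X : measurableType d} {R : realType}.
Variables (mu : {measure set X -> \bar R}) (D : set X).
Hypothesis mD : measurable D.
Implicit Types f g h : X -> R.

(** Functions are not taken modulo null sets, since processes are evaluated pointwise in the
    equations; [n2_eq_ae] and [n2_eq0] translate between almost everywhere equality and norms. *)
Definition L2 f :=
  measurable_fun D f /\ mu.-integrable D (fun x => ((f x) ^+ 2)%:E).
Definition ip f g : R := \int[mu]_(x in D) (f x * g x).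
Definition n2 f : R := Num.sqrt (ip f f).

Lemma integrable_EFinD f g : mu.-integrable D (fun x => (f x)%:E) ->
  mu.-integrable D (fun x => (g x)%:E) ->
  mu.-integrable D (fun x => (f x + g x)%:E).
Proof. by move=> If Ig; exact: (integrableD mD If Ig). Qed.

Lemma L2_mul f g : L2 f -> L2 g -> mu.-integrable D (fun x => (f x * g x)%:E).
Proof.
move=> [mf If] [mg Ig].
apply: (le_integrable mD _ _ (integrable_EFinD If Ig)).
  by apply/measurable_EFinP; exact: measurable_funM.
move=> x _ /=; rewrite lee_fin normrM [leRHS]ger0_norm ?addr_ge0 ?sqr_ge0//.
have := sqr_ge0 (`|f x| - `|g x|).
have := sqr_ge0 (f x); have := sqr_ge0 (g x).
rewrite -(real_normK (num_real (f x))) -(real_normK (num_real (g x))).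
by set a := `|f x|; set b := `|g x|; nra.
Qed.

Lemma L2D f g : L2 f -> L2 g -> L2 (fun x => f x + g x).
Proof.
move=> [mf If] [mg Ig]; split; first exact: measurable_funD.
have := integrable_EFinD (integrable_EFinD If If) (integrable_EFinD Ig Ig).
apply: le_integrable => //.
  by apply/measurable_EFinP; apply/measurable_funX/measurable_funD.
move=> x _ /=; rewrite lee_fin !ger0_norm ?sqr_ge0//.
- by have := sqr_ge0 (f x - g x); nra.
- by rewrite !addr_ge0 ?sqr_ge0.
Qed.

Lemma L2Z (a : R) f : L2 f -> L2 (fun x => a * f x).
Proof.
move=> [mf If]; split; first exact: measurable_funM.
have := integrableZl mD (a ^+ 2) If.
by apply: eq_integrable => // x _ /=; rewrite exprMn.
Qed.

Lemma L2B f g : L2 f -> L2 g -> L2 (fun x => f x - g x).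
Proof.
move=> Lf Lg; have := L2D Lf (L2Z (-1) Lg).
by congr L2; apply/funext => x; rewrite mulN1r.
Qed.

Lemma L20 : L2 (fun=> 0).
Proof.
split=> //; apply: (eq_integrable _ (cst 0%E)) => //.
- by move=> x _; rewrite expr0n.
- exact: integrable0.
Qed.

Lemma L2_sum (I : Type) (r : seq I) (P : pred I) (F : I -> X -> R) :
  (forall i, P i -> L2 (F i)) -> L2 (fun x => \sum_(i <- r | P i) F i x).
Proof.
move=> LF; elim: r => [|i r IH].
  by have := L20; congr L2; apply/funext => x; rewrite big_nil.
have [Pi|Pi] := boolP (P i); last first.
  by move: IH; congr L2; apply/funext => x; rewrite big_cons (negbTE Pi).
have := L2D (LF i Pi) IH.
by congr L2; apply/funext => x; rewrite big_cons Pi.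
Qed.

Lemma ipC f g : ip f g = ip g f.
Proof. by congr Rintegral; apply/funext => x; rewrite mulrC. Qed.

Lemma ipDl f g h : L2 f -> L2 g -> L2 h ->
  ip (fun x => f x + g x) h = ip f h + ip g h.
Proof.
move=> Lf Lg Lh; rewrite /ip -RintegralD//; [|exact: L2_mul..].
by congr Rintegral; apply/funext => x; rewrite mulrDl.
Qed.

Lemma ipZl (a : R) f g : L2 f -> L2 g -> ip (fun x => a * f x) g = a * ip f g.
Proof.
move=> Lf Lg; rewrite /ip -RintegralZl//; last exact: L2_mul.
by congr Rintegral; apply/funext => x; rewrite mulrA.
Qed.

Lemma ipBl f g h : L2 f -> L2 g -> L2 h ->
  ip (fun x => f x - g x) h = ip f h - ip g h.
Proof.
move=> Lf Lg Lh; rewrite -mulN1r -ipZl// -ipDl//; last exact: L2Z.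
by congr ip; apply/funext => x; rewrite mulN1r.
Qed.

Lemma ip_suml (I : Type) (r : seq I) (P : pred I) (F : I -> X -> R) g :
  (forall i, P i -> L2 (F i)) -> L2 g ->
  ip (fun x => \sum_(i <- r | P i) F i x) g = \sum_(i <- r | P i) ip (F i) g.
Proof.
move=> LF Lg; elim: r => [|i r IH].
  rewrite big_nil -[RHS](mul0r (ip g g)) -ipZl//.
  by rewrite /ip; congr Rintegral; apply/funext => x; rewrite big_nil !mul0r.
rewrite big_cons; have [Pi|Pi] := boolP (P i); last first.
  by rewrite -IH; congr ip; apply/funext => x; rewrite big_cons (negbTE Pi).
rewrite -IH -ipDl//; [|exact: LF|exact: L2_sum].
by congr ip; apply/funext => x; rewrite big_cons Pi.
Qed.

Lemma ip_ge0 f : 0 <= ip f f.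
Proof. by apply: Rintegral_ge0 => x _; rewrite -expr2 sqr_ge0. Qed.

Lemma n2_ge0 f : 0 <= n2 f. Proof. exact: sqrtr_ge0. Qed.

Lemma n2_sqr f : n2 f ^+ 2 = ip f f.
Proof. by rewrite sqr_sqrtr// ip_ge0. Qed.

Lemma n2E f : L2 f -> ((n2 f ^+ 2)%:E = \int[mu]_(x in D) ((f x) ^+ 2)%:E)%E.
Proof.
move=> [mf If]; rewrite n2_sqr /ip /Rintegral fineK//.
exact: integrable_fin_num.
Qed.

Lemma cauchy_schwarz f g : L2 f -> L2 g -> `|ip f g| <= n2 f * n2 g.
Proof.
move=> Lf Lg.
have Q (t : R) : 0 <= ip f f - 2 * t * ip f g + t ^+ 2 * ip g g.
  have := ip_ge0 (fun x => f x - t * g x).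
  have Ltg := L2Z t Lg; have Lfg := L2B Lf Ltg.
  rewrite ipBl// (ipC f) (ipC (fun x => t * g x)) !ipBl// !ipZl//.
  rewrite (ipC g (fun x => t * g x)) (ipC f (fun x => t * g x)) !ipZl// (ipC g f).
  by move=> /le_trans; apply; rewrite le_eqVlt; apply/orP; left; apply/eqP; ring.
have [g0|g0] := eqVneq (ip g g) 0.
  rewrite {2}/n2 g0 sqrtr0 mulr0 normr_le0; apply/negP => /negP fg0.
  (* Without its quadratic term [Q] is affine in t; at this t it equals -1. *)
  have := Q ((ip f f + 1) / (2 * ip f g)); rewrite g0 mulr0 addr0.
  have -> : 2 * ((ip f f + 1) / (2 * ip f g)) * ip f g = ip f f + 1 by field.
  by lra.
rewrite -(ler_pXn2r (ltn0Sn 1)) ?nnegrE ?mulr_ge0 ?n2_ge0// exprMn !n2_sqr.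
rewrite real_normK ?num_real//.
have gp : 0 < ip g g by rewrite lt_def g0 ip_ge0.
(* The minimizer of the quadratic, where nonnegativity is the squared inequality. *)
have := Q (ip f g / ip g g).
have -> : ip f f - 2 * (ip f g / ip g g) * ip f g + (ip f g / ip g g) ^+ 2 * ip g g
  = (ip f f * ip g g - ip f g ^+ 2) / ip g g by field.
by rewrite pmulr_lge0 ?invr_gt0// subr_ge0.
Qed.

Lemma n2D f g : L2 f -> L2 g -> n2 (fun x => f x + g x) <= n2 f + n2 g.
Proof.
move=> Lf Lg; have Lfg := L2D Lf Lg.
rewrite -(ler_pXn2r (ltn0Sn 1)) ?nnegrE ?addr_ge0 ?n2_ge0//.
rewrite n2_sqr ipDl// (ipC f) (ipC g) !ipDl// sqrrD !n2_sqr (ipC g f).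
have := le_trans (ler_norm _) (cauchy_schwarz Lf Lg); lra.
Qed.

Lemma n2Z (a : R) f : L2 f -> n2 (fun x => a * f x) = `|a| * n2 f.
Proof.
move=> Lf; have LZ := L2Z a Lf.
rewrite /n2 ipZl// ipC ipZl// mulrA -expr2 sqrtrM ?sqr_ge0//.
by rewrite sqrtr_sqr.
Qed.

Lemma n2N f : L2 f -> n2 (fun x => - f x) = n2 f.
Proof.
move=> Lf; rewrite -[RHS]mul1r -(normrN1 R) -n2Z//.
by congr n2; apply/funext => x; rewrite mulN1r.
Qed.

Lemma n2B f g : L2 f -> L2 g -> n2 (fun x => f x - g x) <= n2 f + n2 g.
Proof.
move=> Lf Lg; rewrite -(n2N Lg); apply: n2D => //.
by have := L2Z (-1) Lg; congr L2; apply/funext => x; rewrite mulN1r.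
Qed.

Lemma n20 : n2 (fun=> 0) = 0.
Proof. by rewrite /n2 /ip (_ : (fun _ => _) = cst 0) ?Rintegral_cst ?mul0r ?sqrtr0//; apply/funext => x; rewrite mulr0. Qed.

Lemma n2_sum (I : Type) (r : seq I) (P : pred I) (F : I -> X -> R) :
  (forall i, P i -> L2 (F i)) ->
  n2 (fun x => \sum_(i <- r | P i) F i x) <= \sum_(i <- r | P i) n2 (F i).
Proof.
move=> LF; elim: r => [|i r IH].
  rewrite big_nil le_eqVlt -[X in _ == X]n20; apply/orP; left; apply/eqP.
  by congr n2; apply/funext => x; rewrite big_nil.
rewrite big_cons; have [Pi|Pi] := boolP (P i); last first.
  apply: le_trans IH; rewrite le_eqVlt; apply/orP; left; apply/eqP.
  by congr n2; apply/funext => x; rewrite big_cons (negbTE Pi).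
apply: le_trans (lerD (lexx _) IH); apply: le_trans (n2D _ _); last 2 first.
- exact: LF.
- exact: L2_sum.
rewrite le_eqVlt; apply/orP; left; apply/eqP.
by congr n2; apply/funext => x; rewrite big_cons Pi.
Qed.

Lemma n2_dist f g : L2 f -> L2 g -> `|n2 f - n2 g| <= n2 (fun x => f x - g x).
Proof.
move=> Lf Lg; have Lfg := L2B Lf Lg; have Lgf := L2B Lg Lf.
have e : n2 (fun x => g x - f x) = n2 (fun x => f x - g x).
  by rewrite -n2N//; congr n2; apply/funext => x; rewrite opprB.
rewrite ler_norml; apply/andP; split.
  rewrite -e lerNl opprB lerBlDl; apply: le_trans (n2D Lf Lgf).
  by rewrite le_eqVlt; apply/orP; left; apply/eqP; congr n2; apply/funext => x; rewrite addrC subrK.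
rewrite lerBlDl; apply: le_trans (n2D Lg Lfg).
by rewrite le_eqVlt; apply/orP; left; apply/eqP; congr n2; apply/funext => x; rewrite addrC subrK.
Qed.

Lemma L2_dom f g : measurable_fun D f -> L2 g ->
  {ae mu, forall x, D x -> `|f x| <= `|g x|} -> L2 f.
Proof.
move=> mf [mg Ig] fg; split => //; apply/integrableP; split.
  by apply/measurable_EFinP; exact: measurable_funX.
case/integrableP: Ig => mg2; apply: le_lt_trans.
apply: ae_ge0_le_integral => //.
- by apply: measurableT_comp => //; apply/measurable_EFinP; exact: measurable_funX.
- by apply: measurableT_comp => //; apply/measurable_EFinP; exact: measurable_funX.
apply: filterS fg => x h Dx; rewrite lee_fin !normrX.
by rewrite lerXn2r ?nnegrE// h.
Qed.

Lemma n2_dom f g : measurable_fun D f -> L2 g ->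
  {ae mu, forall x, D x -> `|f x| <= `|g x|} -> n2 f <= n2 g.
Proof.
move=> mf Lg fg; have Lf := L2_dom mf Lg fg.
rewrite -(ler_pXn2r (ltn0Sn 1)) ?nnegrE ?n2_ge0// -lee_fin !n2E//.
apply: ae_ge0_le_integral => //.
- by move=> x _; rewrite lee_fin sqr_ge0.
- by apply/measurable_EFinP; exact: measurable_funX.
- by move=> x _; rewrite lee_fin sqr_ge0.
- by apply/measurable_EFinP; apply: measurable_funX; case: Lg.
apply: filterS fg => x h Dx; rewrite lee_fin -(real_normK (num_real (f x))).
by rewrite -(real_normK (num_real (g x))) lerXn2r ?nnegrE// h.
Qed.

Lemma n2_eq_ae f g : measurable_fun D f -> L2 g ->
  {ae mu, forall x, D x -> f x = g x} -> L2 f /\ n2 f = n2 g.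
Proof.
move=> mf Lg fg.
have fg' : {ae mu, forall x, D x -> `|f x| <= `|g x|}.
  by apply: filterS fg => x h Dx; rewrite h.
have Lf := L2_dom mf Lg fg'; split => //.
apply/eqP; rewrite eq_le n2_dom//=; apply: n2_dom => //; first by case: Lg.
by apply: filterS fg => x h Dx; rewrite h.
Qed.

Lemma n2_eq0 f : L2 f -> n2 f = 0 -> {ae mu, forall x, D x -> f x = 0}.
Proof.
move=> Lf f0; have [mf If] := Lf.
have := n2E Lf; rewrite f0 expr0n => /esym I0.
have : (\int[mu]_(x in D) `|((f x) ^+ 2)%:E| = 0)%E.
  by rewrite -[RHS]I0; apply: eq_integral => x _; rewrite gee0_abs// lee_fin sqr_ge0.
move/ae_eq_integral_abs => /(_ mD).
have mE : measurable_fun D (fun x => ((f x) ^+ 2)%:E).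
  by apply/measurable_EFinP; exact: measurable_funX.
move=> /(_ mE); apply: filterS => x h Dx.
by have := h Dx => -[] /eqP; rewrite sqrf_eq0 => /eqP.
Qed.

Lemma n2_0_ae f : measurable_fun D f -> {ae mu, forall x, D x -> f x = 0} ->
  L2 f /\ n2 f = 0.
Proof.
by move=> mf f0; have [Lf ->] := n2_eq_ae mf L20 f0; rewrite n20.
Qed.

Lemma L2_bounded_mul (c : R) f h : measurable_fun D h ->
  {ae mu, forall x, D x -> `|h x| <= c} -> L2 f ->
  L2 (fun x => h x * f x) /\ n2 (fun x => h x * f x) <= `|c| * n2 f.
Proof.
move=> mh hc Lf; rewrite -n2Z//.
have mhf : measurable_fun D (fun x => h x * f x).
  by apply: measurable_funM => //; case: Lf.
have H : {ae mu, forall x, D x -> `|h x * f x| <= `|c * f x|}.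
  apply: filterS hc => x k Dx; rewrite !normrM ler_wpM2r//.
  by rewrite (le_trans (k Dx))// ler_norm.
by split; [apply: L2_dom (L2Z c Lf) H|apply: n2_dom (L2Z c Lf) H].
Qed.

Lemma L2_finite_integral f : measurable_fun D f ->
  (\int[mu]_(x in D) ((f x) ^+ 2)%:E < +oo)%E -> L2 f.
Proof.
move=> mf If; split => //; apply/integrableP; split.
  by apply/measurable_EFinP; exact: measurable_funX.
by under eq_integral do rewrite abse_EFin ger0_norm ?sqr_ge0//.
Qed.

End L2_space.

Lemma L2S {d} {X : measurableType d} {R : realType}
  (mu : {measure set X -> \bar R}) (D E : set X) (f : X -> R) :
  measurable D -> measurable E -> E `<=` D -> L2 mu D f -> L2 mu E f.
Proof.
move=> mD mE ED [mf If]; split; first exact: measurable_funS mf.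
exact: integrableS If.
Qed.

Lemma n2S {d} {X : measurableType d} {R : realType}
  (mu : {measure set X -> \bar R}) (D E : set X) (f : X -> R) :
  measurable D -> measurable E -> E `<=` D -> L2 mu D f ->
  n2 mu E f <= n2 mu D f.
Proof.
move=> mD mE ED Lf; have LE := L2S mD mE ED Lf.
rewrite -(ler_pXn2r (ltn0Sn 1)) ?nnegrE ?n2_ge0// -lee_fin !n2E//.
apply: ge0_subset_integral => //.
  by apply/measurable_EFinP; apply: measurable_funX; case: Lf.
by move=> x _; rewrite lee_fin sqr_ge0.
Qed.

(** * Independence *)

Section product_law.
Context {d} {Omega : measurableType d} {R : realType}.
Variable Pr : probability Omega R.
Variables X Y : Omega -> R.
Hypotheses (mX : measurable_fun setT X) (mY : measurable_fun setT Y).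
Hypothesis XY_indep : forall B C, measurable B -> measurable C ->
  (Pr (X @^-1` B `&` Y @^-1` C) = Pr (X @^-1` B) * Pr (Y @^-1` C))%E.
Hypotheses (IX : Pr.-integrable setT (fun w => (X w)%:E))
  (IY : Pr.-integrable setT (fun w => (Y w)%:E)).

Let X' : {mfun Omega >-> R} := HB.pack X (isMeasurableFun.Build _ _ _ _ X mX).
Let Y' : {mfun Omega >-> R} := HB.pack Y (isMeasurableFun.Build _ _ _ _ Y mY).
Let Z (w : Omega) := (X w, Y w).
Let mZ : measurable_fun setT Z.
Proof. exact: measurable_fun_pair. Qed.
Let Z' : {mfun Omega >-> (R * R)%type} :=
  HB.pack Z (isMeasurableFun.Build _ _ _ _ Z mZ).
Let dX := distribution Pr X'.
Let dY := distribution Pr Y'.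
Let dZ := distribution Pr Z'.

(** Independence says that the two measures agree on rectangles, which determine a measure on the
    product; Fubini then factors the expectation of the product. *)
Let prodE (A : set (R * R)) :
  measurable A -> (dX \x dY)%E A = dZ A.
Proof.
by move=> mA; apply: product_measure_unique => // B C mB mC; exact: XY_indep.
Qed.

Let g (p : R * R) : \bar R := (p.1 * p.2)%:E.
Let mg : measurable_fun setT g.
Proof. by apply/measurable_EFinP; apply: measurable_funM. Qed.

Let IgX : dX.-integrable setT (fun x => x%:E).
Proof. by apply: (@integrable_pushforward _ _ _ _ _ _ mX Pr setT EFin). Qed.
Let IgY : dY.-integrable setT (fun x => x%:E).
Proof. by apply: (@integrable_pushforward _ _ _ _ _ _ mY Pr setT EFin). Qed.

Let Ig : (dX \x dY)%E.-integrable setT g.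
Proof.
apply/integrable12ltyP => //.
under eq_integral => x _.
  under eq_integral => y _.
    rewrite /g /= normrM EFinM; over.
  rewrite integralZl//; last exact: (integrable_norm IgY).
  over.
have fX := integrable_fin_num measurableT (integrable_norm IgX).
have fY := integrable_fin_num measurableT (integrable_norm IgY).
rewrite -(fineK fY) /= integralZr//; last exact: (integrable_norm IgX).
by rewrite -(fineK fX) -EFinM ltry.
Qed.

Lemma integrable_indep_mul : Pr.-integrable setT (fun w => (X w * Y w)%:E).
Proof.
apply/integrableP; split.
  by apply/measurable_EFinP; exact: measurable_funM.
case/integrableP: Ig => _; apply: le_lt_trans.
rewrite (eq_measure_integral dZ); last by move=> A mA _; exact: prodE.
rewrite /dZ ge0_integral_distribution//.
exact: measurableT_comp.
Qed.

Lemma expectation_indep_mul :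
  \int[Pr]_w (X w * Y w) = (\int[Pr]_w X w) * (\int[Pr]_w Y w).
Proof.
have e1 : (\int[Pr]_w (X w * Y w)%:E = \int[dX \x dY]_p g p)%E.
  rewrite (eq_measure_integral dZ); last by move=> A mA _; exact: prodE.
  by rewrite integral_distribution//; exact: integrable_indep_mul.
have eX : (\int[dX]_x x%:E = \int[Pr]_w (X w)%:E)%E.
  by rewrite integral_distribution.
have eY : (\int[dY]_x x%:E = \int[Pr]_w (Y w)%:E)%E.
  by rewrite integral_distribution.
have fX := integrable_fin_num measurableT IX.
have fY := integrable_fin_num measurableT IY.
rewrite /Rintegral -fineM//; congr fine.
rewrite e1 -integral12_prod_meas1// /fubini_F -eX -eY.
transitivity (\int[dX]_x (x%:E * \int[dY]_y y%:E))%E.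
  by apply: eq_integral => x _; rewrite -integralZl.
by rewrite eY -(fineK fY) integralZr.
Qed.

End product_law.

(** * Measurability with respect to a sub-sigma-algebra *)

Section sub_sigma_algebras.
Context {d} {Omega : measurableType d} {R : realType}.
Implicit Types (G H : set (set Omega)) (X Y : Omega -> R).

Definition sub_algebra G :=
  sigma_algebra setT G /\ G `<=` (@measurable _ Omega).

(** Reads [measurable_wrt G] as measurability on the space equipped with [G], so that the closure
    properties of measurable functions apply; generating from a sigma-algebra adds no set. *)
Lemma measurable_wrtE G X : sigma_algebra setT G ->
  measurable_wrt G X <->
  measurable_fun [set: g_sigma_algebraType G] (X : g_sigma_algebraType G -> R).
Proof.
move=> sG; split => [h _ B mB|h B mB].
  by rewrite setTI; apply: sub_sigma_algebra; exact: h.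
by have := h measurableT B mB; rewrite setTI /measurable /= sigma_algebra_id.
Qed.

Lemma measurable_wrt_fun G X : sub_algebra G -> measurable_wrt G X ->
  measurable_fun setT X.
Proof. by move=> [sG GM] h _ B mB; rewrite setTI; apply: GM; exact: h. Qed.

Lemma measurable_wrtS G H X : G `<=` H -> measurable_wrt G X -> measurable_wrt H X.
Proof. by move=> GH h B mB; apply: GH; exact: h. Qed.

Lemma measurable_wrtD G X Y : sub_algebra G -> measurable_wrt G X ->
  measurable_wrt G Y -> measurable_wrt G (fun w => X w + Y w).
Proof.
by move=> [sG _]; rewrite !measurable_wrtE// => ? ?; exact: measurable_funD.
Qed.

Lemma measurable_wrtB G X Y : sub_algebra G -> measurable_wrt G X ->
  measurable_wrt G Y -> measurable_wrt G (fun w => X w - Y w).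
Proof.
by move=> [sG _]; rewrite !measurable_wrtE// => ? ?; exact: measurable_funB.
Qed.

Lemma measurable_wrtM G X Y : sub_algebra G -> measurable_wrt G X ->
  measurable_wrt G Y -> measurable_wrt G (fun w => X w * Y w).
Proof.
by move=> [sG _]; rewrite !measurable_wrtE// => ? ?; exact: measurable_funM.
Qed.

Lemma measurable_wrt_cst G (c : R) : sub_algebra G -> measurable_wrt G (fun=> c).
Proof. by move=> [sG _]; rewrite measurable_wrtE//. Qed.

Lemma measurable_wrt_indic G A : sub_algebra G -> G A ->
  measurable_wrt G (\1_A : Omega -> R).
Proof.
move=> [sG _] GA; rewrite measurable_wrtE//; apply: measurable_indic.
exact: sub_sigma_algebra.
Qed.

Lemma sub_algebraI G A B : sub_algebra G -> G A -> G B -> G (A `&` B).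
Proof.
move=> [sG _]; have [_ _ _ h] := (sigma_algebraP (fun (A : set Omega) _ => @subsetT _ A)).1 sG.
exact: h.
Qed.

Lemma sub_algebraT G : sub_algebra G -> G setT.
Proof. by move=> [sG _]; have [] := (sigma_algebraP (fun (A : set Omega) _ => @subsetT _ A)).1 sG. Qed.

Lemma sub_algebra_sigma_of (S : set (Omega -> R)) :
  (forall X, S X -> measurable_fun setT X) -> sub_algebra (sigma_of S).
Proof.
move=> mS; split; first exact: smallest_sigma_algebra.
apply: smallest_sub.
  split; [exact: measurable0|by move=> A mA; rewrite setTD; exact: measurableC|].
  by move=> F mF; exact: bigcupT_measurable.
by move=> _ [X [B [SX mB ->]]]; rewrite -[_ @^-1` _]setTI; exact: mS.
Qed.

Lemma sigma_of_measurable_wrt (S : set (Omega -> R)) X :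
  S X -> measurable_wrt (sigma_of S) X.
Proof. by move=> SX B mB; apply: sub_sigma_algebra; exists X, B. Qed.

Lemma sigma_ofS (S S' : set (Omega -> R)) : S `<=` S' ->
  sigma_of S `<=` sigma_of S'.
Proof.
move=> SS'; apply: sub_sigma_algebra2 => _ [X [B [SX mB ->]]].
by exists X, B; split => //; exact: SS'.
Qed.

Lemma sigma_of_sub (S : set (Omega -> R)) G : sub_algebra G ->
  (forall X, S X -> measurable_wrt G X) -> sigma_of S `<=` G.
Proof.
by move=> [sG _] h; apply: smallest_sub => // _ [X [B [SX mB ->]]]; exact: h.
Qed.

End sub_sigma_algebras.

(** * Independence of joined sigma-algebras *)

Section independence.
Context {d} {Omega : measurableType d} {R : realType}.
Variable Pr : probability Omega R.
Implicit Types (G H : set (set Omega)) (X Y : Omega -> R).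

Lemma independent_mul G H X Y : sub_algebra G -> sub_algebra H ->
  independent Pr G H -> measurable_wrt G X -> measurable_wrt H Y ->
  Pr.-integrable setT (fun w => (X w)%:E) ->
  Pr.-integrable setT (fun w => (Y w)%:E) ->
  Pr.-integrable setT (fun w => (X w * Y w)%:E) /\
  \int[Pr]_w (X w * Y w) = (\int[Pr]_w X w) * (\int[Pr]_w Y w).
Proof.
move=> sG sH GH GX HY IX IY.
have mX := measurable_wrt_fun sG GX; have mY := measurable_wrt_fun sH HY.
have XY B C : measurable B -> measurable C ->
    (Pr (X @^-1` B `&` Y @^-1` C) = Pr (X @^-1` B) * Pr (Y @^-1` C))%E.
  by move=> mB mC; apply: GH; [exact: GX|exact: HY].
by split; [exact: integrable_indep_mul|exact: expectation_indep_mul].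
Qed.

(** Intersections of a set of [G] and a set of [H] form a pi-system that contains both
    sigma-algebras, hence all the generators of [sigma_of S]; the pi-lambda theorem concludes. *)
Lemma join_induction G H (P : set (set Omega)) : sub_algebra G ->
  sub_algebra H -> dynkin P ->
  (forall A B, G A -> H B -> P (A `&` B)) ->
  forall S, (forall X : Omega -> R, S X -> measurable_wrt G X \/ measurable_wrt H X) ->
  sigma_of S `<=` P.
Proof.
move=> sG sH dP PGH S hS.
pose J := [set C : set Omega | exists A B, [/\ G A, H B & C = A `&` B]].
have JI : setI_closed J.
  move=> _ _ [A [B [GA HB ->]]] [A' [B' [GA' HB' ->]]].
  exists (A `&` A'), (B `&` B'); split; [exact: sub_algebraI..|].
  by rewrite setIACA.
have JP : J `<=` P by move=> _ [A [B [GA HB ->]]]; exact: PGH.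
have sJ : <<s J >> `<=` P.
  rewrite -setI_closed_g_dynkin_g_sigma_algebra//.
  exact: smallest_sub.
apply: subset_trans sJ; apply: smallest_sub; first exact: smallest_sigma_algebra.
move=> _ [X [B [SX mB ->]]]; apply: sub_sigma_algebra.
have [GX|HX] := hS X SX.
  by exists (X @^-1` B), setT; split; [exact: GX|exact: sub_algebraT|rewrite setIT].
by exists setT, (X @^-1` B); split; [exact: sub_algebraT|exact: HX|rewrite setTI].
Qed.

Lemma dynkin_indep (D : set Omega) : measurable D ->
  dynkin [set A | measurable A /\ (Pr (A `&` D) = Pr A * Pr D)%E].
Proof.
move=> mD; split.
- by split; [exact: measurableT|rewrite setTI probability_setT mul1e].
- move=> A [mA hA]; split; first exact: measurableC.
  have fA : Pr A \is a fin_num by exact: fin_num_measure.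
  have fD : Pr D \is a fin_num by exact: fin_num_measure.
  have e : Pr D = (Pr (A `&` D) + Pr (~` A `&` D))%E.
    rewrite -measureU//; [|exact: measurableI|apply: measurableI => //; exact: measurableC|].
      by rewrite -setIUl setUv setTI.
    by rewrite setIACA setICr set0I.
  have fAD : Pr (A `&` D) \is a fin_num by rewrite fin_num_measure//; exact: measurableI.
  have -> : Pr (~` A `&` D) = (Pr D - Pr (A `&` D))%E.
    by rewrite {1}e addeAC subee// add0e.
  rewrite hA probability_setC// muleBl//.
  by rewrite mul1e.
- move=> F tF hF; split; first by apply: bigcupT_measurable => k; have [] := hF k.
  have mF k : measurable (F k) by have [] := hF k.
  rewrite setI_bigcupl measure_bigcup//; last 2 first.
  + by move=> k _; apply: measurableI.
  + apply/trivIsetP => i j _ _ ij; rewrite setIACA.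
    by move/trivIsetP : tF => /(_ i j I I ij) ->; rewrite set0I.
  rewrite measure_bigcup//.
  have fD : Pr D \is a fin_num by exact: fin_num_measure.
  rewrite muleC -(fineK fD) -nneseriesZl; last by move=> i _.
  by apply: eq_eseriesr => i _; rewrite fineK// muleC; case: (hF i).
Qed.

(** Independence of [K] from [G] and from [H] separately would not suffice, hence the hypothesis on
    intersections. For fixed [D] it spreads from them to the join by [dynkin_indep] and
    [join_induction]. *)
Lemma independent_join G H K : sub_algebra G -> sub_algebra H -> sub_algebra K ->
  (forall A B D, G A -> H B -> K D -> (Pr (A `&` B `&` D) = Pr (A `&` B) * Pr D)%E) ->
  forall S, (forall X : Omega -> R, S X -> measurable_wrt G X \/ measurable_wrt H X) ->
  independent Pr (sigma_of S) K.
Proof.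
move=> sG sH sK h S hS A D SA KD.
have mD : measurable D by case: sK => _; exact.
have := join_induction sG sH (dynkin_indep mD) _ hS.
case/(_ _)/(_ A SA) => // {A SA}A B GA HB; split; last exact: h.
by apply: measurableI; [case: sG => _; exact|case: sH => _; exact].
Qed.

End independence.

(** * Processes on a time interval *)

Section time_product.
Context {d} {Omega : measurableType d} {R : realType}.
Variable Pr : probability Omega R.
Local Notation leb := (@lebesgue_measure R).

Definition dtP : {measure set (measurableTypeR R * Omega) -> \bar R} := (leb \x Pr)%E.
Definition slab (a b : R) : set (measurableTypeR R * Omega) := `[a, b] `*` setT.
Definition L2t a b (f : R -> Omega -> R) := L2 dtP (slab a b) (fun p => f p.1 p.2).
Definition n2t a b (f : R -> Omega -> R) := n2 dtP (slab a b) (fun p => f p.1 p.2).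
Local Notation E X := (\int[Pr]_w (X w)).
Local Notation L2P := (L2 Pr setT).
Local Notation n2P := (n2 Pr setT).

Lemma ae_lebesgue_filter : Filter (nbhs (almost_everywhere leb)).
Proof. exact: (@ae_filter_ringOfSetsType _ _ _ leb). Qed.
#[local] Hint Extern 0 (Filter (nbhs (almost_everywhere _))) =>
  (exact: ae_lebesgue_filter) : typeclass_instances.

Lemma mitv (a b : R) : @measurable _ (measurableTypeR R) `[a, b].
Proof. exact: measurable_itv. Qed.
Hint Resolve mitv : core.

Lemma measurable_slab a b : measurable (slab a b).
Proof. exact: measurableX. Qed.
Hint Resolve measurable_slab : core.

Lemma slabS a b a' b' : a' <= a -> b <= b' -> slab a b `<=` slab a' b'.
Proof.
move=> aa bb [r w] [/= + _]; rewrite in_itv /= => /andP[ar rb]; split => //=.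
by rewrite in_itv /= (le_trans aa ar) (le_trans rb bb).
Qed.

Lemma L2tS a b a' b' f : a' <= a -> b <= b' -> L2t a' b' f -> L2t a b f.
Proof. by move=> aa bb; apply: L2S => //; exact: slabS. Qed.

Lemma n2tS a b a' b' f : a' <= a -> b <= b' -> L2t a' b' f ->
  n2t a b f <= n2t a' b' f.
Proof. by move=> aa bb; apply: n2S => //; exact: slabS. Qed.

Lemma patch_slab a b (f : measurableTypeR R * Omega -> \bar R) r w :
  (f \_ (slab a b)) (r, w) = ((fun r => f (r, w)) \_ `[a, b]) r.
Proof.
rewrite /patch; congr (if _ then _ else _).
by apply/idP/idP; rewrite !inE; [case|split].
Qed.

Lemma slab_tonelli a b (f : measurableTypeR R * Omega -> \bar R) : measurable_fun (slab a b) f ->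
  (forall p, slab a b p -> 0 <= f p)%E ->
  (\int[dtP]_(p in slab a b) f p = \int[leb]_(r in `[a, b]) \int[Pr]_w f (r, w))%E.
Proof.
move=> mf f0; rewrite integral_mkcond /dtP fubini_tonelli1; last 2 first.
- exact: (measurable_restrictT _ (measurable_slab a b)).1.
- by move=> p; rewrite /patch; case: ifPn => // /set_mem; exact: f0.
rewrite [RHS]integral_mkcond; apply: eq_integral => r _; rewrite /fubini_F.
under eq_integral do rewrite patch_slab.
rewrite /patch; case: ifPn => // _.
by rewrite integral0.
Qed.

Lemma slab_tonelli_measurable a b (f : measurableTypeR R * Omega -> \bar R) :
  measurable_fun (slab a b) f -> (forall p, slab a b p -> 0 <= f p)%E ->
  @measurable_fun _ _ (measurableTypeR R) _ `[a, b]
    (fun r => \int[Pr]_w f (r, w))%E.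
Proof.
move=> mf f0.
have h : measurable_fun setT (fubini_F Pr (f \_ (slab a b))).
  apply: measurable_fun_fubini_tonelli_F.
    exact: (measurable_restrictT _ (measurable_slab a b)).1.
  by move=> p; rewrite /patch; case: ifPn => // /set_mem; exact: f0.
apply: (eq_measurable_fun (fubini_F Pr (f \_ (slab a b)))).
  move=> r rab; rewrite /fubini_F; under eq_integral do rewrite patch_slab.
  by rewrite /patch rab.
exact: measurable_funTS.
Qed.

Lemma slab_tonelli2 a b (f : measurableTypeR R * Omega -> \bar R) : measurable_fun (slab a b) f ->
  (forall p, slab a b p -> 0 <= f p)%E ->
  (\int[dtP]_(p in slab a b) f p = \int[Pr]_w \int[leb]_(r in `[a, b]) f (r, w))%E.
Proof.
move=> mf f0; rewrite integral_mkcond /dtP fubini_tonelli2; last 2 first.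
- exact: (measurable_restrictT _ (measurable_slab a b)).1.
- by move=> p; rewrite /patch; case: ifPn => // /set_mem; exact: f0.
apply: eq_integral => w _; rewrite /fubini_G [RHS]integral_mkcond.
by under eq_integral do rewrite patch_slab.
Qed.

Lemma measurable_slice a b d' (T' : measurableType d') (f : measurableTypeR R * Omega -> T') r :
  measurable_fun (slab a b) f -> a <= r <= b -> measurable_fun setT (fun w => f (r, w)).
Proof.
move=> mf rab; apply: (measurable_comp (measurable_slab a b) _ mf).
  by move=> _ [w _ <-]; split => //=; rewrite in_itv.
exact: measurable_fun_pair.
Qed.

Lemma measurable_path a b d' (T' : measurableType d') (f : measurableTypeR R * Omega -> T') w :
  measurable_fun (slab a b) f -> measurable_fun `[a, b] (fun r => f (r, w)).
Proof.
move=> mf.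
have mp : measurable_fun setT (fun r : R => (r, w)).
  exact: measurable_fun_pair.
move=> mab B mB; have := mf (measurable_slab a b) B mB.
move=> /(mp measurableT); rewrite setTI; congr measurable.
by apply/seteqP; split => r /=; [move=> [[]]|move=> []].
Qed.

Lemma slab_fubini a b (f : measurableTypeR R * Omega -> \bar R) :
  dtP.-integrable (slab a b) f ->
  [/\ measurable_fun setT (fun w => \int[leb]_(r in `[a, b]) f (r, w))%E /\
      @measurable_fun _ _ (measurableTypeR R) _ `[a, b]
        (fun r => \int[Pr]_w f (r, w))%E,
    {ae Pr, forall w, leb.-integrable `[a, b] (fun r => f (r, w))},
    {ae leb, forall r, a <= r <= b -> Pr.-integrable setT (fun w => f (r, w))},
    (\int[dtP]_(p in slab a b) f p =
      \int[leb]_(r in `[a, b]) \int[Pr]_w f (r, w))%E &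
    (\int[dtP]_(p in slab a b) f p =
      \int[Pr]_w \int[leb]_(r in `[a, b]) f (r, w))%E].
Proof.
move=> If; have If' : dtP.-integrable setT (f \_ (slab a b)).
  exact/(integrable_mkcond _ (measurable_slab a b)).1.
have G w : fubini_G leb (f \_ (slab a b)) w = (\int[leb]_(r in `[a, b]) f (r, w))%E.
  by rewrite /fubini_G [RHS]integral_mkcond; under eq_integral do rewrite patch_slab.
have F r : fubini_F Pr (f \_ (slab a b)) r =
    ((fun r => \int[Pr]_w f (r, w))%E \_ `[a, b]) r.
  rewrite /fubini_F; under eq_integral do rewrite patch_slab.
  by rewrite /patch; case: ifPn => // _; rewrite integral0.
split.
- split; first by rewrite -(funext G); exact: (measurable_fubini_G If').
  apply: (eq_measurable_fun (fubini_F Pr (f \_ (slab a b)))).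
    by move=> r rab; rewrite F /patch rab.
  by apply: measurable_funTS; exact: (measurable_fubini_F If').
- have := ae_integrable2 If'; apply: filterS => w h.
  by apply/(integrable_mkcond _ _).2 => //; apply: eq_integrable h => // r _; rewrite patch_slab.
- have := ae_integrable1 If'; apply: filterS => r h rab.
  apply: eq_integrable h => // w _; rewrite patch_slab /patch ifT//.
  by rewrite inE /= in_itv.
- by rewrite [LHS]integral_mkcond [RHS]integral_mkcond -(funext F) -integral12_prod_meas1.
- rewrite [LHS]integral_mkcond.
  apply: etrans (esym (integral21_prod_meas1 If')) _.
  by apply: eq_integral => w _; exact: G.
Qed.

Lemma ae_time_slab a b (Q : R -> Prop) :
  {ae leb, forall r, a <= r <= b -> Q r} ->
  {ae dtP, forall p, slab a b p -> Q p.1}.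
Proof.
move=> [A [mA A0 hA]]; exists (A `*` setT); split.
- exact: measurableX.
- by rewrite /dtP /= product_measure1E// [X in (X * _)%E](_ : _ = 0%E) ?mul0e.
- move=> [r w] /= h; split => //=; apply: hA => /= h'; apply: h.
  by move=> [/= + _]; rewrite in_itv; exact: h'.
Qed.

(** A null set of the product has null sections at almost every time, because the measure of its
    sections has integral zero. *)
Lemma slab_ae_slices a b (Q : R -> Omega -> Prop) :
  {ae dtP, forall p, slab a b p -> Q p.1 p.2} ->
  {ae leb, forall r, a <= r <= b -> {ae Pr, forall w, Q r w}}.
Proof.
move=> [A [mA A0 hA]].
have : (\int[leb]_r Pr (xsection A r) = 0)%E by rewrite -A0 /dtP.
have mx : measurable_fun setT (fun r => Pr (xsection A r)).
  exact: (measurable_fun_xsection Pr mA).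
move=> I0.
have : ae_eq leb setT (fun r => Pr (xsection A r)) (cst 0%E).
  apply/ae_eq_integral_abs => //.
  by rewrite -[RHS]I0; apply: eq_integral => r _; rewrite gee0_abs.
apply: filterS => r /(_ I) h rab; exists (xsection A r); split => //.
  exact: measurable_xsection.
move=> w /= nQ; rewrite /xsection /= inE; apply: hA => /= h'; apply: nQ; apply: h'.
by split => //=; rewrite in_itv.
Qed.

Lemma L2t_slices a b f : L2t a b f ->
  {ae leb, forall r, a <= r <= b -> L2P (f r)}.
Proof.
move=> [mf If]; have [_ _ h _ _] := slab_fubini If.
apply: filterS h => r h rab; split; last exact: h.
exact: (measurable_slice mf rab).
Qed.

Lemma L2t_paths a b f : L2t a b f ->
  {ae Pr, forall w, L2 leb `[a, b] (f ^~ w)}.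
Proof.
move=> [mf If]; have [_ h _ _ _] := slab_fubini If.
apply: filterS h => w h; split; last exact: h.
exact: (measurable_path w mf).
Qed.

Lemma L2_cst1 a b : L2 leb `[a, b] (fun=> 1 : R).
Proof.
split => //; apply: (eq_integrable _ (cst 1%E)) => //.
  by move=> r _; rewrite expr1n.
apply: (@measurable_bounded_integrable _ _ _ _ (cst 1)) => //.
  by rewrite /= lebesgue_measure_itv /=; case: ifP => _; rewrite ltry.
by exists 1; split => // x x1 r _ /=; rewrite normr1 ltW.
Qed.

Lemma n2_cst1 a b : a <= b -> n2 leb `[a, b] (fun=> 1) = Num.sqrt (b - a).
Proof.
move=> ab; rewrite /n2 /ip (_ : (fun _ => _) = cst 1).
  by rewrite Rintegral_cst// mul1r /= lebesgue_measure_itv /= lte_fin;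
   move: ab; rewrite le_eqVlt => /orP[/eqP ->|->//]; rewrite ltxx subrr.
by apply/funext => r; rewrite mulr1.
Qed.

Lemma path_integrable a b f : L2t a b f ->
  {ae Pr, forall w, leb.-integrable `[a, b] (fun r => (f r w)%:E)}.
Proof.
move=> Lf; apply: filterS (L2t_paths Lf) => w Lw.
have := L2_mul (mitv a b) Lw (L2_cst1 a b).
by apply: eq_integrable => // r _; rewrite mulr1.
Qed.

Lemma L2t_fun a b (X : Omega -> R) : L2P X -> L2t a b (fun=> X).
Proof.
move=> [mX IX]; apply: L2_finite_integral => //.
  by apply: measurable_funTS; exact: (measurableT_comp mX).
rewrite slab_tonelli//; last 2 first.
- apply/measurable_EFinP/measurable_funX; apply: measurable_funTS.
  exact: (measurableT_comp mX).
- by move=> p _; rewrite lee_fin sqr_ge0.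
rewrite (_ : (fun r : R => _) = cst (\int[Pr]_w (X w ^+ 2)%:E)%E)//.
rewrite integral_cst//; apply: lte_mul_pinfty => //.
- by apply: integral_ge0 => w _; rewrite lee_fin sqr_ge0.
- exact: integrable_fin_num.
- by rewrite /= lebesgue_measure_itv /=; case: ifP => _; rewrite ltry.
Qed.

Lemma n2tE a b f : L2t a b f ->
  ((n2t a b f ^+ 2)%:E = \int[leb]_(r in `[a, b]) \int[Pr]_w ((f r w) ^+ 2)%:E)%E.
Proof.
move=> Lf; rewrite n2E// slab_tonelli//.
  by apply/measurable_EFinP/measurable_funX; case: Lf.
by move=> p _; rewrite lee_fin sqr_ge0.
Qed.

(** Passing from bounds at each time to L2 in time gains [sqrt(b - a)]. Together with [tint_L2] this
    is what makes short intervals contract. *)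
Lemma n2t_slices_le a b f (K : R) : a <= b -> 0 <= K ->
  measurable_fun (slab a b) (fun p => f p.1 p.2) ->
  (forall r, a <= r <= b -> L2P (f r) /\ n2P (f r) <= K) ->
  L2t a b f /\ n2t a b f <= Num.sqrt (b - a) * K.
Proof.
move=> ab K0 mf h.
have I : (\int[leb]_(r in `[a, b]) \int[Pr]_w ((f r w) ^+ 2)%:E
    <= ((b - a) * K ^+ 2)%:E)%E.
  apply: (@le_trans _ _ (\int[leb]_(r in `[a, b]) (cst (K ^+ 2)%:E r))%E).
    apply: ge0_le_integral => //.
    - by move=> r _; apply: integral_ge0 => w _; rewrite lee_fin sqr_ge0.
    - apply: (slab_tonelli_measurable (f := fun p => ((f p.1 p.2) ^+ 2)%:E)).
        by apply/measurable_EFinP; exact: measurable_funX.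
      by move=> p _; rewrite lee_fin sqr_ge0.
    - move=> r; rewrite /= in_itv /= => /h[Lf fK].
      by rewrite -n2E// lee_fin lerXn2r ?nnegrE ?n2_ge0.
  rewrite integral_cst//= lebesgue_measure_itv /= lte_fin.
  move: ab; rewrite le_eqVlt => /orP[/eqP ->|->].
    by rewrite ltxx mule0 subrr mul0r.
  by rewrite -EFinM lee_fin mulrC.
have Lf : L2t a b f.
  apply: L2_finite_integral => //; rewrite slab_tonelli//=.
  - by rewrite (le_lt_trans I)// ltry.
  - by apply/measurable_EFinP; exact: measurable_funX.
  - by move=> p _; rewrite lee_fin sqr_ge0.
split => //.
rewrite -(ler_pXn2r (ltn0Sn 1)) ?nnegrE ?mulr_ge0 ?n2_ge0 ?sqrtr_ge0//.
by rewrite exprMn [X in _ <= X * _]sqr_sqrtr ?subr_ge0// -lee_fin n2tE.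
Qed.

Definition tint (f : R -> Omega -> R) a b w : R := \int[leb]_(r in `[a, b]) f r w.

Lemma L2t_mul a b f g : L2t a b f -> L2t a b g ->
  dtP.-integrable (slab a b) (fun p => (f p.1 p.2 * g p.1 p.2)%:E).
Proof. by move=> Lf Lg; exact: (L2_mul (measurable_slab a b) Lf Lg). Qed.

Lemma L2t_integrable a b f : L2t a b f ->
  dtP.-integrable (slab a b) (fun p => (f p.1 p.2)%:E).
Proof.
move=> Lf.
have L1 : L2P (fun=> 1).
  split => //; apply: (eq_integrable _ (cst 1%E)) => //.
    by move=> r _; rewrite expr1n.
  exact: finite_measure_integrable_cst.
have := L2t_mul Lf (L2t_fun a b L1).
by apply: eq_integrable => // p _; rewrite mulr1.
Qed.

(** Cauchy-Schwarz against the constant 1 on almost every path, then Tonelli. *)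
Lemma tint_L2 a b f : a <= b -> L2t a b f ->
  L2P (tint f a b) /\ n2P (tint f a b) <= Num.sqrt (b - a) * n2t a b f.
Proof.
move=> ab Lf; have [[mG _] _ _ _ _] := slab_fubini (L2t_integrable Lf).
have mt : measurable_fun setT (tint f a b).
  by apply: measurableT_comp => //; exact: fine_measurable.
have I : (\int[Pr]_w ((tint f a b w) ^+ 2)%:E <= ((b - a) * n2t a b f ^+ 2)%:E)%E.
  have -> : (((b - a) * n2t a b f ^+ 2)%:E =
      \int[Pr]_w ((b - a)%:E * \int[leb]_(r in `[a, b]) ((f r w) ^+ 2)%:E))%E.
    rewrite ge0_integralZl//; last 3 first.
    - have [[m2 _] _ _ _ _] := slab_fubini (proj2 Lf); exact: m2.
    - by move=> w _; apply: integral_ge0 => r _; rewrite lee_fin sqr_ge0.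
    - by rewrite lee_fin subr_ge0.
    rewrite EFinM n2E// slab_tonelli2//.
      by apply/measurable_EFinP/measurable_funX; case: Lf.
    by move=> p _; rewrite lee_fin sqr_ge0.
  apply: ae_ge0_le_integral => //.
  - by move=> w _; rewrite lee_fin sqr_ge0.
  - by apply/measurable_EFinP; exact: measurable_funX.
  - move=> w _; rewrite mule_ge0// ?lee_fin ?subr_ge0//.
    by apply: integral_ge0 => r _; rewrite lee_fin sqr_ge0.
  - apply: measurable_funeM; have [[m2 _] _ _ _ _] := slab_fubini (proj2 Lf); exact: m2.
  apply: filterS (L2t_paths Lf) => w Lw _.
  rewrite -n2E// -EFinM lee_fin.
  have := cauchy_schwarz (mitv a b) (L2_cst1 a b) Lw.
  rewrite n2_cst1// => h.
  have -> : tint f a b w = ip leb `[a, b] (fun=> 1) (f ^~ w).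
    by rewrite /tint /ip; congr Rintegral; apply/funext => r; rewrite mul1r.
  rewrite -(real_normK (num_real (ip _ _ _ _))).
  rewrite -[X in X * _](sqr_sqrtr (_ : 0 <= b - a)) ?subr_ge0// -exprMn.
  by rewrite lerXn2r ?nnegrE ?mulr_ge0 ?sqrtr_ge0 ?n2_ge0.
have Lt : L2P (tint f a b).
  by apply: L2_finite_integral => //; rewrite (le_lt_trans I)// ltry.
split => //.
rewrite -(ler_pXn2r (ltn0Sn 1)) ?nnegrE ?mulr_ge0 ?n2_ge0 ?sqrtr_ge0//.
by rewrite exprMn [X in _ <= X * _]sqr_sqrtr ?subr_ge0// -lee_fin (n2E measurableT Lt).
Qed.

Lemma tint_split a b c f : a <= b -> b <= c -> L2t a c f ->
  {ae Pr, forall w, tint f a c w = tint f a b w + tint f b c w}.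
Proof.
move=> ab bc Lf; apply: filterS (path_integrable Lf) => w Iw.
have := @Rintegral_itvB _ (f ^~ w) (BLeft a) (BRight c) b Iw.
rewrite !bnd_simp => /(_ ab bc); rewrite Rintegral_itv_obnd_cbnd.
  by rewrite /tint => <-; rewrite addrC subrK.
apply: (integrableS (mitv a c) _ _ Iw); first exact: measurable_itv.
by move=> r /=; rewrite !in_itv /= => /andP[br ->]; rewrite (le_trans ab (ltW br)).
Qed.

(** Real-valued integrals take a default value where the inner integral is not finite; by Fubini
    this happens only on null sets, so the iterated integrals are unaffected. *)
Lemma slab_Rfubini a b (f : R -> Omega -> R) :
  dtP.-integrable (slab a b) (fun p => (f p.1 p.2)%:E) ->
  [/\ leb.-integrable `[a, b] (fun r => (E (f r))%:E),
      Pr.-integrable setT (fun w => (tint f a b w)%:E),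
      \int[dtP]_(p in slab a b) f p.1 p.2 = \int[leb]_(r in `[a, b]) E (f r) &
      \int[dtP]_(p in slab a b) f p.1 p.2 = E (tint f a b)].
Proof.
move=> If; have [[mG mF] Ip Is eF eG] := slab_fubini If.
have mF' : @measurable_fun _ _ (measurableTypeR R) _ `[a, b]
    (fun r => (E (f r))%:E).
  by apply/measurable_EFinP/measurableT_comp; [exact: fine_measurable|exact: mF].
have mG' : measurable_fun setT (fun w => (tint f a b w)%:E).
  by apply/measurable_EFinP/measurableT_comp; [exact: fine_measurable|exact: mG].
have aF : {ae leb, forall r, a <= r <= b ->
    ((E (f r))%:E = \int[Pr]_w (f r w)%:E)%E}.
  apply: filterS Is => r h rab; rewrite /Rintegral fineK//.
  by apply: integrable_fin_num => //; exact: h.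
have aG : {ae Pr, forall w,
    ((tint f a b w)%:E = \int[leb]_(r in `[a, b]) (f r w)%:E)%E}.
  apply: filterS Ip => w h; rewrite /tint /Rintegral fineK//.
  by apply: (integrable_fin_num (mitv a b)); exact: h.
(* [fine] maps infinite values to 0, so it can only decrease absolute values. *)
have fine_le (x : \bar R) : (`|(fine x)%:E| <= `|x|)%E.
  by case: x => [x| |] //=; rewrite normr0 leey.
have [mf Ia] := integrableP _ _ _ If.
have Ifa : dtP.-integrable (slab a b)
    (abse \o (fun p : measurableTypeR R * Omega => (f p.1 p.2)%:E)).
  exact: (integrable_abse If).
have [[mGa mFa] _ _ eFa eGa] := slab_fubini Ifa.
have IJ : leb.-integrable `[a, b] (fun r => (E (f r))%:E).
  apply/integrableP; split => //.
  apply: le_lt_trans Ia; rewrite eFa.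
  apply: ge0_le_integral => //.
  + by apply: measurableT_comp => //; exact: mF'.
  + move=> r; rewrite /= in_itv => rab.
    apply: le_trans (fine_le _) _; apply: le_abse_integral => //.
    exact: (measurable_slice mf rab).
have IG : Pr.-integrable setT (fun w => (tint f a b w)%:E).
  apply/integrableP; split => //.
  apply: le_lt_trans Ia; rewrite eGa.
  apply: ge0_le_integral => //.
  + by apply: measurableT_comp => //; exact: mG'.
  + move=> w _; apply: le_trans (fine_le _) _.
    apply: (le_abse_integral _ (mitv a b)).
    exact: (measurable_path w mf).
split => //.
- rewrite {1}/Rintegral eF /Rintegral; congr fine; apply: ae_eq_integral => //.
  by apply: filterS aF => r h; rewrite /= in_itv => /h.
- rewrite {1}/Rintegral eG /Rintegral; congr fine; apply: ae_eq_integral => //.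
  by apply: filterS aG => w h _.
Qed.

End time_product.

#[local] Hint Extern 0 (Filter (nbhs (almost_everywhere _))) =>
  (exact: ae_lebesgue_filter) : typeclass_instances.
#[local] Hint Resolve mitv measurable_slab : core.

(** * Moments of the normal law *)

Section normal_moments.
Context {R : realType}.
Local Notation leb := (@lebesgue_measure R).
Implicit Types s x : R.

(** The density coincides almost everywhere with the Radon-Nikodym derivative, for which the change
    of variables is available, because both have the same integral over every measurable set. *)
Lemma normal_prob_integral (s : R) (f : measurableTypeR R -> \bar R) :
  measurable_fun setT f -> (forall x, 0 <= f x)%E ->
  (\int[normal_prob 0 s]_x f x = \int[leb]_x (f x * (normal_pdf 0 s x)%:E))%E.
Proof.
move=> mf f0; have dom := normal_prob_dominates 0 s.
rewrite -(Radon_Nikodym_SigmaFinite.change_of_variables dom)//.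
have Ip := Radon_Nikodym_SigmaFinite.f_integrable dom.
have mp : measurable_fun setT (fun x => (normal_pdf 0 s x)%:E).
  by apply/measurable_EFinP; exact: measurable_normal_pdf.
have e : ae_eq leb setT
    (Radon_Nikodym_SigmaFinite.f (normal_prob 0 s) leb)
    (fun x => (normal_pdf 0 s x)%:E).
  apply: integral_ae_eq => // A _ mA.
  by rewrite -Radon_Nikodym_SigmaFinite.f_integral.
apply: ae_eq_integral => //.
- by apply: emeasurable_funM => //; exact: measurable_int Ip.
- exact: emeasurable_funM.
- by apply: filterS e => x h _; rewrite h.
Qed.

Lemma normal_pdf_exp s x : 0 < s ->
  normal_pdf 0 s x = (Num.sqrt (pi *+ 2))^-1 / s * expR (- (x ^+ 2 / (2 * s ^+ 2))).
Proof.
move=> s0; rewrite normal_pdfE ?gt_eqF// /normal_peak /normal_fun subr0.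
congr (_ * _).
  rewrite -mulrnAr sqrtrM ?sqr_ge0// sqrtr_sqr gtr0_norm// invfM mulrC//.
by rewrite mulNr -mulr_natl.
Qed.

Let pdfM s s' x : 0 < s -> 0 < s' ->
  s / s' * normal_pdf 0 s x = (Num.sqrt (pi *+ 2))^-1 / s' * expR (- (x ^+ 2 / (2 * s ^+ 2))).
Proof.
move=> s0 s0'; rewrite normal_pdf_exp//; set c := (Num.sqrt _)^-1; set e := expR _.
by field; rewrite !gt_eqF.
Qed.

(* The variance is obtained without integration by parts: [expR_ge1Dx] compares the
   densities of deviations [s] and [s'], hence [V_ub] and [V_lb], and [s'] tends to [s]. *)
Lemma normal_pdf_le s s' x : 0 < s -> s < s' ->
  normal_pdf 0 s x * (1 + ((s ^- 2 - s' ^- 2) / 2) * x ^+ 2)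
    <= s' / s * normal_pdf 0 s' x.
Proof.
move=> s0 ss; have s0' := lt_trans s0 ss.
rewrite pdfM// normal_pdf_exp// -[leLHS]mulrA ler_wpM2l//.
  by rewrite divr_ge0 ?invr_ge0 ?sqrtr_ge0// ltW.
have -> : - (x ^+ 2 / (2 * s' ^+ 2)) = - (x ^+ 2 / (2 * s ^+ 2)) + (s ^- 2 - s' ^- 2) / 2 * x ^+ 2.
  by field; rewrite !gt_eqF.
by rewrite expRD ler_wpM2l ?expR_ge0// expR_ge1Dx.
Qed.

Lemma normal_pdf_ge s s' x : 0 < s' -> s' < s ->
  normal_pdf 0 s x <= ((s' ^- 2 - s ^- 2) / 2) * (x ^+ 2 * normal_pdf 0 s x)
     + s' / s * normal_pdf 0 s' x.
Proof.
move=> s0' ss; have s0 := lt_trans s0' ss.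
rewrite pdfM// normal_pdf_exp//.
have -> : - (x ^+ 2 / (2 * s' ^+ 2)) = - (x ^+ 2 / (2 * s ^+ 2)) + (- ((s' ^- 2 - s ^- 2) / 2 * x ^+ 2)).
  by field; rewrite !gt_eqF.
rewrite expRD; set h := _ * x ^+ 2; set e := expR (- (_ / _)).
set c := _ / s; have c0 : 0 <= c by rewrite divr_ge0 ?invr_ge0 ?sqrtr_ge0// ltW.
have e0 : 0 <= e by exact: expR_ge0.
have := expR_ge1Dx (- h); set g := expR _ => hg.
have -> : (s' ^- 2 - s ^- 2) / 2 * (x ^+ 2 * (c * e)) = h * (c * e).
  by rewrite mulrA.
have ce0 : 0 <= c * e by rewrite mulr_ge0.
have := ler_wpM2l ce0 hg; rewrite mulrA; lra.
Qed.

Let V s : \bar R := (\int[leb]_x (x ^+ 2 * normal_pdf 0 s x)%:E)%E.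

Let mpdf s (c : R) : @measurable_fun _ _ (measurableTypeR R) _ setT
  (fun x => (c * normal_pdf 0 s x)%:E).
Proof. by apply/measurable_EFinP/measurable_funM => //; exact: measurable_normal_pdf. Qed.

Let mpdf2 s (c : R) : @measurable_fun _ _ (measurableTypeR R) _ setT
  (fun x => (c * (x ^+ 2 * normal_pdf 0 s x))%:E).
Proof.
apply/measurable_EFinP/measurable_funM => //; apply: measurable_funM.
  exact: measurable_funX.
exact: measurable_normal_pdf.
Qed.

Let Ipdf s (c : R) : 0 <= c -> (\int[leb]_x (c * normal_pdf 0 s x)%:E = c%:E)%E.
Proof.
move=> c0; under eq_integral do rewrite EFinM.
rewrite ge0_integralZl//; last 2 first.
- by apply/measurable_EFinP; exact: measurable_normal_pdf.
- by move=> x _; rewrite lee_fin normal_pdf_ge0.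
by rewrite integral_normal_pdf mule1.
Qed.

Let Ipdf2 s (c : R) : 0 <= c ->
  (\int[leb]_x (c * (x ^+ 2 * normal_pdf 0 s x))%:E = c%:E * V s)%E.
Proof.
move=> c0; under eq_integral do rewrite EFinM.
rewrite ge0_integralZl//.
- by have := mpdf2 s 1; congr measurable_fun; apply/funext => x; rewrite mul1r.
- by move=> x _; rewrite lee_fin mulr_ge0 ?sqr_ge0 ?normal_pdf_ge0.
Qed.

Let V_ub s s' : 0 < s -> s < s' ->
  (((s ^- 2 - s' ^- 2) / 2)%:E * V s + 1 <= (s' / s)%:E)%E.
Proof.
move=> s0 ss; have s0' := lt_trans s0 ss.
have h0 : 0 <= (s ^- 2 - s' ^- 2) / 2.
  by rewrite divr_ge0// subr_ge0 lef_pV2 ?posrE ?exprn_gt0// lerXn2r ?nnegrE ?ltW.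
have q0 : 0 <= s' / s by rewrite divr_ge0 ?ltW.
rewrite -Ipdf2// -(Ipdf s' q0).
set h := _ / 2 in h0 *.
have p1 : forall x : measurableTypeR R, setT x -> (0 <= (h * (x ^+ 2 * normal_pdf 0 s x))%:E)%E.
  by move=> x _; rewrite lee_fin mulr_ge0// mulr_ge0 ?sqr_ge0 ?normal_pdf_ge0.
have p2 : forall x : measurableTypeR R, setT x -> (0 <= (1 * normal_pdf 0 s x)%:E)%E.
  by move=> x _; rewrite lee_fin mul1r normal_pdf_ge0.
rewrite -[X in (_ + X)%E](Ipdf s ler01).
rewrite -(ge0_integralD leb measurableT p1 (mpdf2 s h) p2 (mpdf s 1)).
apply: ge0_le_integral => //.
- by move=> x _; rewrite adde_ge0 ?p1 ?p2.
- by apply: emeasurable_funD; [exact: mpdf2|exact: mpdf].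
- move=> x _; rewrite -EFinD lee_fin.
  have := normal_pdf_le x s0 ss; rewrite -/h; lra.
Qed.

Let V_lb s s' : 0 < s' -> s' < s ->
  (1 <= ((s' ^- 2 - s ^- 2) / 2)%:E * V s + (s' / s)%:E)%E.
Proof.
move=> s0' ss; have s0 := lt_trans s0' ss.
have h0 : 0 <= (s' ^- 2 - s ^- 2) / 2.
  by rewrite divr_ge0// subr_ge0 lef_pV2 ?posrE ?exprn_gt0// lerXn2r ?nnegrE ?ltW.
have q0 : 0 <= s' / s by rewrite divr_ge0 ?ltW.
rewrite -Ipdf2// -(Ipdf s' q0).
set h := _ / 2 in h0 *.
have p1 : forall x : measurableTypeR R, setT x -> (0 <= (h * (x ^+ 2 * normal_pdf 0 s x))%:E)%E.
  by move=> x _; rewrite lee_fin mulr_ge0// mulr_ge0 ?sqr_ge0 ?normal_pdf_ge0.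
have p2 : forall x : measurableTypeR R, setT x -> (0 <= (s' / s * normal_pdf 0 s' x)%:E)%E.
  by move=> x _; rewrite lee_fin mulr_ge0 ?normal_pdf_ge0.
rewrite -[X in (X <= _)%E](Ipdf s ler01).
rewrite -(ge0_integralD leb measurableT p1 (mpdf2 s h) p2 (mpdf s' (s' / s))).
apply: ge0_le_integral => //.
- by move=> x _; rewrite lee_fin mul1r normal_pdf_ge0.
- by apply: emeasurable_funD; [exact: mpdf2|exact: mpdf].
- move=> x _; rewrite -EFinD lee_fin mul1r; exact: normal_pdf_ge.
Qed.

Lemma normal_second_moment s : 0 < s ->
  (\int[normal_prob 0 s]_x (x ^+ 2)%:E = (s ^+ 2)%:E)%E.
Proof.
move=> s0; rewrite normal_prob_integral//; last 2 first.
- by apply/measurable_EFinP; exact: measurable_funX.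
- by move=> x; rewrite lee_fin sqr_ge0.
transitivity (V s); first by apply: eq_integral => x _; rewrite EFinM.
have V0 : (0 <= V s)%E.
  by apply: integral_ge0 => x _; rewrite lee_fin mulr_ge0 ?sqr_ge0 ?normal_pdf_ge0.
have Vfin : V s \is a fin_num.
  (* A single larger deviation, here 2 s, already bounds [V s], whose coefficient in [V_ub] is
     positive. *)
  rewrite ge0_fin_numE//; have ss : s < 2 * s by lra.
  have := V_ub s0 ss; case: (V s) V0 => [v| |]//= _; first by rewrite ltry.
  rewrite gt0_muley// lte_fin divr_gt0// subr_gt0 ltf_pV2 ?posrE ?exprn_gt0//; last by lra.
  by rewrite ltrXn2r// ?nnegrE; lra.
(* [V_ub] at s' = (1 + e) s, divided by e; the limit e -> 0 gives the upper bound s^2. The next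
   claim treats s' = (1 - e) s in the same way. *)
have ub (e : R) : 0 < e -> fine (V s) * (2 + e) <= 2 * s ^+ 2 * (1 + e) ^+ 2.
  move=> e0; have ss : s < (1 + e) * s by rewrite mulrDl mul1r ltrDl mulr_gt0.
  have := V_ub s0 ss; rewrite -(fineK Vfin) -EFinM -EFinD lee_fin.
  set v := fine _; rewrite mulfK ?gt_eqF// => h.
  have {}h : (s ^- 2 - ((1 + e) * s) ^- 2) / 2 * v <= e by lra.
  have E1 : (s ^- 2 - ((1 + e) * s) ^- 2) / 2 = e * ((2 + e) / (2 * s ^+ 2 * (1 + e) ^+ 2)).
    by field; rewrite !gt_eqF// addr_gt0.
  move: h; rewrite E1 -(mulrA e) ger_pMr//.
  rewrite mulrAC ler_pdivrMr ?mul1r.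
    by rewrite (mulrC (2 + e)).
  by rewrite !mulr_gt0// ?exprn_gt0// addr_gt0.
have lb (e : R) : 0 < e -> e < 1 -> 2 * s ^+ 2 * (1 - e) ^+ 2 <= fine (V s) * (2 - e).
  move=> e0 e1; have ss : (1 - e) * s < s by rewrite mulrBl mul1r ltrBlDl ltrDr mulr_gt0.
  have s0' : 0 < (1 - e) * s by rewrite mulr_gt0// subr_gt0.
  have := V_lb s0' ss; rewrite -(fineK Vfin) -EFinM -EFinD lee_fin.
  set v := fine _; rewrite mulfK ?gt_eqF// => h.
  have {}h : e <= (((1 - e) * s) ^- 2 - s ^- 2) / 2 * v by lra.
  have e1' : 0 < 1 - e by rewrite subr_gt0.
  have E1 : (((1 - e) * s) ^- 2 - s ^- 2) / 2 = e * ((2 - e) / (2 * s ^+ 2 * (1 - e) ^+ 2)).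
    by field; rewrite !gt_eqF.
  move: h; rewrite E1 -(mulrA e) ler_pMr//.
  rewrite mulrAC ler_pdivlMr ?mul1r.
    by rewrite (mulrC (2 - e)).
  by rewrite !mulr_gt0// ?exprn_gt0.
rewrite -(fineK Vfin); congr EFin; set v := fine _ in ub lb *.
have v0 : 0 <= v by exact: fine_ge0.
have S0 : 0 < s ^+ 2 by rewrite exprn_gt0.
apply/eqP; rewrite eq_le; apply/andP; split.
  apply/ler_addgt0Pr => d d0.
  (* For e <= 1 one has (1 + e)^2 <= 1 + 3 e, so the excess over s^2 is at most 3 e s^2 <= d. *)
  pose e := Num.min 1 (d / (3 * s ^+ 2)).
  have e0 : 0 < e by rewrite lt_min ltr01 divr_gt0// mulr_gt0.
  have e1 : e <= 1 by rewrite ge_min lexx.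
  have ed : e * (3 * s ^+ 2) <= d by rewrite -ler_pdivlMr ?mulr_gt0// ge_min lexx orbT.
  have := ub e e0; move: v0 S0; set S := s ^+ 2 in ed *; move=> v0 S0 h.
  have h2 : 2 * S * (1 + e) ^+ 2 <= 2 * S * (1 + 3 * e).
    by apply: ler_wpM2l; [apply: mulr_ge0 => //; exact: ltW|nra].
  have : v * 2 <= v * (2 + e) by rewrite ler_wpM2l//; lra.
  lra.
apply/ler_addgt0Pr => d d0.
(* From (1 - e)^2 >= 1 - 2 e the defect is at most 2 e s^2 <= d; the bound 1/2 keeps e < 1, as [lb]
   asks. *)
pose e := Num.min 2^-1 (d / (2 * s ^+ 2)).
have e0 : 0 < e by rewrite lt_min invr_gt0 ltr0n /= divr_gt0// mulr_gt0.
have e1 : e <= 2^-1 by rewrite ge_min lexx.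
have ed : e * (2 * s ^+ 2) <= d by rewrite -ler_pdivlMr ?mulr_gt0// ge_min lexx orbT.
have e1' : e < 1 by lra.
have := lb e e0 e1'; move: v0 S0; set S := s ^+ 2 in ed *; move=> v0 S0 h.
have h2 : 2 * S * (1 - 2 * e) <= 2 * S * (1 - e) ^+ 2.
  by apply: ler_wpM2l; [apply: mulr_ge0 => //; exact: ltW|nra].
have : v * (2 - e) <= v * 2 by rewrite ler_wpM2l//; lra.
lra.
Qed.

(** Integrability follows from |x| <= 1 + x^2. The mean vanishes because the reflection x -> -x
    preserves the density and exchanges the positive and negative parts of x. *)
Lemma normal_first_moment s : 0 < s ->
  (normal_prob 0 s).-integrable setT (fun x : measurableTypeR R => x%:E) /\
  \int[normal_prob 0 s]_x x = 0.
Proof.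
move=> s0.
have I1 : (normal_prob 0 s).-integrable setT (fun x : measurableTypeR R => x%:E).
  have I2 : (normal_prob 0 s).-integrable setT
      (fun x : measurableTypeR R => (1 + x ^+ 2)%:E).
    apply/integrableP; split.
      by apply/measurable_EFinP/measurable_funD => //; exact: measurable_funX.
    under eq_integral => x _.
      rewrite abse_EFin ger0_norm ?addr_ge0 ?sqr_ge0// EFinD; over.
    rewrite ge0_integralD//=.
    - rewrite normal_second_moment// [X in (X + _)%E](_ : _ = 1%:E).
        by rewrite -EFinD ltry.
      rewrite integral_cst// mul1e; exact: probability_setT.
    - by move=> x _; rewrite lee_fin sqr_ge0.
    - by apply/measurable_EFinP; exact: measurable_funX.
  apply: le_integrable I2 => //; first by apply/measurable_EFinP; exact: measurable_id.
  move=> x _ /=; rewrite lee_fin [leRHS]ger0_norm ?addr_ge0 ?sqr_ge0//.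
  by rewrite ler_norml; have := sqr_ge0 (x - 1); have := sqr_ge0 (x + 1);
    set y := x ^+ 2; rewrite !expr2 /y expr2 => *; apply/andP; split; nra.
split => //.
have P (f : measurableTypeR R -> \bar R) :
    measurable_fun setT f -> (forall x, 0 <= f x)%E ->
    (\int[normal_prob 0 s]_x f x = \int[normal_prob 0 s]_x f (- x)%R)%E.
  move=> mf f0; rewrite !normal_prob_integral//; last first.
    by apply: measurableT_comp => //; exact: oppr_measurable.
  transitivity (\int[pushforward leb (-%R : R -> measurableTypeR R)]_x
      (f x * (normal_pdf 0 s x)%:E))%E.
    by apply: eq_measure_integral => A mA _; exact/esym/lebesgue_measureN.
  have mN : @measurable_fun _ _ (measurableTypeR R) (measurableTypeR R) setT -%R.
    exact: oppr_measurable.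
  have mg : @measurable_fun _ _ (measurableTypeR R) _ setT
      (fun x => f x * (normal_pdf 0 s x)%:E)%E.
    by apply: emeasurable_funM => //; apply/measurable_EFinP; exact: measurable_normal_pdf.
  have g0 : {in [set: measurableTypeR R], forall x, 0 <= f x * (normal_pdf 0 s x)%:E}%E.
    by move=> x _; rewrite mule_ge0// lee_fin normal_pdf_ge0.
  apply: etrans (ge0_integral_pushforward mN leb measurableT mg g0) _.
  rewrite preimage_setT; apply: eq_integral => x _ /=.
  by rewrite !normal_pdf_exp// sqrrN.
rewrite /Rintegral integralE.
rewrite [X in (X - _)%E]P//; last first.
  by apply: measurable_funepos.
rewrite (_ : (fun x : R => _) = (fun x : R => x%:E)^\-%E) ?subee//.
  by apply: integrable_neg_fin_num.
by apply/funext => x; rewrite funeposE funenegE EFinN.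
Qed.

End normal_moments.

(** * Ito integrals *)

Section elementary_integrals.
Context {d} {Omega : measurableType d} {R : realType}.
Variable Pr : probability Omega R.
Local Notation leb := (@lebesgue_measure R).
Local Notation E X := (\int[Pr]_w (X w)).
Local Notation L2P := (L2 Pr setT).
Local Notation n2P := (n2 Pr setT).
Local Notation ipP := (ip Pr setT).
Implicit Types (X Y zeta : Omega -> R).

Definition rbounded X := exists c : R, forall w, `|X w| <= c.

Lemma L2P_bounded X : measurable_fun setT X -> rbounded X -> L2P X.
Proof.
move=> mX [c Xc].
have Lc : L2P (fun=> c).
  split => //; apply: (eq_integrable _ (cst (c ^+ 2)%:E)) => //.
  exact: finite_measure_integrable_cst.
apply: (L2_dom measurableT mX Lc); apply: aeW => w _.
by rewrite (le_trans (Xc w))// ler_norm.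
Qed.

Lemma L2P_integrable X : L2P X -> Pr.-integrable setT (fun w => (X w)%:E).
Proof.
move=> LX; have L1 : L2P (fun=> 1) by apply: L2P_bounded => //; exists 1 => w; rewrite normr1.
have := L2_mul measurableT LX L1.
by apply: eq_integrable => // w _; rewrite mulr1.
Qed.

Lemma L2P_bounded_mul X Y : measurable_fun setT X ->
  rbounded X -> L2P Y -> L2P (fun w => X w * Y w).
Proof.
move=> mX [c Xc] LY; have [] // := L2_bounded_mul (c := c) measurableT mX _ LY.
by apply: aeW => w _; exact: Xc.
Qed.

(** The properties of a Brownian motion on which Ito integration in L2 rests. The filtration is a
    parameter because [W0 m] is used with [Fplayer] and [Fcommon], and [Wi m i] with [Fplayer] and
    [Gplayer]. *)
Record integrator (T : R) (F : R -> set (set Omega)) (W : R -> Omega -> R) : Prop :=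
  Integrator {
  itg_sub : forall t : R, 0 <= t <= T -> sub_algebra (F t);
  itg_mono : forall s t, 0 <= s -> s <= t -> t <= T -> F s `<=` F t;
  itg_meas : forall t, 0 <= t <= T -> measurable_wrt (F t) (W t);
  itg_indep : forall s t, 0 <= s -> s < t -> t <= T ->
    independent Pr (F s) (sigma_of [set (fun w => W t w - W s w)]);
  itg_L2 : forall s t, 0 <= s -> s < t -> t <= T -> L2P (fun w => W t w - W s w);
  itg_mean : forall s t, 0 <= s -> s < t -> t <= T -> E (fun w => W t w - W s w) = 0;
  itg_var : forall s t, 0 <= s -> s < t -> t <= T ->
    E (fun w => (W t w - W s w) ^+ 2) = t - s }.

Section integrator.
Variables (T : R) (F : R -> set (set Omega)) (W : R -> Omega -> R).
Hypothesis itg : integrator T F W.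
Local Notation dW a b := (fun w => W b w - W a w).

Lemma integrator_dW_L2 (s t : R) : 0 <= s -> s <= t -> t <= T -> L2P (dW s t).
Proof.
move=> s0; rewrite le_eqVlt => /orP[/eqP <-|st] tT; last exact: (itg_L2 itg).
by rewrite (_ : (fun w => _) = fun=> 0); [exact: L20|apply/funext => w; rewrite subrr].
Qed.

Lemma integrator_dW_meas (s t u : R) : 0 <= s -> s <= t -> t <= u -> u <= T ->
  measurable_wrt (F u) (dW s t).
Proof.
move=> s0 st tu uT; have t0 := le_trans s0 st; have u0 := le_trans t0 tu.
apply: measurable_wrtB; first by apply: (itg_sub itg); rewrite u0.
  apply: measurable_wrtS (itg_mono itg t0 tu uT) _.
  by apply: (itg_meas itg); rewrite t0 (le_trans tu).
apply: measurable_wrtS (itg_mono itg s0 (le_trans st tu) uT) _.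
by apply: (itg_meas itg); rewrite s0 (le_trans (le_trans st tu)).
Qed.

Lemma integrator_orth (s t : R) X : 0 <= s -> s <= t -> t <= T ->
  measurable_wrt (F s) X -> L2P X -> ipP X (dW s t) = 0.
Proof.
move=> s0; rewrite le_eqVlt => /orP[/eqP <-|st] tT FX LX.
  rewrite /ip (_ : (fun w => _) = fun=> 0); first by rewrite Rintegral_cst// mul0r.
  by apply/funext => w; rewrite subrr mulr0.
have sT := le_trans (ltW st) tT.
have Fs : sub_algebra (F s) by apply: (itg_sub itg); rewrite s0.
have LdW := itg_L2 itg s0 st tT.
have sdW : sub_algebra (sigma_of [set (dW s t)]).
  by apply: sub_algebra_sigma_of => _ ->; case: LdW.
have mdW : measurable_wrt (sigma_of [set (dW s t)]) (dW s t).
  exact: sigma_of_measurable_wrt.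
have [_ e] := independent_mul Fs sdW (itg_indep itg s0 st tT) FX mdW
  (L2P_integrable LX) (L2P_integrable LdW).
by rewrite /ip e (itg_mean itg)// mulr0.
Qed.

Lemma integrator_square (s t : R) X : 0 <= s -> s <= t -> t <= T ->
  measurable_wrt (F s) X -> rbounded X ->
  E (fun w => X w * (W t w - W s w) ^+ 2) = (t - s) * E X.
Proof.
move=> s0; rewrite le_eqVlt => /orP[/eqP <-|st] tT FX bX.
  rewrite subrr mul0r (_ : (fun w => _) = fun=> 0); first by rewrite Rintegral_cst// mul0r.
  by apply/funext => w; rewrite subrr expr0n mulr0.
have sT := le_trans (ltW st) tT.
have Fs : sub_algebra (F s) by apply: (itg_sub itg); rewrite s0.
have LdW := itg_L2 itg s0 st tT.
have LX := L2P_bounded (measurable_wrt_fun Fs FX) bX.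
have sdW : sub_algebra (sigma_of [set (dW s t)]).
  by apply: sub_algebra_sigma_of => _ ->; case: LdW.
have mdW : measurable_wrt (sigma_of [set (dW s t)]) (dW s t).
  exact: sigma_of_measurable_wrt.
have mdW2 : measurable_wrt (sigma_of [set (dW s t)])
    (fun w => (W t w - W s w) ^+ 2).
  have := measurable_wrtM sdW mdW mdW.
  by congr measurable_wrt; apply/funext => w; rewrite expr2.
have [_ ->] := independent_mul Fs sdW (itg_indep itg s0 st tT) FX mdW2
  (L2P_integrable LX) (proj2 LdW).
by rewrite (itg_var itg)// mulrC.
Qed.

(** Length of the intersection of ]a, b] and ]a', b']. *)
Definition overlap (a b a' b' : R) := Num.max 0 (Num.min b b' - Num.max a a').

(** Splitting the intervals at each other's end points leaves one common interval, whose
    contribution is given by [integrator_square], and pairs of disjoint intervals, where the later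
    increment is independent of all the other factors. *)
Lemma integrator_cov (a b a' b' : R) zeta zeta' :
  0 <= a -> a <= b -> b <= T -> 0 <= a' -> a' <= b' -> b' <= T ->
  measurable_wrt (F a) zeta -> rbounded zeta ->
  measurable_wrt (F a') zeta' -> rbounded zeta' ->
  ipP (fun w => zeta w * (W b w - W a w)) (fun w => zeta' w * (W b' w - W a' w))
  = overlap a b a' b' * ipP zeta zeta'.
Proof.
wlog aa : a b a' b' zeta zeta' / a <= a'.
  move=> H a0 ab bT a0' ab' bT' m bz m' bz'.
  have [aa|/ltW aa] := leP a a'; first exact: H.
  rewrite ipC /overlap (minC b) (maxC a) (ipC _ _ zeta).
  exact: H.
move=> a0 ab bT a0' ab' bT' mz bz mz' bz'.
have aT := le_trans ab bT; have aT' := le_trans ab' bT'.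
have b0 := le_trans a0 ab; have b0' := le_trans a0' ab'.
have Fa : sub_algebra (F a) by apply: (itg_sub itg); rewrite a0.
have Fa' : sub_algebra (F a') by apply: (itg_sub itg); rewrite a0'.
have mz1 : measurable_wrt (F a') zeta by apply: measurable_wrtS mz; apply: (itg_mono itg).
have fz := measurable_wrt_fun Fa mz; have fz' := measurable_wrt_fun Fa' mz'.
have bzz : rbounded (fun w => zeta w * zeta' w).
  case: bz bz' => c hc [c' hc']; exists (c * c') => w.
  by rewrite normrM ler_pM.
have fzz : measurable_fun setT (fun w => zeta w * zeta' w) by exact: measurable_funM.
have mzz : measurable_wrt (F a') (fun w => zeta w * zeta' w) by exact: measurable_wrtM.
(* a factor that is F_u-measurable and precedes an increment after u *)
have orth (u v c e : R) : 0 <= c -> c <= e -> e <= u -> a' <= u -> u <= v -> v <= T ->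
    ipP (fun w => zeta w * (W e w - W c w)) (fun w => zeta' w * (W v w - W u w)) = 0.
  move=> c0 ce eu au uv vT; have u0 := le_trans a0' au.
  have Fu : sub_algebra (F u) by apply: (itg_sub itg); rewrite u0 (le_trans uv).
  rewrite -(@integrator_orth u v (fun w => (zeta w * zeta' w) * (W e w - W c w)))//.
  - by congr Rintegral; apply/funext => w; ring.
  - apply: measurable_wrtM => //.
      by apply: measurable_wrtS mzz; apply: (itg_mono itg) => //; exact: le_trans vT.
    by apply: integrator_dW_meas => //; exact: le_trans vT.
  - by apply: L2P_bounded_mul => //; apply: integrator_dW_L2 => //; rewrite (le_trans eu)// (le_trans uv).
have L (c e : R) z : measurable_fun setT z -> rbounded z ->
    0 <= c -> c <= e -> e <= T -> L2P (fun w => z w * (W e w - W c w)).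
  by move=> ? ? c0 ce eT; apply: L2P_bounded_mul => //; exact: integrator_dW_L2.
have split (c e f : R) z : (fun w => z w * (W f w - W c w)) =
    (fun w => z w * (W e w - W c w) + z w * (W f w - W e w)).
  by apply/funext => w; ring.
rewrite /overlap (max_r aa).
have [ba|/ltW ab1] := leP b a'.
  rewrite (@max_l _ _ 0) ?mul0r; first exact: orth.
  by rewrite subr_le0 ge_min ba.
rewrite (split a a' b) ipDl//; [|exact: L..].
rewrite orth// add0r max_r; last by rewrite subr_ge0 le_min ab1.
have sq (u : R) : a' <= u -> u <= T ->
    ipP (fun w => zeta w * (W u w - W a' w)) (fun w => zeta' w * (W u w - W a' w))
    = (u - a') * ipP zeta zeta'.
  move=> au uT; rewrite -integrator_square//.
  by congr Rintegral; apply/funext => w; ring.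
have [bb|/ltW bb] := leP b b'.
  rewrite ipC (split a' b b') ipDl//; [|exact: L..].
  rewrite [X in _ + X]ipC orth// addr0 ipC; exact: sq.
rewrite (split a' b' b) ipDl//; [|exact: L..].
rewrite sq// [X in _ + X](_ : _ = 0) ?addr0//.
rewrite -(@integrator_orth b' b (fun w => (zeta w * zeta' w) * (W b' w - W a' w)))//.
- by congr Rintegral; apply/funext => w; ring.
- apply: measurable_wrtM.
  + by apply: (itg_sub itg); rewrite (le_trans a0')// (le_trans bb).
  + by apply: measurable_wrtS mzz; apply: (itg_mono itg).
  + exact: integrator_dW_meas.
- by apply: L2P_bounded_mul => //; exact: integrator_dW_L2.
Qed.

End integrator.

(** Lists of terms zeta 1_(]a, b]), whose intervals may overlap, unlike those of a simple process:
    sums are concatenations, and no common refinement of the times is ever formed. *)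
Definition eproc := seq (R * R * (Omega -> R)).
Definition eeval (e : eproc) (r : R) (w : Omega) : R :=
  \sum_(x <- e) x.2 w * (x.1.1 < r <= x.1.2)%R%:R.
Definition eint (W : R -> Omega -> R) (e : eproc) (w : Omega) : R :=
  \sum_(x <- e) x.2 w * (W x.1.2 w - W x.1.1 w).
Definition evalid (F : R -> set (set Omega)) (s t : R) (e : eproc) :=
  forall x, List.In x e -> [/\ s <= x.1.1, x.1.1 <= x.1.2, x.1.2 <= t,
     measurable_wrt (F x.1.1) x.2 & rbounded x.2].

Lemma In_cat (A : Type) (l l' : seq A) x :
  List.In x (l ++ l') -> List.In x l \/ List.In x l'.
Proof. by elim: l => [|y l IH] /=; [right|move=> [->|/IH[]]; auto]. Qed.

Lemma In_map (A B : Type) (f : A -> B) (l : seq A) y :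
  List.In y (map f l) -> exists2 x, List.In x l & y = f x.
Proof.
by elim: l => [//|x l IH] /= [<-|/IH[z zl ->]]; [exists x; [left|]|exists z; [right|]].
Qed.

Lemma big_In (A : Type) (V : nmodType) (l : seq A) (f g : A -> V) :
  (forall x, List.In x l -> f x = g x) -> \sum_(x <- l) f x = \sum_(x <- l) g x.
Proof.
elim: l => [|x l IH] h; first by rewrite !big_nil.
by rewrite !big_cons h ?IH//; [move=> y yl; apply: h; right|left].
Qed.

Definition escale (c : R) (e : eproc) : eproc :=
  [seq (x.1, fun w => c * x.2 w) | x <- e].

Lemma eeval_cat e e' r w : eeval (e ++ e') r w = eeval e r w + eeval e' r w.
Proof. by rewrite /eeval big_cat. Qed.

Lemma eint_cat W e e' w : eint W (e ++ e') w = eint W e w + eint W e' w.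
Proof. by rewrite /eint big_cat. Qed.

Lemma eeval_scale c e r w : eeval (escale c e) r w = c * eeval e r w.
Proof.
rewrite /eeval big_map mulr_sumr; apply: eq_bigr => x _ /=.
by rewrite mulrA.
Qed.

Lemma eint_scale W c e w : eint W (escale c e) w = c * eint W e w.
Proof.
rewrite /eint big_map mulr_sumr; apply: eq_bigr => x _ /=.
by rewrite mulrA.
Qed.

Lemma evalid_cat F (s t : R) e e' : evalid F s t e -> evalid F s t e' ->
  evalid F s t (e ++ e').
Proof. by move=> h h' x xe; have [{}xe|{}xe] := In_cat xe; [exact: h|exact: h']. Qed.

Lemma evalid_scale (T : R) F (s t c : R) e : 0 <= s -> t <= T ->
  (forall t : R, 0 <= t <= T -> sub_algebra (F t)) ->
  evalid F s t e -> evalid F s t (escale c e).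
Proof.
move=> s0 tT sF h y ye; have [x xe ->] := In_map ye.
have [sx xx xt mx [C bx]] := h x xe; split => //=.
  apply: measurable_wrtM => //; last apply: measurable_wrt_cst;
  by apply: sF; rewrite (le_trans s0 sx) (le_trans xx (le_trans xt tT)).
by exists (`|c| * C) => w; rewrite normrM ler_wpM2l.
Qed.

Section isometry.
Variables (T : R) (F : R -> set (set Omega)) (W : R -> Omega -> R).
Hypothesis itg : integrator T F W.

Lemma overlapE (s t a b a' b' : R) : s <= a -> a <= b -> b <= t ->
  s <= a' -> a' <= b' -> b' <= t ->
  \int[leb]_(r in `[s, t]) ((a < r <= b)%R%:R * (a' < r <= b')%R%:R) = overlap a b a' b'.
Proof.
move=> sa ab bt sa' ab' bt'.
have -> : (fun r => (a < r <= b)%R%:R * (a' < r <= b')%R%:R : R) =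
    \1_(`]Num.max a a', Num.min b b']%classic).
  apply/funext => r; rewrite indicE.
  rewrite -natrM mulnb; congr ((_ : bool)%:R).
  apply/idP/idP.
    move=> /andP[/andP[? ?] /andP[? ?]]; rewrite inE /= in_itv /= gt_max le_min.
    by apply/andP; split; apply/andP.
  rewrite inE /= in_itv /= gt_max le_min => /andP[/andP[-> ->] /andP[-> ->]] //.
rewrite /Rintegral integral_indic//.
rewrite (_ : _ `&` _ = `]Num.max a a', Num.min b b']%classic); last first.
  apply/seteqP; split => r /=; first by case.
  move=> h; split => //; move: h; rewrite !in_itv /= gt_max le_min.
  by move=> /andP[/andP[/ltW ? _] /andP[? _]]; rewrite (le_trans sa)//= (le_trans _ bt).
rewrite /= lebesgue_measure_itv /= lte_fin /overlap.
by case: ltP => h; [rewrite [RHS]max_r// subr_ge0 ltW|rewrite [RHS]max_l// subr_le0].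
Qed.

Lemma measurable_step (D : set R) (a b : R) :
  @measurable_fun _ _ (measurableTypeR R) R D (fun r => (a < r <= b)%R%:R).
Proof.
rewrite (_ : (fun r => _) = \1_(`]a, b]%classic)).
  by apply: measurable_indic; exact: measurable_itv.
apply/funext => p; rewrite indicE; congr ((_ : bool)%:R).
by apply/idP/idP; rewrite inE /= in_itv.
Qed.

Lemma L2t_step (s t a b : R) zeta : measurable_fun setT zeta -> rbounded zeta ->
  L2t Pr s t (fun r w => zeta w * (a < r <= b)%R%:R).
Proof.
move=> mz bz; have Lz := L2t_fun s t (L2P_bounded mz bz).
have mI : measurable_fun (slab s t)
    (fun p : measurableTypeR R * Omega => (a < p.1 <= b)%R%:R : R).
  rewrite (_ : (fun p => _) = \1_(`]a, b] `*` setT)).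
    by apply: measurable_indic; exact: measurableX.
  apply/funext => p; rewrite indicE; congr ((_ : bool)%:R).
  by apply/idP/idP; rewrite inE /= in_itv /=; [split|case].
have [] := L2_bounded_mul (c := 1) (measurable_slab s t) mI _ Lz.
  by apply: aeW => p _; case: (_ < _ <= _); rewrite ?normr1 ?normr0.
by move=> h _; move: h; congr L2; apply/funext => p; rewrite mulrC.
Qed.

Lemma evalid_L2t (s t : R) e : 0 <= s -> t <= T -> evalid F s t e -> L2t Pr s t (eeval e).
Proof.
move=> s0 tT he.
have : forall x, List.In x e -> L2t Pr s t (fun r w => x.2 w * (x.1.1 < r <= x.1.2)%R%:R).
  move=> x xe; have [sx xx xt mx bx] := he x xe; apply: L2t_step => //.
  apply: measurable_wrt_fun mx; apply: (itg_sub itg).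
  by rewrite (le_trans s0 sx) (le_trans xx (le_trans xt tT)).
elim: e {he} => [|x e IH] h.
  rewrite (_ : eeval [::] = fun=> fun=> 0); first exact: (L20 _ (measurable_slab s t)).
  by apply/funext => r; apply/funext => w; rewrite /eeval big_nil.
have := L2D (measurable_slab s t) (h x (or_introl erefl)) (IH (fun y ye => h y (or_intror ye))).
by congr L2; apply/funext => p; rewrite /eeval big_cons.
Qed.

Lemma evalid_L2 (s t : R) e : 0 <= s -> t <= T -> evalid F s t e -> L2P (eint W e).
Proof.
move=> s0 tT he.
have : forall x, List.In x e -> L2P (fun w => x.2 w * (W x.1.2 w - W x.1.1 w)).
  move=> x xe; have [sx xx xt mx bx] := he x xe; have xT := le_trans xt tT; have x0 := le_trans s0 sx.
  apply: L2P_bounded_mul => //; last exact: (integrator_dW_L2 itg).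
  by apply: measurable_wrt_fun mx; apply: (itg_sub itg); rewrite x0 (le_trans xx).
elim: e {he} => [|x e IH] h.
  rewrite (_ : eint W [::] = fun=> 0); first exact: L20.
  by apply/funext => w; rewrite /eint big_nil.
have := L2D measurableT (h x (or_introl erefl)) (IH (fun y ye => h y (or_intror ye))).
by congr L2; apply/funext => w; rewrite /eint big_cons.
Qed.

(** Both sides are the overlap of the two intervals times [ipP x.2 y.2], the left one by
    [integrator_cov] and the right one by Fubini. *)
Lemma ip_step (s t : R) x y : 0 <= s -> t <= T -> evalid F s t [:: x; y] ->
  ipP (fun w => x.2 w * (W x.1.2 w - W x.1.1 w)) (fun w => y.2 w * (W y.1.2 w - W y.1.1 w)) =
  ip (dtP Pr) (slab s t) (fun p => x.2 p.2 * (x.1.1 < p.1 <= x.1.2)%R%:R)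
    (fun p => y.2 p.2 * (y.1.1 < p.1 <= y.1.2)%R%:R).
Proof.
move=> s0 tT h; have [sx xx xt mx bx] := h x (or_introl erefl).
have [sy yy yt my by_] := h y (or_intror (or_introl erefl)).
have x0 := le_trans s0 sx; have y0 := le_trans s0 sy.
have fx : measurable_fun setT x.2.
  by apply: measurable_wrt_fun mx; apply: (itg_sub itg); rewrite x0 (le_trans xx (le_trans xt tT)).
have fy : measurable_fun setT y.2.
  by apply: measurable_wrt_fun my; apply: (itg_sub itg); rewrite y0 (le_trans yy (le_trans yt tT)).
rewrite (integrator_cov itg) ?(le_trans xt) ?(le_trans yt)//.
have [_ _ e _] := @slab_Rfubini _ _ _ Pr s t
  (fun r w => (x.2 w * (x.1.1 < r <= x.1.2)%R%:R) * (y.2 w * (y.1.1 < r <= y.1.2)%R%:R))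
  (L2t_mul (L2t_step s t x.1.1 x.1.2 fx bx) (L2t_step s t y.1.1 y.1.2 fy by_)).
rewrite [RHS]e -(@overlapE s t)//; set g := fun r : R => _ * _.
have Lxy := L2_mul measurableT (L2P_bounded fx bx) (L2P_bounded fy by_).
have Ig : leb.-integrable `[s, t] (fun r => (g r)%:E).
  apply: measurable_bounded_integrable => //.
  - by rewrite /= lebesgue_measure_itv /=; case: ifP => _; rewrite ltry.
  - by apply: measurable_funM; exact: measurable_step.
  exists 1; split => // M M1 r _; rewrite /= /g.
  by rewrite -natrM ger0_norm ?ler0n// (le_trans _ (ltW M1))// lern1 mulnb leq_b1.
rewrite mulrC /ip -RintegralZl//.
congr Rintegral; apply/funext => r.
rewrite mulrC -RintegralZl//.
by congr Rintegral; apply/funext => w; rewrite /g; ring.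
Qed.

(** Bilinearity reduces the isometry to pairs of terms, and [ip_step] treats every pair, which is
    why overlapping intervals do no harm. *)
Lemma ito_isometry_elementary (s t : R) e : 0 <= s -> t <= T -> evalid F s t e ->
  n2P (eint W e) = n2t Pr s t (eeval e).
Proof.
move=> s0 tT he; rewrite /n2t /n2; congr Num.sqrt.
pose X x := (fun w : Omega => x.2 w * (W x.1.2 w - W x.1.1 w)).
pose Y x := (fun p : measurableTypeR R * Omega => x.2 p.2 * (x.1.1 < p.1 <= x.1.2)%R%:R : R).
have h1 x : List.In x e -> L2P (X x).
  move=> xe; have := @evalid_L2 s t [:: x] s0 tT.
  rewrite (_ : eint W [:: x] = X x); last by apply/funext => w; rewrite /eint big_seq1.
  by apply => y [<-|//]; exact: he.
have h2 x : List.In x e -> L2 (dtP Pr) (slab s t) (Y x).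
  move=> xe; have := @evalid_L2t s t [:: x] s0 tT.
  rewrite (_ : eeval [:: x] = fun r w => Y x (r, w)); last first.
    by apply/funext => r; apply/funext => w; rewrite /eeval big_seq1.
  by apply => y [<-|//]; exact: he.
have h3 x y : List.In x e -> List.In y e -> ipP (X x) (X y) = ip (dtP Pr) (slab s t) (Y x) (Y y).
  by move=> xe ye; apply: ip_step => // z [<-|[<-|//]]; exact: he.
(* [List.In] is not a predicate that [ip_suml] can carry, so linearity is repeated for terms that
   are square-integrable along the list. *)
have ip_suml' (d' : measure_display) (U : measurableType d') (mu : {measure set U -> \bar R})
    (D : set U) (Z : R * R * (Omega -> R) -> U -> R) (l : eproc) (g : U -> R) :
    measurable D -> (forall x, List.In x l -> L2 mu D (Z x)) -> L2 mu D g ->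
    L2 mu D (fun u => \sum_(x <- l) Z x u) /\
    ip mu D (fun u => \sum_(x <- l) Z x u) g = \sum_(x <- l) ip mu D (Z x) g.
  move=> mD + Lg; elim: l => [|x l IH] hl.
    rewrite big_nil (_ : (fun u => _) = fun=> 0); last by apply/funext => u; rewrite big_nil.
    split; first exact: L20.
    by rewrite /ip (_ : (fun u => _) = fun=> 0) ?Rintegral_cst ?mul0r//; apply/funext => u; rewrite mul0r.
  have [LS IHe] := IH (fun y yl => hl y (or_intror yl)).
  have Lx := hl x (or_introl erefl).
  rewrite big_cons -IHe -ipDl//.
  rewrite (_ : (fun u => _) = fun u => Z x u + \sum_(x0 <- l) Z x0 u); last first.
    by apply/funext => u; rewrite big_cons.
  by split => //; exact: L2D.
have LX := evalid_L2 s0 tT he; have LY := evalid_L2t s0 tT he.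
have [_ ->] := ip_suml' _ _ Pr setT X e (eint W e) measurableT h1 LX.
have [_ ->] := ip_suml' _ _ (dtP Pr) (slab s t) Y e (fun p => eeval e p.1 p.2)
  (measurable_slab s t) h2 LY.
apply: big_In => x xe; rewrite ipC [RHS]ipC.
have [_ ->] := ip_suml' _ _ Pr setT X e (X x) measurableT h1 (h1 x xe).
have [_ ->] := ip_suml' _ _ (dtP Pr) (slab s t) Y e (Y x) (measurable_slab s t) h2 (h2 x xe).
by apply: big_In => y ye; exact: h3.
Qed.

Lemma ito_isometry_elementary_sub (s t : R) e e' : 0 <= s -> t <= T ->
  evalid F s t e -> evalid F s t e' ->
  n2P (fun w => eint W e w - eint W e' w) = n2t Pr s t (fun r w => eeval e r w - eeval e' r w).
Proof.
move=> s0 tT he he'.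
have := @ito_isometry_elementary s t (e ++ escale (-1) e') s0 tT.
move=> /(_ (evalid_cat he (evalid_scale s0 tT (itg_sub itg) he'))).
rewrite (_ : eint W _ = fun w => eint W e w - eint W e' w); last first.
  by apply/funext => w; rewrite eint_cat eint_scale mulN1r.
rewrite (_ : eeval _ = fun r w => eeval e r w - eeval e' r w)//.
by apply/funext => r; apply/funext => w; rewrite eeval_cat eeval_scale mulN1r.
Qed.

Lemma eint_orth (s t : R) e Y : 0 <= s -> t <= T -> evalid F s t e ->
  measurable_wrt (F s) Y -> L2P Y -> ipP Y (eint W e) = 0.
Proof.
move=> s0 tT he mY LY; elim: e he => [|x e IH] he.
  rewrite /ip (_ : (fun u => _) = fun=> 0) ?Rintegral_cst ?mul0r//.
  by apply/funext => u; rewrite /eint big_nil mulr0.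
have he' : evalid F s t e by move=> y ye; apply: he; right.
have [sx xx xt mx bx] := he x (or_introl erefl).
have x0 := le_trans s0 sx; have xT := le_trans xt tT.
have Fx : sub_algebra (F x.1.1) by apply: (itg_sub itg); rewrite x0 (le_trans xx).
have fx := measurable_wrt_fun Fx mx.
have LdW := integrator_dW_L2 itg x0 xx xT.
rewrite ipC (_ : eint W _ = fun w => x.2 w * (W x.1.2 w - W x.1.1 w) + eint W e w); last first.
  by apply/funext => w; rewrite /eint big_cons.
rewrite ipDl//; [|exact: L2P_bounded_mul|exact: evalid_L2 he'].
rewrite [X in _ + X]ipC IH// addr0.
(* The bounded factor [x.2] joins [Y]: the product is square-integrable and known at time [x.1.1],
   hence orthogonal to the increment. *)
rewrite -(@integrator_orth T F W itg x.1.1 x.1.2 (fun w => x.2 w * Y w))//.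
- by congr Rintegral; apply/funext => w; ring.
- apply: measurable_wrtM => //; apply: measurable_wrtS mY.
  by apply: (itg_mono itg) => //; exact: le_trans xT.
- exact: L2P_bounded_mul.
Qed.

End isometry.

End elementary_integrals.

(** * Increments of Ito integrals: isometry and orthogonality to the past *)

Section ito_increments.
Context {d} {Omega : measurableType d} {R : realType}.
Variable Pr : probability Omega R.
Local Notation leb := (@lebesgue_measure R).
Local Notation E X := (\int[Pr]_w (X w)).
Local Notation L2P := (L2 Pr setT).
Local Notation n2P := (n2 Pr setT).
Local Notation ipP := (ip Pr setT).
Local Notation L2t := (L2t Pr).
Local Notation n2t := (n2t Pr).
Implicit Types (X Y zeta : Omega -> R).

Lemma le0_eps (x : R) : (forall e : R, 0 < e -> x <= e) -> x <= 0.
Proof. by move=> h; apply/ler_addgt0Pr => e e0; rewrite add0r h. Qed.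

(* [M] is a version of the integral of [h] over [s, t]. *)
Definition itoinc (F : R -> set (set Omega)) W (s t : R) h M :=
  [/\ L2t s t h, L2P M & forall eps : R, 0 < eps -> exists e,
    [/\ evalid F s t e, n2t s t (fun r w => h r w - eeval e r w) <= eps &
        n2P (fun w => M w - eint W e w) <= eps]].

Section integrator.
Variables (T : R) (F : R -> set (set Omega)) (W : R -> Omega -> R).
Hypothesis itg : integrator Pr T F W.

Lemma itoincB (s t : R) h h' M M' : 0 <= s -> t <= T ->
  itoinc F W s t h M -> itoinc F W s t h' M' ->
  itoinc F W s t (fun r w => h r w - h' r w) (fun w => M w - M' w).
Proof.
move=> s0 tT [Lh LM a] [Lh' LM' a']; split; first exact: (L2B (measurable_slab s t)).
  exact: L2B.
move=> eps eps0; have eps2 : 0 < eps / 2 by rewrite divr_gt0.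
have [e [he e1 e2]] := a _ eps2; have [e' [he' e1' e2']] := a' _ eps2.
have hs := evalid_scale (c := -1) s0 tT (itg_sub itg) he'.
exists (e ++ escale (-1) e'); split; first exact: evalid_cat.
  rewrite (_ : (fun r w => _) =
    fun r w => (h r w - eeval e r w) - (h' r w - eeval e' r w)).
    apply: le_trans (n2B (measurable_slab s t) _ _) _.
    - by apply: (L2B (measurable_slab s t) Lh); exact: (evalid_L2t itg).
    - by apply: (L2B (measurable_slab s t) Lh'); exact: (evalid_L2t itg).
    by rewrite [leRHS]splitr lerD.
  apply/funext => r; apply/funext => w; rewrite eeval_cat eeval_scale; ring.
rewrite (_ : (fun w => _) = fun w => (M w - eint W e w) - (M' w - eint W e' w)).
  apply: le_trans (n2B measurableT _ _) _.
  - by apply: (L2B measurableT LM); exact: (evalid_L2 itg s0 tT).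
  - by apply: (L2B measurableT LM'); exact: (evalid_L2 itg s0 tT).
  by rewrite [leRHS]splitr lerD.
by apply/funext => w; rewrite eint_cat eint_scale; ring.
Qed.

Lemma itoinc_isometry (s t : R) h M : 0 <= s -> t <= T ->
  itoinc F W s t h M -> n2P M = n2t s t h.
Proof.
move=> s0 tT [Lh LM a]; apply/eqP; rewrite -subr_eq0 -normr_le0.
apply: le0_eps => eps eps0; have eps2 : 0 < eps / 2 by rewrite divr_gt0.
have [e [he e1 e2]] := a _ eps2.
have Le := evalid_L2t itg s0 tT he; have LE := evalid_L2 itg s0 tT he.
have i1 := n2_dist measurableT LM LE.
have i2 := n2_dist (measurable_slab s t) Lh Le.
move: i1; rewrite (ito_isometry_elementary itg s0 tT he) => i1.
have -> : n2P M - n2t s t h = (n2P M - n2t s t (eeval e)) - (n2t s t h - n2t s t (eeval e)).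
  by ring.
rewrite (le_trans (ler_normB _ _))// [leRHS]splitr lerD//.
  exact: le_trans i1 e2.
exact: le_trans i2 e1.
Qed.

Lemma itoinc_orth (s t : R) h M Y : 0 <= s -> t <= T ->
  itoinc F W s t h M -> measurable_wrt (F s) Y -> L2P Y -> ipP Y M = 0.
Proof.
move=> s0 tT [Lh LM a] mY LY; apply/eqP; rewrite -normr_le0.
apply: le0_eps => eps eps0.
(* The 1 keeps the divisor positive when [Y] has norm zero. *)
have c0 : 0 < n2P Y + 1 by rewrite ltr_wpDl// n2_ge0.
have [e [he _ e2]] := a _ (divr_gt0 eps0 c0).
have LE := evalid_L2 itg s0 tT he.
have := eint_orth itg s0 tT he mY LY => o.
have -> : ipP Y M = ipP Y (fun w => M w - eint W e w).
  by rewrite ipC [RHS]ipC ipBl// (ipC _ _ (eint W e)) o subr0.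
apply: le_trans (cauchy_schwarz measurableT LY _) _; first exact: L2B.
apply: (@le_trans _ _ ((n2P Y + 1) * (eps / (n2P Y + 1)))).
  by apply: ler_pM; rewrite ?n2_ge0// lerDl.
by rewrite mulrCA mulfV ?mulr1// gt_eqF.
Qed.

(** Integrals adapted to the common noise become integrals for the player's filtration, and those in
    turn integrals for [Gplayer]. *)
Lemma itoinc_sub F' (s t : R) h M : 0 <= s -> t <= T ->
  (forall r, 0 <= r <= T -> F r `<=` F' r) ->
  itoinc F W s t h M -> itoinc F' W s t h M.
Proof.
move=> s0 tT FF [Lh LM a]; split => // eps /a[e [he e1 e2]]; exists e; split => //.
move=> x xe; have [sx xx xt mx bx] := he x xe; split => //.
apply: measurable_wrtS mx; apply: FF; rewrite (le_trans s0 sx).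
by rewrite (le_trans xx (le_trans xt tT)).
Qed.

End integrator.

(** * From simple processes on [0, T] to increments over [s, t] *)

Section from_simple.
Variables (T : R) (F : R -> set (set Omega)) (W : R -> Omega -> R).

Definition clamp (s t x : R) := Num.max s (Num.min x t).
(** A term that starts after [t] would be clamped to the empty interval ]t, t], but its value need
    not be known at time [t]; hence the filter. Terms that end before [s] may stay, their values
    being known at time [s]. *)
Definition clip (s t : R) (h : @simple_process R d Omega) : @eproc d Omega R :=
  [seq (clamp s t (sp_time h l), clamp s t (sp_time h l.+1), sp_val h l)
     | l <- iota 0 (sp_size h) & sp_time h l <= t].

Lemma sum_iota (V : nmodType) n (f : nat -> V) :
  \sum_(l < n) f l = \sum_(l <- iota 0 n) f l.
Proof. by rewrite -(big_mkord xpredT f) /index_iota subn0. Qed.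

Lemma clip_eint (s t : R) (h : @simple_process R d Omega) w : s <= t -> is_simple T F h ->
  eint W (clip s t h) w = simple_ito W h t w - simple_ito W h s w.
Proof.
move=> st hs; rewrite /eint /clip big_map big_filter /simple_ito.
rewrite (sum_iota _ (fun l => sp_val h l w *
  (W (Num.min (sp_time h l.+1) t) w - W (Num.min (sp_time h l) t) w))).
rewrite (sum_iota _ (fun l => sp_val h l w *
  (W (Num.min (sp_time h l.+1) s) w - W (Num.min (sp_time h l) s) w))).
rewrite -sumrB big_mkcond /=.
rewrite big_seq [RHS]big_seq; apply: eq_bigr => l; rewrite mem_iota add0n /= => lh.
have [_ ab _ _ _] := hs l lh.
(* In this form an increment between clamped times is the difference of the increments stopped at
   [t] and at [s]. *)
have cl x : W (clamp s t x) w = W (Num.min x t) w - W (Num.min x s) w + W s w.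
  rewrite /clamp; have [xs|sx] := leP x s.
    rewrite (min_l (le_trans xs st)) (max_l xs); ring.
  rewrite max_r ?subrK//; by rewrite le_min ltW//= ltW.
case: ifPn => [_|]; first by rewrite !cl; ring.
rewrite -ltNge => ta; have tb := lt_le_trans ta ab.
rewrite !min_r ?(ltW ta) ?(ltW tb) ?(le_trans st (ltW ta)) ?(le_trans st (ltW tb))//.
ring.
Qed.

Lemma clip_eeval (s t : R) (h : @simple_process R d Omega) r w : s <= t -> is_simple T F h ->
  s < r -> r <= t -> eeval (clip s t h) r w = simple_eval h r w.
Proof.
move=> st hs sr rt; rewrite /eeval /clip big_map big_filter /simple_eval.
rewrite big_mkcond [RHS]big_mkcond /= (sum_iota _ (fun l => if (sp_time h l < r <= sp_time h l.+1)%R then sp_val h l w else 0)).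
rewrite big_seq [RHS]big_seq; apply: eq_bigr => l; rewrite mem_iota add0n /= => lh.
have -> : (clamp s t (sp_time h l) < r) = (sp_time h l < r).
  by rewrite /clamp gt_max sr /= gt_min (ltNge t) rt orbF.
have -> : (r <= clamp s t (sp_time h l.+1)) = (r <= sp_time h l.+1).
  by rewrite /clamp le_max (leNgt r s) sr /= le_min rt andbT.
case: ifPn => [_|]; first by case: ifP => _; rewrite ?mulr1 ?mulr0.
by rewrite -ltNge => ta; rewrite (ltNge _ r) (ltW (le_lt_trans rt ta)).
Qed.

Lemma clip_valid (s t : R) (h : @simple_process R d Omega) : 
  (forall s t : R, 0 <= s -> s <= t -> t <= T -> F s `<=` F t) ->
  s <= t -> t <= T -> is_simple T F h -> evalid F s t (clip s t h).
Proof.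
move=> Fm st tT hs x xe; have [l xl ->] := In_map xe.
have {xl}[lh lt_] : (l < sp_size h)%N /\ sp_time h l <= t.
  have : l \in [seq l <- iota 0 (sp_size h) | sp_time h l <= t].
    elim: {hs}[seq l <- _ | _] xl => //= a l' IH [->|/IH]; rewrite inE ?eqxx//.
    by move=> ->; rewrite orbT.
  by rewrite mem_filter mem_iota add0n => /andP[? ?].
have [a0 ab bT ma ba] := hs l lh; split => //=.
- by rewrite le_max lexx.
- by rewrite /clamp ge_max le_max lexx /= le_max; apply/orP; right; rewrite le_min ge_min ab /= ge_min lexx orbT.
- by rewrite ge_max st ge_min lexx orbT.
- apply: measurable_wrtS ma; apply: Fm => //.
  + by rewrite /clamp le_max (min_l lt_) lexx orbT.
  + by rewrite /clamp (min_l lt_) (le_trans _ tT)// ge_max st.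
Qed.

Hypothesis itg : integrator Pr T F W.

Definition eraw (h : @simple_process R d Omega) : @eproc d Omega R :=
  [seq (sp_time h l, sp_time h l.+1, sp_val h l) | l <- iota 0 (sp_size h)].

Lemma eraw_eeval h r w : eeval (eraw h) r w = simple_eval h r w.
Proof.
rewrite /eeval /eraw big_map /simple_eval [RHS]big_mkcond /=.
rewrite (sum_iota _ (fun l => if (sp_time h l < r <= sp_time h l.+1)%R then sp_val h l w else 0)).
by apply: eq_bigr => l _; case: ifP => _; rewrite ?mulr1 ?mulr0.
Qed.

Lemma In_iota n l : List.In l (iota 0 n) -> (l < n)%N.
Proof.
have : forall s, List.In l s -> l \in s.
  by elim=> //= a s IH [->|/IH h]; rewrite inE ?eqxx// h orbT.
by move=> /[apply]; rewrite mem_iota.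
Qed.

Lemma eraw_valid h : is_simple T F h -> evalid F 0 T (eraw h).
Proof.
move=> hs x xl; have [l /In_iota lh ->] := In_map xl.
by have [? ? ? ? ?] := hs l lh.
Qed.

Lemma simple_ito0 h w : is_simple T F h -> simple_ito W h 0 w = 0.
Proof.
move=> hs; rewrite /simple_ito big1// => l _.
have [a0 ab _ _ _] := hs l (ltn_ord l).
by rewrite !min_r ?subrr ?mulr0//; exact: le_trans ab.
Qed.

Lemma simple_ito_L2 h t : 0 <= t -> t <= T -> is_simple T F h ->
  L2P (simple_ito W h t).
Proof.
move=> t0 tT hs; have hv := clip_valid (itg_mono itg) t0 tT hs.
have := evalid_L2 itg (lexx 0) tT hv.
congr L2; apply/funext => w; rewrite clip_eint// (simple_ito0 _ hs) subr0//.
Qed.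

Lemma ecvg0_near (u : nat -> \bar R) (e : R) : 0 < e -> u @ \oo --> 0%E ->
  \forall q \near \oo, (u q < e%:E)%E.
Proof.
move=> e0 /(_ [set y | (y < e%:E)%E]); apply.
by apply: open_ereal_lt'; rewrite lte_fin.
Qed.

Lemma itoinc_of_ito1 (s t : R) h I : 0 <= s -> s <= t -> t <= T ->
  L2t 0 T h -> is_ito1 Pr T F W h I ->
  itoinc F W s t h (fun w => I t w - I s w).
Proof.
move=> s0 st tT Lh [mI [hs [simp ch cI]]].
have t0 := le_trans s0 st; have sT := le_trans st tT; have T0 := le_trans t0 tT.
have Lht : L2t s t h by exact: L2tS Lh.
have simL q : L2t 0 T (simple_eval (hs q)).
  have := evalid_L2t itg (lexx 0) (lexx T) (eraw_valid (simp q)).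
  by congr (L2t 0 T); apply/funext => r; apply/funext => w; rewrite eraw_eeval.
(* The three convergences hold eventually, so one index serves the integrand and both end points. *)
have key (eps : R) : 0 < eps -> exists q,
    [/\ n2t 0 T (fun r w => simple_eval (hs q) r w - h r w) <= eps,
     L2P (fun w => simple_ito W (hs q) t w - I t w) /\ n2P (fun w => simple_ito W (hs q) t w - I t w) <= eps &
     L2P (fun w => simple_ito W (hs q) s w - I s w) /\ n2P (fun w => simple_ito W (hs q) s w - I s w) <= eps].
  move=> eps0; have e2 : 0 < eps ^+ 2 by rewrite exprn_gt0.
  have E1 := ecvg0_near e2 ch.
  have tT' : 0 <= t <= T by rewrite t0.
  have sT' : 0 <= s <= T by rewrite s0.
  have E2 := ecvg0_near e2 (cI t tT'); have E3 := ecvg0_near e2 (cI s sT').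
  have [q [[h1 h2] h3]] := filter_ex (filterI (filterI E1 E2) E3).
  have fin u : 0 <= u <= T ->
      (\int[Pr]_w ((simple_ito W (hs q) u w - I u w) ^+ 2)%:E < (eps ^+ 2)%:E)%E ->
      L2P (fun w => simple_ito W (hs q) u w - I u w) /\
      n2P (fun w => simple_ito W (hs q) u w - I u w) <= eps.
    move=> uT hu; have /andP[u0 u1] := uT.
    have mu : measurable_fun setT (fun w => simple_ito W (hs q) u w - I u w).
      by apply: measurable_funB; [case: (simple_ito_L2 u0 u1 (simp q))|exact: mI].
    have Lu : L2P (fun w => simple_ito W (hs q) u w - I u w).
      by apply: L2_finite_integral => //; rewrite (lt_trans hu)// ltry.
    split => //; rewrite -(ler_pXn2r (ltn0Sn 1)) ?nnegrE ?n2_ge0 ?(ltW eps0)//.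
    by rewrite -lee_fin n2E// ltW.
  exists q; split; [|exact: fin|exact: fin].
  have Ld := L2B (measurable_slab 0 T) (simL q) Lh.
  rewrite -(ler_pXn2r (ltn0Sn 1)) ?nnegrE ?n2_ge0 ?(ltW eps0)//.
  rewrite -lee_fin (n2E (measurable_slab 0 T) Ld); apply: le_trans (ltW h1).
  rewrite slab_tonelli2//; last by move=> p _; rewrite lee_fin sqr_ge0.
  by apply/measurable_EFinP/measurable_funX; case: Ld.
have [q0 [_ [Lt _] [Ls _]]] := key 1 ltr01.
(* [is_ito1] does not bound [I]; its increment is square-integrable because it lies at finite
   distance from that of a simple process. *)
have LM : L2P (fun w => I t w - I s w).
  have := L2B measurableT
    (L2B measurableT (simple_ito_L2 t0 tT (simp q0)) (simple_ito_L2 s0 sT (simp q0)))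
    (L2B measurableT Lt Ls).
  by congr L2; apply/funext => w; ring.
split => // eps eps0; have eps2 : 0 < eps / 2 by rewrite divr_gt0.
have [q [h1 [Lqt h2] [Lqs h3]]] := key _ eps2.
have hv := clip_valid (itg_mono itg) st tT (simp q).
exists (clip s t (hs q)); split => //.
- have Le := evalid_L2t itg s0 tT hv.
  have Ld := L2B (measurable_slab s t) (L2tS s0 tT (simL q)) Lht.
  have mhe : measurable_fun (slab s t) (fun p => h p.1 p.2 - eeval (clip s t (hs q)) p.1 p.2).
    by apply: measurable_funB; [case: Lht|case: Le].
  (* At [r = s] the clipped process may differ from the original one, as clipped intervals are open
     on the left; this time is null. *)
  have nz : {ae leb, forall r, s <= r <= t -> s < r}.
    exists [set s]; split => //; first by rewrite lebesgue_measure_set1.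
    move=> r /= /not_implyP[/andP[sr _]] /negP; rewrite -leNgt => rs.
    by apply/eqP; rewrite eq_le sr rs.
  apply: le_trans (n2_dom (measurable_slab s t) mhe Ld _) _.
    apply: filterS (ae_time_slab Pr nz) => -[r w] /= hr srt.
    rewrite distrC clip_eeval//; first exact: hr.
    by case: srt => /=; rewrite in_itv /= => /andP[].
  apply: le_trans (n2tS (f := fun r w => simple_eval (hs q) r w - h r w) s0 tT
    (L2B (measurable_slab 0 T) (simL q) Lh)) _.
  by rewrite (le_trans h1)// ler_pdivrMr// ler_peMr ?ltW//; lra.
- rewrite (_ : (fun w => _) = fun w => (simple_ito W (hs q) s w - I s w) -
      (simple_ito W (hs q) t w - I t w)).
    by apply: le_trans (n2B measurableT Lqs Lqt) _; rewrite [leRHS]splitr lerD.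
  by apply/funext => w; rewrite (clip_eint _ st (simp q)); ring.
Qed.

End from_simple.
End ito_increments.

(** * Brownian motions and the filtrations of the game *)

Section brownian_integrator.
Context {d} {Omega : measurableType d} {R : realType}.
Variable Pr : probability Omega R.
Local Notation E X := (\int[Pr]_w (X w)).
Local Notation L2P := (L2 Pr setT).

Lemma brownian_increment (W : R -> Omega -> R) (s t : R) : brownian Pr W ->
  0 <= s -> s < t ->
  [/\ L2P (fun w => W t w - W s w), E (fun w => W t w - W s w) = 0 &
      E (fun w => (W t w - W s w) ^+ 2) = t - s].
Proof.
move=> [mW _ _ _ lawW] s0 st.
pose X := (fun w => W t w - W s w) : Omega -> measurableTypeR R.
have mX : measurable_fun setT X.
  by apply: measurable_funB; apply: mW; rewrite // (le_trans s0)// ltW.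
have sg : 0 < Num.sqrt (t - s) by rewrite sqrtr_gt0 subr_gt0.
have sgE : Num.sqrt (t - s) ^+ 2 = t - s by rewrite sqr_sqrtr// subr_ge0 ltW.
have law (A : set (measurableTypeR R)) : measurable A ->
    pushforward Pr X A = normal_prob 0 (Num.sqrt (t - s)) A.
  by move=> mA; exact: lawW.
have I2 : (\int[Pr]_w ((X w) ^+ 2)%:E = (t - s)%:E)%E.
  rewrite -sgE -normal_second_moment//.
  have m2 : @measurable_fun _ _ (measurableTypeR R) _ setT (fun x => (x ^+ 2)%:E).
    by apply/measurable_EFinP; exact: measurable_funX.
  rewrite -(@eq_measure_integral _ _ _ _ _ (pushforward Pr X)); last first.
    by move=> A mA _; exact: law.
  rewrite ge0_integral_pushforward//.
  by move=> x _; rewrite lee_fin sqr_ge0.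
have LX : L2P X.
  by apply: L2_finite_integral => //; rewrite I2 ltry.
have [IN EN] := normal_first_moment sg.
split => //.
- rewrite -[RHS]EN /Rintegral; congr fine.
  rewrite -(@eq_measure_integral _ _ _ _ _ (pushforward Pr X)); last first.
    by move=> A mA _; exact: law.
  by rewrite integral_pushforward//; exact: L2P_integrable.
- by rewrite /Rintegral I2.
Qed.

Definition all_path (W : R -> Omega -> R) : set (Omega -> R) :=
  [set X | exists2 r, 0 <= r & X = W r].

Lemma path_upto_all W (t : R) : path_upto W t `<=` all_path W.
Proof. by move=> _ [r /andP[r0 _] ->]; exists r. Qed.

(** The added information [S0] is independent of the whole path, so probabilities factor on A, B, D
    with A in [S0], B in the past and D in the increment; [independent_join] extends this to the
    joined filtration. *)
Lemma enlarged_integrator (T : R) (S0 : set (Omega -> R)) (W : R -> Omega -> R) :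
  (forall X, S0 X -> measurable_fun setT X) -> brownian Pr W ->
  independent Pr (sigma_of S0) (sigma_of (all_path W)) ->
  integrator Pr T (fun t => sigma_of (S0 `|` path_upto W t)) W.
Proof.
move=> mS0 bW ind; have [mW _ _ indW _] := bW.
have sub (t : R) : sub_algebra (sigma_of (S0 `|` path_upto W t)).
  apply: sub_algebra_sigma_of => X [/mS0//|[r /andP[r0 _] ->]]; exact: mW.
split.
- by move=> t _; exact: sub.
- move=> s t s0 st tT; apply: sigma_ofS; apply: setUS => _ [r /andP[r0 rs] ->].
  by exists r => //; rewrite r0 (le_trans rs).
- move=> t /andP[t0 _]; apply: sigma_of_measurable_wrt; right.
  by exists t => //; rewrite t0 lexx.
- move=> s t s0 st tT; have t0 := le_trans s0 (ltW st).
  have sS0 : sub_algebra (sigma_of S0) by exact: sub_algebra_sigma_of.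
  have sW : sub_algebra (sigma_of (path_upto W s)).
    by apply: sub_algebra_sigma_of => _ [r /andP[r0 _] ->]; exact: mW.
  have mdW : measurable_fun setT (fun w => W t w - W s w).
    by apply: measurable_funB; exact: mW.
  have sdW : sub_algebra (sigma_of [set (fun w => W t w - W s w)]).
    by apply: sub_algebra_sigma_of => _ ->.
  have sall : sub_algebra (sigma_of (all_path W)).
    by apply: sub_algebra_sigma_of => _ [r r0 ->]; exact: mW.
  apply: (independent_join sS0 sW sdW); last first.
    by move=> X [XS|XW]; [left|right]; exact: sigma_of_measurable_wrt.
  move=> A B D GA HB KD.
  have allB : sigma_of (all_path W) B.
    by apply: sigma_ofS HB; exact: path_upto_all.
  have allD : sigma_of (all_path W) D.
    move: D KD; apply: sigma_of_sub => // _ ->; apply: measurable_wrtB => //.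
      by apply: sigma_of_measurable_wrt; exists t.
    by apply: sigma_of_measurable_wrt; exists s.
  rewrite -setIA (ind A (B `&` D))//; last exact: (sub_algebraI sall allB allD).
  by rewrite (indW s t s0 st B D HB KD) muleA -(ind A B GA allB).
- by move=> s t s0 st tT; case: (brownian_increment bW s0 st).
- by move=> s t s0 st tT; case: (brownian_increment bW s0 st).
- by move=> s t s0 st tT; case: (brownian_increment bW s0 st).
Qed.

Lemma integrator_sub (T : R) (F F' : R -> set (set Omega)) W :
  integrator Pr T F W ->
  (forall t, 0 <= t <= T -> sub_algebra (F' t)) ->
  (forall s t, 0 <= s -> s <= t -> t <= T -> F' s `<=` F' t) ->
  (forall t, 0 <= t <= T -> measurable_wrt (F' t) (W t)) ->
  (forall t, 0 <= t <= T -> F' t `<=` F t) ->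
  integrator Pr T F' W.
Proof.
move=> itg sF mF WF FF; split => //.
- move=> s t s0 st tT A B FA FB; apply: (itg_indep itg s0 st tT) => //.
  by apply: FF => //; rewrite s0 (le_trans (ltW st)).
- exact: (itg_L2 itg).
- exact: (itg_mean itg).
- exact: (itg_var itg).
Qed.

End brownian_integrator.

Section game_filtrations.
Context {R : realType} {d : measure_display} {Omega : measurableType d}.
Context {N n k : nat}.
Variables (Pr : probability Omega R) (m : game R Omega N n k).
Hypothesis W_brownian : standard_brownian Pr (noise m).
Hypothesis hA1 : A1 Pr m.
Local Notation T := (horizon m).
Variable i : 'I_N.

(* [Wi] is still an integrator for this enlarged filtration, so the private Ito
   integrals are orthogonal to the whole common noise. *)
Definition Gplayer (t : R) : set (set Omega) :=
  sigma_of (coords (init m i) `|` path_upto (Wi m i) t `|` path_upto (W0 m) T).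

Lemma noise_measurable j (t : R) : 0 <= t -> measurable_fun setT (noise m j t).
Proof. by have [mW _ _ _ _] := W_brownian.1 j; exact: mW. Qed.

Lemma coords_measurable X : coords (init m i) X -> measurable_fun setT X.
Proof. by move=> [l ->]; exact: (A1_init_meas hA1). Qed.

(** The initial state is independent of all the noises together and the noises of one another, so
    probabilities of intersections split into three factors. *)
Lemma init_noise_independent j j' : j != j' ->
  independent Pr (sigma_of (coords (init m i) `|` all_path (noise m j)))
    (sigma_of (all_path (noise m j'))).
Proof.
move=> jj.
have sX : sub_algebra (sigma_of (coords (init m i))).
  by apply: sub_algebra_sigma_of; exact: coords_measurable.
have sW j0 : sub_algebra (sigma_of (all_path (noise m j0))).
  by apply: sub_algebra_sigma_of => _ [r r0 ->]; exact: noise_measurable.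
apply: (independent_join sX (sW j) (sW j')); last first.
  by move=> X [XS|XW]; [left|right]; exact: sigma_of_measurable_wrt.
move=> A B D GA HB KD.
have all_sub j0 : sigma_of (all_path (noise m j0)) `<=`
    sigma_of [set X | exists j, exists2 s, 0 <= s & X = noise m j s].
  by apply: sigma_ofS => _ [r r0 ->]; exists j0, r.
have sall : sub_algebra (sigma_of [set X | exists j, exists2 s, 0 <= s & X = noise m j s]).
  by apply: sub_algebra_sigma_of => _ [j0 [r r0 ->]]; exact: noise_measurable.
have GA' : sigma_of (\bigcup_(i in [set: 'I_N]) coords (init m i)) A.
  by apply: sigma_ofS GA => X XX; exists i.
have ind C : sigma_of [set X | exists j, exists2 s, 0 <= s & X = noise m j s] C ->
    (Pr (A `&` C) = Pr A * Pr C)%E.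
  by move=> hC; exact: (A1_init_noise hA1).
have BD : (Pr (B `&` D) = Pr B * Pr D)%E.
  have := W_brownian.2 (j |: [set j'])%SET (fun j0 => if j0 == j then B else D).
  rewrite big_setU1 ?inE//= big_set1 big_setU1 ?inE//= big_set1 eqxx.
  rewrite eq_sym (negbTE jj); apply => j0; rewrite !inE.
  by case: eqVneq => [->//|_] /= /eqP ->.
have allB := all_sub _ _ HB; have allD := all_sub _ _ KD.
rewrite -setIA ind; last exact: (sub_algebraI sall allB allD).
by rewrite BD muleA ind.
Qed.

Lemma Fplayer_sub t : sub_algebra (Fplayer m i t).
Proof.
apply: sub_algebra_sigma_of => X [[|]|].
- exact: coords_measurable.
- by move=> [r /andP[r0 _] ->]; exact: noise_measurable.
- by move=> [r /andP[r0 _] ->]; exact: noise_measurable.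
Qed.

Lemma Fcommon_sub t : sub_algebra (Fcommon m t).
Proof.
by apply: sub_algebra_sigma_of => X [r /andP[r0 _] ->]; exact: noise_measurable.
Qed.

Lemma Gplayer_sub t : sub_algebra (Gplayer t).
Proof.
apply: sub_algebra_sigma_of => X [[|]|].
- exact: coords_measurable.
- by move=> [r /andP[r0 _] ->]; exact: noise_measurable.
- by move=> [r /andP[r0 _] ->]; exact: noise_measurable.
Qed.

Lemma path_uptoS W (s t : R) : s <= t -> @path_upto R d Omega W s `<=` path_upto W t.
Proof. by move=> st _ [r /andP[r0 rs] ->]; exists r; rewrite // r0 (le_trans rs). Qed.

Lemma Fcommon_Fplayer t : Fcommon m t `<=` Fplayer m i t.
Proof. by apply: sigma_ofS => X hX; right. Qed.

Lemma Fcommon_mono s t : s <= t -> Fcommon m s `<=` Fcommon m t.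
Proof. by move=> st; apply: sigma_ofS; exact: path_uptoS. Qed.

Lemma Fplayer_Gplayer t : t <= T -> Fplayer m i t `<=` Gplayer t.
Proof. by move=> tT; apply: sigma_ofS; apply: setUS; exact: path_uptoS. Qed.

Lemma Fcommon_Gplayer t : Fcommon m T `<=` Gplayer t.
Proof. by apply: sigma_ofS => X hX; right. Qed.

(** [Fplayer] lies inside the filtration of [W0 m] enlarged at time 0 by the initial state and the
    entire private noise, to which [enlarged_integrator] applies. *)
Lemma Fplayer_integrator : integrator Pr T (Fplayer m i) (W0 m).
Proof.
have ne : lift ord0 i != ord0 :> 'I_N.+1 by [].
have := @enlarged_integrator _ _ _ Pr T _ (W0 m) _ (W_brownian.1 ord0)
  (init_noise_independent ne).
move=> /(_ _)/wrap[].
  by move=> X [/coords_measurable//|[r r0 ->]]; exact: noise_measurable.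
move=> h; apply: (integrator_sub h).
- by move=> t _; exact: Fplayer_sub.
- move=> s t s0 st _; apply: sigma_ofS; apply: setUSS; last exact: path_uptoS.
  by apply: setUS; exact: path_uptoS.
- move=> t /andP[t0 _]; apply: sigma_of_measurable_wrt; right.
  by exists t => //; rewrite t0 lexx.
- move=> t _; apply: sigma_ofS => X [[hX|hX]|hX]; [by left; left|left; right|by right].
  exact: path_upto_all hX.
Qed.

Lemma Fcommon_integrator : integrator Pr T (Fcommon m) (W0 m).
Proof.
apply: (integrator_sub Fplayer_integrator).
- by move=> t _; exact: Fcommon_sub.
- by move=> s t s0 st _; exact: Fcommon_mono.
- move=> t /andP[t0 _]; apply: sigma_of_measurable_wrt.
  by exists t => //; rewrite t0 lexx.
- by move=> t _; exact: Fcommon_Fplayer.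
Qed.

Lemma Gplayer_integrator : integrator Pr T Gplayer (Wi m i).
Proof.
have ne : ord0 != lift ord0 i :> 'I_N.+1 by [].
have := @enlarged_integrator _ _ _ Pr T _ (Wi m i) _ (W_brownian.1 (lift ord0 i))
  (init_noise_independent ne).
move=> /(_ _)/wrap[].
  by move=> X [/coords_measurable//|[r r0 ->]]; exact: noise_measurable.
move=> h; apply: (integrator_sub h).
- by move=> t _; exact: Gplayer_sub.
- move=> s t s0 st _; apply: sigma_ofS; apply: setSU.
  by apply: setUS; exact: path_uptoS.
- move=> t /andP[t0 _]; apply: sigma_of_measurable_wrt; left; right.
  by exists t => //; rewrite t0 lexx.
- move=> t _; apply: sigma_ofS => X [[hX|hX]|hX]; [by left; left|by right|left; right].
  exact: path_upto_all hX.
Qed.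

Lemma Fplayer_integrator_private : integrator Pr T (Fplayer m i) (Wi m i).
Proof.
apply: (integrator_sub Gplayer_integrator).
- by move=> t _; exact: Fplayer_sub.
- by have := itg_mono Fplayer_integrator.
- move=> t /andP[t0 _]; apply: sigma_of_measurable_wrt; left; right.
  by exists t => //; rewrite t0 lexx.
- by move=> t /andP[_ tT]; exact: Fplayer_Gplayer.
Qed.

Lemma private_common_independent :
  independent Pr (sigma_of (coords (init m i) `|` all_path (Wi m i))) (Fcommon m T).
Proof.
move=> A C hA hC; apply: (init_noise_independent (j := lift ord0 i) (j' := ord0)) => //.
by apply: sigma_ofS hC; exact: path_upto_all.
Qed.

End game_filtrations.

(** * Projection on the common noise *)

Section L2_density.
Context {d} {Omega : measurableType d} {R : realType}.
Variable Pr : probability Omega R.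
Local Notation E X := (\int[Pr]_w (X w)).
Local Notation L2P := (L2 Pr setT).
Local Notation n2P := (n2 Pr setT).
Local Notation ipP := (ip Pr setT).
Implicit Types (G H : set (set Omega)) (X Y Z : Omega -> R).

Lemma L2_dominated (f_ : nat -> Omega -> R) (f g : Omega -> R) :
  (forall q, measurable_fun setT (f_ q)) -> measurable_fun setT f -> L2P g ->
  (forall w, (f_ ^~ w : nat -> R) @ \oo --> f w) ->
  (forall q w, `|f w - f_ q w| <= `|g w|) ->
  forall eps : R, 0 < eps -> exists q,
    L2P (fun w => f w - f_ q w) /\ n2P (fun w => f w - f_ q w) <= eps.
Proof.
move=> mf_ mf Lg cf fg eps eps0.
have L q : L2P (fun w => f w - f_ q w).
  apply: (L2_dom measurableT _ Lg); first exact: measurable_funB.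
  by apply: aeW => w _; exact: fg.
have e2 : 0 < eps ^+ 2 by rewrite exprn_gt0.
have c0 : (fun q => \int[Pr]_w ((f w - f_ q w) ^+ 2)%:E)%E @ \oo --> 0%E.
  have [|||||_ _] := @dominated_convergence _ _ _ Pr setT measurableT
    (fun q w => ((f w - f_ q w) ^+ 2)%:E) (cst 0%E) (fun w => ((g w) ^+ 2)%:E).
  - by move=> q; apply/measurable_EFinP; apply: measurable_funX; exact: measurable_funB.
  - exact: measurable_cst.
  - apply: aeW => w _; apply: cvg_EFin; first by apply: nearW.
    rewrite [X in _ --> X](_ : _ = (f w - f w) * (f w - f w)); last first.
      by rewrite subrr mulr0.
    apply: cvgM; apply: cvgB; by [exact: cvg_cst|exact: cf].
  - by case: Lg.
  - apply: aeW => w q _; rewrite /= lee_fin ger0_norm ?sqr_ge0//.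
    rewrite -(real_normK (num_real (f w - f_ q w))) -(real_normK (num_real (g w))).
    by rewrite lerXn2r ?nnegrE// fg.
  by rewrite integral0.
have [q hq] := filter_ex (ecvg0_near e2 c0).
exists q; split => //; rewrite -(ler_pXn2r (ltn0Sn 1)) ?nnegrE ?n2_ge0 ?(ltW eps0)//.
by rewrite -lee_fin n2E// ltW.
Qed.

Definition simple_rv G X := exists l : seq (R * set Omega),
  (forall x, List.In x l -> G x.2) /\
  X = fun w => \sum_(x <- l) x.1 * \1_(x.2) w.

Import HBNNSimple.

(** The approximation is made on the space equipped with [G], so that the level sets belong to [G];
    [Y] itself dominates the error. *)
Lemma simple_rv_dense_ge0 G Y : sub_algebra G -> measurable_wrt G Y -> L2P Y ->
  (forall w, 0 <= Y w) -> forall eps : R, 0 < eps -> exists2 X, simple_rv G X &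
  L2P X /\ n2P (fun w => Y w - X w) <= eps.
Proof.
move=> sG mY LY Y0 eps eps0.
have mY' : measurable_fun [set: g_sigma_algebraType G] (fun w => (Y w)%:E).
  by apply/measurable_EFinP; apply/measurable_wrtE => //; case: sG.
pose f_ := nnsfun_approx measurableT mY'.
have simp q : simple_rv G (f_ q).
  pose s := finmap.enum_fset (fset_set (range (f_ q))).
  exists [seq (nth 0 s i, f_ q @^-1` [set nth 0 s i]) | i <- iota 0 (size s)]; split.
    move=> x xl; have [j _ ->] := In_map xl; rewrite /=.
    have : measurable ((f_ q : g_sigma_algebraType G -> R) @^-1` [set nth 0 s j]).
      by rewrite -[_ @^-1` _]setTI; apply: measurable_funP.
    by rewrite /measurable /= sigma_algebra_id//; case: sG.
  apply/funext => w; rewrite big_map -/(index_iota 0 (size s)).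
  rewrite [RHS](_ : _ = \sum_(0 <= j < size s) s`_j * \1_(f_ q @^-1` [set s`_j]) w); last first.
    by rewrite /index_iota subn0.
  by rewrite big_mkord (fimfunEord (f_ q)).
have mf q : measurable_fun setT (f_ q : Omega -> R).
  apply: (measurable_wrt_fun sG); apply/measurable_wrtE; first by case: sG.
  exact: measurable_funP.
have fY q w : 0 <= f_ q w <= Y w.
  rewrite fun_ge0 /= -lee_fin.
  by rewrite /f_ nnsfun_approxE; apply: le_approx => // y _; rewrite lee_fin.
have [|w||q [Lq hq]] := @L2_dominated (f_ : nat -> Omega -> R) Y Y mf _ LY _ _ eps eps0.
- by case: LY.
- have := @cvg_nnsfun_approx _ _ _ _ measurableT _ mY' (fun w _ => Y0 w) w I.
  by move/fine_cvgP => [].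
- by move=> q w; have /andP[a b] := fY q w; rewrite !ger0_norm ?subr_ge0// gerBl.
exists (f_ q); first exact: simp.
split => //; have := L2B measurableT LY Lq.
by congr L2; apply/funext => w; rewrite opprB addrC subrK.
Qed.

Lemma simple_rv_sub G X X' : simple_rv G X -> simple_rv G X' ->
  simple_rv G (fun w => X w - X' w).
Proof.
move=> [l [hl ->]] [l' [hl' ->]]; exists (l ++ [seq (- x.1, x.2) | x <- l']); split.
  move=> x xl; have [{}xl|{}xl] := In_cat xl; first exact: hl.
  by have [y yl e] := In_map xl; rewrite e /=; exact: hl' y yl.
apply/funext => w; rewrite big_cat big_map /= -sumrN; congr (_ + _).
by apply: eq_bigr => x _; rewrite mulNr.
Qed.

Lemma simple_rv_dense G Y : sub_algebra G -> measurable_wrt G Y -> L2P Y ->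
  forall eps : R, 0 < eps -> exists2 X, simple_rv G X &
  L2P X /\ n2P (fun w => Y w - X w) <= eps.
Proof.
move=> sG mY LY eps eps0; have eps2 : 0 < eps / 2 by rewrite divr_gt0.
have sG1 : sigma_algebra setT G by case: sG.
have mP : measurable_wrt G (fun w => Num.max (Y w) 0).
  by apply/measurable_wrtE => //; apply: measurable_maxr => //; exact/measurable_wrtE.
have mN : measurable_wrt G (fun w => Num.max (- Y w) 0).
  apply/measurable_wrtE => //; apply: measurable_maxr => //.
  by apply: measurableT_comp => //; exact/measurable_wrtE.
have LP : L2P (fun w => Num.max (Y w) 0).
  apply: (L2_dom measurableT _ LY); first exact: measurable_wrt_fun mP.
  apply: aeW => w _; case: (leP (Y w) 0) => h; last by [].
  by rewrite normr0 normr_ge0.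
have LN : L2P (fun w => Num.max (- Y w) 0).
  apply: (L2_dom measurableT _ LY); first exact: measurable_wrt_fun mN.
  apply: aeW => w _; case: (leP (- Y w) 0) => h; last by rewrite normrN.
  by rewrite normr0 normr_ge0.
have max0 (Z : Omega -> R) w : 0 <= Num.max (Z w) 0 by rewrite le_max lexx orbT.
have [X sX [LX hX]] := simple_rv_dense_ge0 sG mP LP (max0 Y) eps2.
have [X' sX' [LX' hX']] := simple_rv_dense_ge0 sG mN LN (max0 (fun w => - Y w)) eps2.
exists (fun w => X w - X' w); first exact: simple_rv_sub.
split; first exact: L2B.
rewrite (_ : (fun w => _) = fun w => (Num.max (Y w) 0 - X w) - (Num.max (- Y w) 0 - X' w)).
  apply: le_trans (n2B measurableT _ _) _; [exact: L2B|exact: L2B|].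
  by rewrite [leRHS]splitr lerD.
apply/funext => w; have eY : Y w = Num.max (Y w) 0 - Num.max (- Y w) 0.
  by case: leP => h; case: leP => h'; lra.
by rewrite {1}eY; ring.
Qed.

(** Indicators span a dense subspace. This turns the averages over sets that define conditional
    expectations into orthogonality in L2. *)
Lemma ip_orth_sets G D Y : sub_algebra G -> L2P D ->
  (forall A, G A -> ipP D (\1_A) = 0) -> measurable_wrt G Y -> L2P Y -> ipP D Y = 0.
Proof.
move=> sG LD hD mY LY; apply/eqP; rewrite -normr_le0.
apply: le0_eps => eps eps0.
have c0 : 0 < n2P D + 1 by rewrite ltr_wpDl// n2_ge0.
have [X [l [hl eX]] [LX hX]] := simple_rv_dense sG mY LY (divr_gt0 eps0 c0).
have iX : ipP D X = 0.
  rewrite ipC eX; elim: {LX hX eX} l hl => [|x l IH] hl.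
    by rewrite /ip (_ : (fun w => _) = fun=> 0) ?Rintegral_cst ?mul0r//; apply/funext => w; rewrite big_nil mul0r.
  have LI A : G A -> L2P (\1_A).
    move=> Gx; apply: L2P_bounded.
      exact: measurable_wrt_fun (measurable_wrt_indic sG Gx).
    by exists 1 => w; rewrite indicE; case: (_ \in _); rewrite ?normr1 ?normr0.
  have L1 (x' : R * set Omega) : G x'.2 -> L2P (fun w => x'.1 * \1_(x'.2) w).
    by move=> Gx; apply: L2Z => //; exact: LI.
  have Ll : L2P (fun w => \sum_(x <- l) x.1 * \1_(x.2) w).
    elim: {IH} l hl => [|y l IH] hl.
      by have := L20 Pr measurableT; congr L2; apply/funext => w; rewrite big_nil.
    have := L2D measurableT (L1 y (hl y (or_intror (or_introl erefl)))) (IH _).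
    move=> /(_ _)/wrap[]; first by move=> z [<-|zl]; apply: hl; [left|right; right].
    by congr L2; apply/funext => w; rewrite big_cons.
  have Gx : G x.2 by apply: hl; left.
  rewrite (_ : (fun w => _) = fun w => x.1 * \1_(x.2) w + \sum_(x <- l) x.1 * \1_(x.2) w).
    rewrite ipDl// ?IH ?addr0; [|by move=> y yl; apply: hl; right|exact: L1].
    rewrite (ipZl measurableT x.1 (LI _ Gx) LD).
    by rewrite [X in _ * X]ipC hD// mulr0.
  by apply/funext => w; rewrite big_cons.
have -> : ipP D Y = ipP D (fun w => Y w - X w).
  by rewrite ipC [RHS]ipC ipBl// (ipC _ _ X) iX subr0.
apply: le_trans (cauchy_schwarz measurableT LD _) _; first exact: L2B.
apply: (@le_trans _ _ ((n2P D + 1) * (eps / (n2P D + 1)))).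
  by apply: ler_pM; rewrite ?n2_ge0// lerDl.
by rewrite mulrCA mulfV ?mulr1// gt_eqF.
Qed.

End L2_density.

(** * Weak bounds of conditional means *)

Section weak_projection.
Context {d} {Omega : measurableType d} {R : realType}.
Variable Pr : probability Omega R.
Local Notation leb := (@lebesgue_measure R).
Local Notation E X := (\int[Pr]_w (X w)).
Local Notation L2P := (L2 Pr setT).
Local Notation n2P := (n2 Pr setT).
Local Notation ipP := (ip Pr setT).
Local Notation L2t := (L2t Pr).
Local Notation n2t := (n2t Pr).
Implicit Types (G H F : set (set Omega)) (X Y Z : Omega -> R).

(** Lets inequalities between norms at almost every time become inequalities on the slab, by
    domination in time. *)
Lemma n2P_slices (s t : R) (f : R -> Omega -> R) : L2t s t f ->
  L2 leb `[s, t] (fun r => n2P (f r)) /\ n2 leb `[s, t] (fun r => n2P (f r)) = n2t s t f.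
Proof.
move=> Lf; have If := L2t_mul Lf Lf.
have [I1 _ e _] := @slab_Rfubini _ _ _ _ s t (fun r w => f r w * f r w) If.
have e2 : (fun r => n2P (f r) * n2P (f r)) = (fun r => E (fun w => f r w * f r w)).
  by apply/funext => r; rewrite -expr2 n2_sqr.
split.
  split.
    case/integrableP: I1 => /measurable_EFinP m1 _.
    have ms : @measurable_fun _ _ (measurableTypeR R) (measurableTypeR R) setT Num.sqrt.
      by apply: continuous_measurable_fun; exact: sqrt_continuous.
    exact: (measurableT_comp ms m1).
  by apply: eq_integrable I1 => // r _; rewrite n2_sqr.
by rewrite /n2t {1}/n2 /ip e2 /n2 /ip e.
Qed.

(* Says that the norm of E[X | H] is at most kappa, without conditional expectations. *)
Definition pb H (kappa : R) X := forall Y, measurable_wrt H Y -> L2P Y ->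
  `|ipP X Y| <= kappa * n2P Y.

Lemma pbD H (k1 k2 : R) X X' : L2P X -> L2P X' -> pb H k1 X -> pb H k2 X' ->
  pb H (k1 + k2) (fun w => X w + X' w).
Proof.
move=> LX LX' h h' Y mY LY; rewrite ipDl// mulrDl.
by apply: le_trans (ler_normD _ _) _; apply: lerD; [exact: h|exact: h'].
Qed.

Lemma pbZ H (k c : R) X : L2P X -> pb H k X -> pb H (`|c| * k) (fun w => c * X w).
Proof.
by move=> LX h Y mY LY; rewrite ipZl// normrM -mulrA ler_wpM2l//; exact: h.
Qed.

Lemma pbW H (k1 k2 : R) X : k1 <= k2 -> pb H k1 X -> pb H k2 X.
Proof.
move=> k12 h Y mY LY; apply: le_trans (h Y mY LY) _.
by rewrite ler_wpM2r// n2_ge0.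
Qed.

Lemma pb_n2 H X : L2P X -> pb H (n2P X) X.
Proof. by move=> LX Y _ LY; exact: cauchy_schwarz. Qed.

Lemma pb_sum H (I : Type) (r : seq I) (k : I -> R) (X : I -> Omega -> R) :
  (forall i, L2P (X i)) -> (forall i, pb H (k i) (X i)) ->
  pb H (\sum_(i <- r) k i) (fun w => \sum_(i <- r) X i w).
Proof.
move=> LX h Y mY LY; rewrite ip_suml// mulr_suml.
by apply: le_trans (ler_norm_sum _ _ _) _; apply: ler_sum => i _; exact: h.
Qed.

Lemma pb_eq_ae H (k : R) X X' : measurable_fun setT X -> L2P X' ->
  {ae Pr, forall w, X w = X' w} -> pb H k X' -> pb H k X.
Proof.
move=> mX LX' e h Y mY LY; suff -> : ipP X Y = ipP X' Y by exact: h.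
have [LX _] : L2P X /\ n2P X = n2P X'.
  by apply: n2_eq_ae => //; apply: filterS e => w h' _.
rewrite /ip /Rintegral; congr fine; apply: ae_eq_integral => //.
- by apply/measurable_EFinP; apply: measurable_funM => //; case: LY.
- by apply/measurable_EFinP; apply: measurable_funM => //; [case: LX'|case: LY].
- by apply: filterS e => w h' _ /=; rewrite h'.
Qed.

(** Pairing with [Y] commutes with the time integral by Fubini, so the bounds at almost every time
    are integrated. *)
Lemma pb_tint H (s t k : R) (f : R -> Omega -> R) : s <= t -> L2t s t f -> 0 <= k ->
  {ae leb, forall r, s <= r <= t -> pb H k (f r)} ->
  pb H ((t - s) * k) (tint f s t).
Proof.
move=> st Lf k0 h Y mY LY.
have Ifg := L2t_mul Lf (L2t_fun s t LY).
have [I1 _ e1 e2] := @slab_Rfubini _ _ _ _ s t (fun r w => f r w * Y w) Ifg.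
have -> : ipP (tint f s t) Y = \int[leb]_(r in `[s, t]) ipP (f r) Y.
  rewrite -[RHS]e1 e2 /ip /Rintegral; congr fine; apply: ae_eq_integral => //.
  - have [Lt _] := tint_L2 st Lf.
    by apply/measurable_EFinP; apply: measurable_funM => //; [case: Lt|case: LY].
  - have [_ I2 _ _] := @slab_Rfubini _ _ _ _ s t (fun r w => f r w * Y w) Ifg.
    by case/integrableP: I2.
  - apply: filterS (path_integrable Lf) => w Iw _; congr EFin.
    by rewrite /tint -RintegralZr.
apply: le_trans (le_normr_Rintegral _ I1) _ => //.
have lst : fine (leb `[s, t]) = t - s.
  rewrite lebesgue_measure_itv /= lte_fin; move: st; rewrite le_eqVlt => /orP[/eqP ->|->//].
  by rewrite ltxx subrr.
rewrite -mulrA -[leRHS]mulrC -[in leRHS]lst -Rintegral_cst//.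
have mc : measurable_fun `[s, t] (fun r : measurableTypeR R => (`|ipP (f r) Y|)%:E).
  apply/measurable_EFinP; apply: measurableT_comp => //; apply/measurable_EFinP.
  by case/integrableP: I1.
have Ic : leb.-integrable `[s, t] (cst (k * n2P Y)%:E).
  have := L2_mul (mitv s t) (L2Z (mitv s t) (k * n2P Y) (L2_cst1 s t)) (L2_cst1 s t).
  by apply: eq_integrable => // r _; rewrite !mulr1.
apply: fine_le.
- apply: integrable_fin_num => //.
  by have := integrable_abse I1; apply: eq_integrable.
- exact: integrable_fin_num.
- apply: ae_ge0_le_integral => //.
  + by move=> r _; rewrite lee_fin mulr_ge0// n2_ge0.
  + by apply: filterS h => r h; rewrite /= in_itv /= => rst; rewrite lee_fin; exact: h.
Qed.

(* [X0] is an explicit E[X | H], and it depends only on the smaller sigma-algebra [G];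
   typically [X] is the product of a private and a common indicator. *)
Definition projectable G F H X := [/\ measurable_wrt F X, rbounded X &
  exists X0, [/\ measurable_wrt G X0, rbounded X0 &
    forall Z, measurable_wrt H Z -> Pr.-integrable setT (fun w => (Z w)%:E) ->
      E (fun w => X w * Z w) = E (fun w => X0 w * Z w)]].

Section ito_projection.
Variables (T : R) (W : R -> Omega -> R) (F Fc : R -> set (set Omega)) (H : set (set Omega)).
Hypothesis itg : integrator Pr T F W.
Hypothesis itgc : integrator Pr T Fc W.
Hypothesis sH : sub_algebra H.
Hypothesis FcH : forall t, 0 <= t <= T -> Fc t `<=` H.
Hypothesis dense : forall (a : R) X, 0 <= a <= T -> measurable_wrt (F a) X -> L2P X ->
  forall eps : R, 0 < eps -> exists2 X', projectable (Fc a) (F a) H X' &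
    n2P (fun w => X w - X' w) <= eps.

Lemma ip_E X Y : ipP X Y = E (fun w => X w * Y w). Proof. by []. Qed.

Lemma bounded_integrable_mul X Z : measurable_fun setT X -> rbounded X ->
  Pr.-integrable setT (fun w => (Z w)%:E) ->
  Pr.-integrable setT (fun w => (X w * Z w)%:E).
Proof.
move=> mX [c Xc] IZ.
have IcZ : Pr.-integrable setT (fun w => (c * Z w)%:E) by exact: (integrableZl measurableT c IZ).
apply: le_integrable IcZ => //.
  apply/measurable_EFinP; apply: measurable_funM => //.
  by case/integrableP: IZ => /measurable_EFinP.
move=> w _; rewrite lee_fin !normrM ler_wpM2r//.
by apply: le_trans (Xc w) _; exact: ler_norm.
Qed.

(** Conditioning on [H] acts on the coefficients of an elementary process alone, the increments of
    [W] being [H]-measurable. Thus [e'] approximates [e], and [e0] is the conditional expectation of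
    [e'], for the process as well as for its integral. *)
Lemma projectable_eproc (s t : R) e : 0 <= s -> s <= t -> t <= T -> evalid F s t e ->
  forall eps : R, 0 < eps -> exists e' e0,
  [/\ evalid F s t e', evalid Fc s t e0,
    forall r Z, measurable_wrt H Z -> L2P Z -> ipP (eeval e' r) Z = ipP (eeval e0 r) Z,
    forall Y, measurable_wrt H Y -> L2P Y -> ipP (eint W e') Y = ipP (eint W e0) Y &
    n2t s t (fun r w => eeval e r w - eeval e' r w) <= eps].
Proof.
move=> s0 st tT; elim: e => [_|x e IH he] eps eps0.
  exists [::], [::]; split => //.
  have -> : (fun r w => eeval [::] r w - eeval [::] r w) = fun _ (_ : Omega) => (0 : R).
    by apply/funext => r; apply/funext => w; rewrite subrr.
  rewrite /n2t (n20 _ (measurable_slab s t)).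

  exact: ltW.
have eps2 : 0 < eps / 2 by rewrite divr_gt0.
have {}IH := IH (fun y ye => he y (or_intror ye)).
have [e' [e0 [he' he0 h1 h2 h3]]] := IH _ eps2.
have [sx xx xt mx bx] := he x (or_introl erefl).
have x0T : 0 <= x.1.1 <= T by rewrite (le_trans s0 sx) (le_trans xx (le_trans xt tT)).
have x1T : 0 <= x.1.2 <= T by case/andP: x0T => x0 _; rewrite (le_trans x0 xx) (le_trans xt tT).
have sF := itg_sub itg x0T; have sFc := itg_sub itgc x0T.
(* [n2t_slices_le] will multiply the error of the coefficient by [sqrt(t - s)]; the 1 keeps the
   divisor positive. *)
have ts1 : 0 < Num.sqrt (t - s) + 1 by rewrite ltr_wpDl// sqrtr_ge0.
have [X [mX bX [X0 [mX0 bX0 hX]]] nX] := @dense x.1.1 x.2 x0T mx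
  (L2P_bounded Pr (measurable_wrt_fun sF mx) bx) _ (divr_gt0 eps2 ts1).
have Mx := measurable_wrt_fun sF mx.
have MX := measurable_wrt_fun sF mX; have MX0 := measurable_wrt_fun sFc mX0.
exists ((x.1, X) :: e'), ((x.1, X0) :: e0).
have v' : evalid F s t ((x.1, X) :: e') by move=> y [<-|ye]; [split|exact: he'].
have v0 : evalid Fc s t ((x.1, X0) :: e0) by move=> y [<-|ye]; [split|exact: he0].
have consE (y : R * R * (Omega -> R)) l r w :
    eeval (y :: l) r w = y.2 w * (y.1.1 < r <= y.1.2)%R%:R + eeval l r w.
  by rewrite /eeval big_cons.
have consI (y : R * R * (Omega -> R)) l w :
    eint W (y :: l) w = y.2 w * (W y.1.2 w - W y.1.1 w) + eint W l w.
  by rewrite /eint big_cons.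
have Lev l r : evalid F s t l -> L2P (eeval l r).
  elim: l => [_|y l IHl hl].
    by have := L20 Pr measurableT; congr L2; apply/funext => w; rewrite /eeval big_nil.
  have [sy yy yt my by_] := hl y (or_introl erefl).
  have y0T : 0 <= y.1.1 <= T by rewrite (le_trans s0 sy) (le_trans yy (le_trans yt tT)).
  have Ly := L2Z measurableT (y.1.1 < r <= y.1.2)%R%:R
    (L2P_bounded Pr (measurable_wrt_fun (itg_sub itg y0T) my) by_).
  have := L2D measurableT Ly (IHl (fun z zl => hl z (or_intror zl))).
  by congr L2; apply/funext => w; rewrite consE mulrC.
have Levc l r : evalid Fc s t l -> L2P (eeval l r).
  elim: l => [_|y l IHl hl].
    by have := L20 Pr measurableT; congr L2; apply/funext => w; rewrite /eeval big_nil.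
  have [sy yy yt my by_] := hl y (or_introl erefl).
  have y0T : 0 <= y.1.1 <= T by rewrite (le_trans s0 sy) (le_trans yy (le_trans yt tT)).
  have Ly := L2Z measurableT (y.1.1 < r <= y.1.2)%R%:R
    (L2P_bounded Pr (measurable_wrt_fun (itg_sub itgc y0T) my) by_).
  have := L2D measurableT Ly (IHl (fun z zl => hl z (or_intror zl))).
  by congr L2; apply/funext => w; rewrite consE mulrC.
have LX : L2P X by exact: L2P_bounded.
have LX0 : L2P X0 by exact: L2P_bounded.
have hXip Z : measurable_wrt H Z -> L2P Z -> ipP X Z = ipP X0 Z.
  by move=> mZ LZ; rewrite !ip_E; apply: hX => //; exact: L2P_integrable.
split => //.
- move=> r Z mZ LZ; set b : R := (x.1.1 < r <= x.1.2)%R%:R.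
  rewrite (_ : eeval ((x.1, X) :: e') r = fun w => b * X w + eeval e' r w); last first.
    by apply/funext => w; rewrite consE mulrC.
  rewrite (_ : eeval ((x.1, X0) :: e0) r = fun w => b * X0 w + eeval e0 r w); last first.
    by apply/funext => w; rewrite consE mulrC.
  rewrite (ipDl measurableT (L2Z measurableT b LX) (Lev _ _ he') LZ).
  rewrite (ipDl measurableT (L2Z measurableT b LX0) (Levc _ _ he0) LZ).
  by rewrite (ipZl measurableT b LX LZ) (ipZl measurableT b LX0 LZ) (hXip Z)// (h1 r Z).
- move=> Y mY LY; set dW := fun w => W x.1.2 w - W x.1.1 w.
  have LdW : L2P dW by apply: (integrator_dW_L2 itg); case/andP: x0T x1T => [? ?] /andP[].
  have LXd : L2P (fun w => X w * dW w) by exact: L2P_bounded_mul.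
  have LX0d : L2P (fun w => X0 w * dW w) by exact: L2P_bounded_mul.
  have Le' := evalid_L2 itg s0 tT he'; have Le0 := evalid_L2 itgc s0 tT he0.
  rewrite (_ : eint W ((x.1, X) :: e') = fun w => X w * dW w + eint W e' w); last first.
    by apply/funext => w; rewrite consI.
  rewrite (_ : eint W ((x.1, X0) :: e0) = fun w => X0 w * dW w + eint W e0 w); last first.
    by apply/funext => w; rewrite consI.
  rewrite (ipDl measurableT LXd Le' LY) (ipDl measurableT LX0d Le0 LY) (h2 Y)//.
  congr (_ + _); rewrite !ip_E.
  have mdW : measurable_wrt H dW.
    apply: measurable_wrtB => //; (apply: measurable_wrtS; last by apply: (itg_meas itgc)).
      exact: FcH.
    exact: FcH.
  rewrite (_ : (fun w => _) = fun w => X w * (dW w * Y w)); last first.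
    by apply/funext => w; rewrite mulrA.
  rewrite [in RHS](_ : (fun w => _) = fun w => X0 w * (dW w * Y w)); last first.
    by apply/funext => w; rewrite mulrA.
  (* The test variable [dW * Y] is only integrable, which is why [projectable] tests against
     integrable variables. *)
  apply: hX; first exact: measurable_wrtM.
  exact: (L2_mul measurableT LdW LY).
- have Lt1 : L2t s t (fun r w => (x.2 w - X w) * (x.1.1 < r <= x.1.2)%R%:R).
    apply: L2t_step; first exact: measurable_funB.
    case: bx bX => [c hc] [c' hc']; exists (c + c') => w.
    by apply: le_trans (ler_normB _ _) _; exact: lerD.
  have Lt2 : L2t s t (fun r w => eeval e r w - eeval e' r w).
    apply: (L2B (measurable_slab s t)); apply: (evalid_L2t itg) => //.
    by move=> y ye; apply: he; right.
  have LxX : L2P (fun w => x.2 w - X w) by apply: L2B => //; exact: L2P_bounded.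
  have le1 : n2t s t (fun r w => (x.2 w - X w) * (x.1.1 < r <= x.1.2)%R%:R) <= eps / 2.
    have [||||_ h] := @n2t_slices_le _ _ _ Pr s t
        (fun r w => (x.2 w - X w) * (x.1.1 < r <= x.1.2)%R%:R) (eps / 2 / (Num.sqrt (t - s) + 1)) => //.
    - by rewrite ltW// divr_gt0.
    - by case: Lt1.
    - move=> r _; have := L2Z measurableT (x.1.1 < r <= x.1.2)%R%:R LxX.
      have := n2Z measurableT (x.1.1 < r <= x.1.2)%R%:R LxX.
      rewrite (_ : (fun w => _) = fun w => (x.2 w - X w) * (x.1.1 < r <= x.1.2)%R%:R); last first.
        by apply/funext => w; rewrite mulrC.
      move=> -> L; split => //; apply: le_trans nX.
      rewrite -[leRHS]mul1r ler_wpM2r ?n2_ge0//.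
      by case: (_ < _ <= _); rewrite ?normr1 ?normr0.
    apply: le_trans h _; rewrite mulrCA -ler_pdivlMl ?divr_gt0// mulVf ?gt_eqF//.
    by rewrite ler_pdivrMr// mul1r lerDl.
  rewrite [leRHS]splitr; apply: le_trans (lerD le1 h3).
  apply: le_trans (n2D (measurable_slab s t) Lt1 Lt2).
  rewrite le_eqVlt; apply/orP; left; apply/eqP; congr n2.
  by apply/funext => -[r w]; rewrite !consE /=; ring.
Qed.

(* [e'] takes values with an explicit conditional expectation [e0] given [H]:
   then [n2 (e0_r) <= k + n2 (e'_r - h_r)] for a.e. [r], and the isometry concludes. *)
Lemma pb_itoinc (s t k : R) h M : 0 <= s -> s <= t -> t <= T -> 0 <= k ->
  itoinc Pr F W s t h M -> {ae leb, forall r, s <= r <= t -> pb H k (h r)} ->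
  pb H (Num.sqrt (t - s) * k) M.
Proof.
move=> s0 st tT k0 [Lh LM a] hk Y mY LY; apply/ler_addgt0Pr => eps eps0.
have c0 : 0 < n2P Y + 1 by rewrite ltr_wpDl// n2_ge0.
(* Four errors of size [eta] are collected at the end, each multiplied by [n2P Y]. *)
pose eta := eps / (n2P Y + 1) / 4.
have eta0 : 0 < eta by rewrite !divr_gt0.
have [e [he e1 e2]] := a _ eta0.
have [e' [e0 [he' he0 h1 h2 h3]]] := projectable_eproc s0 st tT he eta0.
have Le := evalid_L2t itg s0 tT he; have Le' := evalid_L2t itg s0 tT he'.
have Le0 := evalid_L2t itgc s0 tT he0.
have Ie := evalid_L2 itg s0 tT he; have Ie' := evalid_L2 itg s0 tT he'.
have Ie0 := evalid_L2 itgc s0 tT he0.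
have Ld : L2t s t (fun r w => h r w - eeval e' r w) by exact: (L2B (measurable_slab s t)).
have nd : n2t s t (fun r w => h r w - eeval e' r w) <= eta + eta.
  apply: le_trans (lerD e1 h3).
  apply: le_trans (n2D (measurable_slab s t) _ _).
  - rewrite le_eqVlt; apply/orP; left; apply/eqP; congr n2.
    by apply/funext => -[r w] /=; ring.
  - exact: (L2B (measurable_slab s t)).
  - exact: (L2B (measurable_slab s t)).
have me0 r : measurable_wrt H (eeval e0 r).
  elim: (e0) (he0) => [_|y l IHl hl].
    rewrite (_ : eeval [::] r = fun=> 0); first exact: measurable_wrt_cst.
    by apply/funext => w; rewrite /eeval big_nil.
  rewrite (_ : eeval (y :: l) r = fun w => y.2 w * (y.1.1 < r <= y.1.2)%R%:R + eeval l r w); last first.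
    by apply/funext => w; rewrite /eeval big_cons.
  apply: measurable_wrtD => //; last by apply: IHl => z zl; apply: hl; right.
  have [sy yy yt my _] := hl y (or_introl erefl).
  apply: measurable_wrtM => //; last exact: measurable_wrt_cst.
  by apply: measurable_wrtS my; apply: FcH; rewrite (le_trans s0 sy) (le_trans yy (le_trans yt tT)).
have sl : {ae leb, forall r, s <= r <= t ->
    n2P (eeval e0 r) <= k + n2P (fun w => h r w - eeval e' r w)}.
  have S1 := L2t_slices Lh; have S2 := L2t_slices Le'; have S3 := L2t_slices Le0.
  apply: filterS2 (filterI S1 S2) (filterI S3 hk) => r [S1r S2r] [S3r hkr] rst.
  have {}S1r := S1r rst; have {}S2r := S2r rst; have {}S3r := S3r rst; have {}hkr := hkr rst.
  have LB : L2P (fun w => h r w - eeval e' r w) by exact: L2B.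
  (* [eeval e0 r] is [H]-measurable, so it may itself serve as the test variable. *)
  have key : n2P (eeval e0 r) ^+ 2 <=
      (k + n2P (fun w => h r w - eeval e' r w)) * n2P (eeval e0 r).
    rewrite n2_sqr -(h1 r) ?mulrDl//.
    rewrite (_ : ipP _ _ = ipP (h r) (eeval e0 r) - ipP (fun w => h r w - eeval e' r w) (eeval e0 r)); last first.
      by rewrite (ipBl measurableT S1r S2r S3r); ring.
    apply: le_trans (ler_norm _) _; apply: le_trans (ler_normB _ _) _.
    by apply: lerD; [exact: hkr|exact: cauchy_schwarz].
  have [->|x0] := eqVneq (n2P (eeval e0 r)) 0; first by rewrite addr_ge0// n2_ge0.
  by rewrite -(ler_pM2r (_ : 0 < n2P (eeval e0 r))) -?expr2// lt_neqAle eq_sym x0 n2_ge0.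
have x_le : n2t s t (eeval e0) <= Num.sqrt (t - s) * k + (eta + eta).
  have [L1 <-] := n2P_slices Le0; have [L2_ E2] := n2P_slices Ld.
  have Lk := L2Z (mitv s t) k (L2_cst1 s t).
  apply: (@le_trans _ _ (n2 leb `[s, t] (fun r => k * 1 + n2P (fun w => h r w - eeval e' r w)))).
    apply: n2_dom => //; [by case: L1|exact: L2D|].
    apply: filterS sl => r sl; rewrite /= in_itv /= => rst.
    by rewrite mulr1 !ger0_norm ?addr_ge0 ?n2_ge0// sl.
  apply: le_trans (n2D (mitv s t) Lk L2_) _.
  rewrite (n2Z (mitv s t) k (L2_cst1 s t)) n2_cst1// ger0_norm// mulrC.
  by apply: lerD => //; rewrite E2.
have ee' : n2P (fun w => eint W e w - eint W e' w) <= eta.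
  by rewrite (ito_isometry_elementary_sub itg s0 tT he he').
have MB : n2P (fun w => M w - eint W e' w) <= eta + eta.
  apply: le_trans (lerD e2 ee').
  apply: le_trans (n2D measurableT _ _); [|exact: L2B|exact: L2B].
  by rewrite le_eqVlt; apply/orP; left; apply/eqP; congr n2; apply/funext => w; ring.
have LMB : L2P (fun w => M w - eint W e' w) by exact: L2B.
rewrite (_ : ipP M Y = ipP (fun w => M w - eint W e' w) Y + ipP (eint W e0) Y); last first.
  by rewrite (ipBl measurableT LM Ie' LY) (h2 Y)// subrK.
apply: le_trans (ler_normD _ _) _.
apply: (@le_trans _ _ ((eta + eta) * n2P Y + (Num.sqrt (t - s) * k + (eta + eta)) * n2P Y)).
  apply: lerD.
    by apply: le_trans (cauchy_schwarz measurableT LMB LY) _; rewrite ler_wpM2r// n2_ge0.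
  apply: le_trans (cauchy_schwarz measurableT Ie0 LY) _; rewrite ler_wpM2r ?n2_ge0//.
  by rewrite (ito_isometry_elementary itgc s0 tT he0).
have : eta * 4 * n2P Y <= eps.
  rewrite /eta divfK//; rewrite -mulrA ger_pMr// ler_pdivrMl// mulr1 lerDl//.
lra.
Qed.

End ito_projection.

(** * Density of the projectable variables *)

Section projectable_density.
Variables (Gp G H : set (set Omega)) (S : set (Omega -> R)).
Local Notation F := (sigma_of S).
Hypotheses (sGp : sub_algebra Gp) (sG : sub_algebra G) (sH : sub_algebra H).
Hypotheses (GH : G `<=` H) (GpF : Gp `<=` F) (GF : G `<=` F).
Hypothesis sF : sub_algebra F.
Hypothesis ind : independent Pr Gp H.
Hypothesis genF : forall X : Omega -> R, S X -> measurable_wrt Gp X \/ measurable_wrt G X.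
Local Notation V := (projectable G F H).

Lemma rbounded_indic (A : set Omega) : rbounded (\1_A : Omega -> R).
Proof. by exists 1 => w; rewrite indicE; case: (_ \in _); rewrite ?normr1 ?normr0. Qed.

Lemma rboundedD X Y : rbounded X -> rbounded Y -> rbounded (fun w => X w + Y w).
Proof.
move=> [c h] [c' h']; exists (c + c') => w.
by apply: le_trans (ler_normD _ _) _; exact: lerD.
Qed.

Lemma rboundedM X Y : rbounded X -> rbounded Y -> rbounded (fun w => X w * Y w).
Proof.
by move=> [c h] [c' h']; exists (c * c') => w; rewrite normrM; exact: ler_pM.
Qed.

Lemma projectableD X Y : V X -> V Y -> V (fun w => X w + Y w).
Proof.
move=> [mX bX [X0 [mX0 bX0 hX]]] [mY bY [Y0 [mY0 bY0 hY]]]; split.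
- exact: measurable_wrtD.
- exact: rboundedD.
exists (fun w => X0 w + Y0 w); split; [exact: measurable_wrtD|exact: rboundedD|].
move=> Z mZ IZ.
have D A B : measurable_fun setT A -> rbounded A -> measurable_fun setT B -> rbounded B ->
    E (fun w => (A w + B w) * Z w) = E (fun w => A w * Z w) + E (fun w => B w * Z w).
  move=> mA bA mB bB; rewrite -RintegralD//; try exact: bounded_integrable_mul.
  by congr Rintegral; apply/funext => w; rewrite mulrDl.
rewrite (D X Y (measurable_wrt_fun sF mX) bX (measurable_wrt_fun sF mY) bY).
rewrite (D X0 Y0 (measurable_wrt_fun sG mX0) bX0 (measurable_wrt_fun sG mY0) bY0).
by rewrite hX// hY.
Qed.

Lemma projectableZ (c : R) X : V X -> V (fun w => c * X w).
Proof.
move=> [mX bX [X0 [mX0 bX0 hX]]].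
have bc : rbounded (fun _ : Omega => c) by exists `|c|.
split; [by apply: measurable_wrtM => //; exact: measurable_wrt_cst|exact: rboundedM|].
exists (fun w => c * X0 w); split.
- by apply: measurable_wrtM => //; exact: measurable_wrt_cst.
- exact: rboundedM.
move=> Z mZ IZ.
have Zc A : measurable_fun setT A -> rbounded A ->
    E (fun w => (c * A w) * Z w) = c * E (fun w => A w * Z w).
  move=> mA bA; rewrite -RintegralZl//; last exact: bounded_integrable_mul.
  by congr Rintegral; apply/funext => w; rewrite mulrA.
rewrite (Zc X (measurable_wrt_fun sF mX) bX) (Zc X0 (measurable_wrt_fun sG mX0) bX0).
by rewrite hX.
Qed.

(** [B] belongs to [H] and [A] is independent of [H], so the conditional expectation is the
    probability of [A] times the indicator of [B]. *)
Lemma projectable_rect A B : Gp A -> G B -> V (\1_(A `&` B)).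
Proof.
move=> GA GB; have FAB := sub_algebraI sF (GpF GA) (GF GB).
split; [exact: measurable_wrt_indic|exact: rbounded_indic|].
have bc : rbounded (fun _ : Omega => E (\1_A)) by exists `|E (\1_A)|.
exists (fun w => E (\1_A) * \1_B w); split.
- by apply: measurable_wrtM => //; [exact: measurable_wrt_cst|exact: measurable_wrt_indic].
- by apply: rboundedM => //; exact: rbounded_indic.
move=> Z mZ IZ.
have mB : measurable_wrt G (\1_B : Omega -> R) by exact: measurable_wrt_indic.
have IA : Pr.-integrable setT (fun w => ((\1_A w : R))%:E).
  apply: L2P_integrable; apply: L2P_bounded; last exact: rbounded_indic.
  by apply: measurable_wrt_fun sGp _; exact: measurable_wrt_indic.
have IBZ : Pr.-integrable setT (fun w => (\1_B w * Z w)%:E).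
  by apply: bounded_integrable_mul => //; [exact: (measurable_wrt_fun sG mB)|exact: rbounded_indic].
have mBZ : measurable_wrt H (fun w => \1_B w * Z w).
  by apply: measurable_wrtM => //; apply: measurable_wrtS mB.
have [_ e] := independent_mul sGp sH ind (measurable_wrt_indic sGp GA) mBZ IA IBZ.
rewrite (_ : (fun w => _) = fun w => \1_A w * (\1_B w * Z w)); last first.
  by apply/funext => w; rewrite indicI /= mulrA.
rewrite e -RintegralZl//.
by congr Rintegral; apply/funext => w; rewrite mulrA.
Qed.

Definition approximable X := forall eps : R, 0 < eps ->
  exists2 X', V X' & n2P (fun w => X w - X' w) <= eps.

Lemma projectable_L2 X : V X -> L2P X.
Proof. by move=> [mX bX _]; apply: L2P_bounded => //; exact: measurable_wrt_fun mX. Qed.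

Lemma approximableD X Y : L2P X -> L2P Y -> approximable X -> approximable Y ->
  approximable (fun w => X w + Y w).
Proof.
move=> LX LY aX aY eps eps0; have e2 : 0 < eps / 2 by rewrite divr_gt0.
have [X' VX hX] := aX _ e2; have [Y' VY hY] := aY _ e2.
exists (fun w => X' w + Y' w); first exact: projectableD.
rewrite [leRHS]splitr; apply: le_trans (lerD hX hY).
apply: le_trans (n2D measurableT _ _); last 2 first.
- by apply: L2B => //; exact: projectable_L2.
- by apply: L2B => //; exact: projectable_L2.
by rewrite le_eqVlt; apply/orP; left; apply/eqP; congr n2; apply/funext => w; ring.
Qed.

Lemma approximableZ (c : R) X : L2P X -> approximable X -> approximable (fun w => c * X w).
Proof.
move=> LX aX eps eps0; have c0 : 0 < `|c| + 1 by rewrite ltr_wpDl.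
have [X' VX hX] := aX _ (divr_gt0 eps0 c0).
exists (fun w => c * X' w); first exact: projectableZ.
rewrite (_ : (fun w => _) = fun w => c * (X w - X' w)); last first.
  by apply/funext => w; rewrite mulrBr.
have LB : L2P (fun w => X w - X' w) by apply: L2B => //; exact: projectable_L2.
rewrite (n2Z measurableT c LB).
apply: (@le_trans _ _ ((`|c| + 1) * (eps / (`|c| + 1)))).
  by apply: ler_pM => //; [exact: n2_ge0|rewrite lerDl].
by rewrite mulrCA mulfV ?mulr1// gt_eqF.
Qed.

Lemma approximable_lim (f_ : nat -> Omega -> R) (f g : Omega -> R) :
  (forall q, L2P (f_ q)) -> measurable_fun setT f -> L2P g ->
  (forall w, (f_ ^~ w : nat -> R) @ \oo --> f w) ->
  (forall q w, `|f w - f_ q w| <= `|g w|) ->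
  (forall q, approximable (f_ q)) -> approximable f.
Proof.
move=> Lf_ mf Lg cf fg af eps eps0; have e2 : 0 < eps / 2 by rewrite divr_gt0.
have [q [Lq hq]] := L2_dominated (fun q => proj1 (Lf_ q)) mf Lg cf fg e2.
have [X' VX hX] := af q _ e2.
exists X' => //; rewrite [leRHS]splitr; apply: le_trans (lerD hq hX).
apply: le_trans (n2D measurableT Lq _); last first.
  by apply: L2B => //; exact: projectable_L2.
by rewrite le_eqVlt; apply/orP; left; apply/eqP; congr n2; apply/funext => w; ring.
Qed.

Lemma L2P_indic A : measurable A -> L2P (\1_A).
Proof.
by move=> mA; apply: L2P_bounded; [exact: measurable_indic|exact: rbounded_indic].
Qed.

Lemma dynkin_approximable : dynkin [set A | measurable A /\ approximable (\1_A)].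
Proof.
have aT : approximable (\1_(setT : set Omega)).
  move=> eps eps0; exists (\1_(setT `&` setT)).
    by apply: projectable_rect; exact: sub_algebraT.
  rewrite setTI (_ : (fun w => _) = fun=> 0) ?n20 ?ltW//.
  by apply/funext => w; rewrite subrr.
split => //.
- move=> A [mA aA]; split; first exact: measurableC.
  rewrite (_ : \1_(~` A) = fun w => \1_(setT : set Omega) w + (-1) * \1_A w); last first.
    apply/funext => w; rewrite indicT indicE in_setC indicE.
    change ((w \notin A)%:R = 1 + -1 * (w \in A)%:R :> R).
    by case: (w \in A); rewrite mulN1r /= ?subrr ?oppr0 ?addr0.
  apply: approximableD; [exact: L2P_indic|apply: L2Z => //; exact: L2P_indic|exact: aT|].
  by apply: approximableZ => //; exact: L2P_indic.
- move=> A tA hA; have mA j : measurable (A j) by case: (hA j).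
  split; first exact: bigcup_measurable.
  (* Indicators of the partial unions are finite sums by disjointness, and they converge boundedly,
     so [approximable_lim] applies. *)
  pose f_ q w : R := \1_(\bigcup_(j < q) A j) w.
  have f_S q : f_ q.+1 = fun w => f_ q w + \1_(A q) w.
    apply/funext => w; rewrite /f_ bigcup_mkord big_ord_recr /= -bigcup_mkord.
    rewrite !indicE in_setU.
    have [Aq|] := boolP (w \in A q); last by rewrite orbF addr0.
    case: (boolP (w \in _)) => [|_]; last by rewrite add0r.
    rewrite inE => -[j /= jq Aj].
    have := tA j q I I; move=> /(_ _)/wrap[]; first by exists w; split => //; rewrite inE in Aq.
    by move=> jq'; rewrite jq' ltnn in jq.
  have Lf_ q : L2P (f_ q) by apply: L2P_indic; exact: bigcup_measurable.
  apply: (@approximable_lim f_ _ (fun=> 1)) => //.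
  + by apply: measurable_indic; exact: bigcup_measurable.
  + by apply: L2P_bounded => //; exists 1 => w; rewrite normr1.
  + move=> w; apply: cvg_near_cst.
    have [[j _ Aj]|nA] := pselect ((\bigcup_j A j) w).
      exists j.+1 => // q /= jq; rewrite /f_ !indicE !mem_set//; first by exists j.
      by exists j.
    near=> q; rewrite /f_ !indicE !memNset// => -[j _ Aj]; apply: nA; exists j => //.
  + move=> q w; rewrite normr1 /f_ !indicE; do 2 case: (_ \in _);
      by rewrite ?subr0 ?subrr ?sub0r ?normrN ?normr1 ?normr0.
  + elim=> [|q IH].
      rewrite (_ : f_ 0 = fun w => 0 * \1_(setT : set Omega) w).
        by apply: approximableZ => //; exact: L2P_indic.
      by apply/funext => w; rewrite /f_ bigcup_mkord big_ord0 indic0 mul0r.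
    by rewrite f_S; apply: approximableD => //; [exact: L2P_indic|case: (hA q)].
Unshelve. all: by end_near.
Qed.

(** Rectangles are projectable; the pi-lambda theorem reaches every set of [F], linearity the simple
    variables, and their density all of L2. *)
Lemma projectable_dense X : measurable_wrt F X -> L2P X -> approximable X.
Proof.
move=> mX LX eps eps0; have e2 : 0 < eps / 2 by rewrite divr_gt0.
have FP : F `<=` [set A | measurable A /\ approximable (\1_A)].
  apply: (join_induction sGp sG dynkin_approximable) => // A B GA GB.
  have [_ mF] := sF; split; first by apply: mF; exact: (sub_algebraI sF (GpF GA) (GF GB)).
  move=> e e0; exists (\1_(A `&` B)); first exact: projectable_rect.
  rewrite (_ : (fun w => _) = fun=> 0) ?n20 ?ltW//.
  by apply/funext => w; rewrite subrr.
have [Y [l [hl eY]] [LY hY]] := simple_rv_dense sF mX LX e2.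
have [LY' aY] : L2P Y /\ approximable Y.
  rewrite eY; elim: {LY hY eY} l hl => [|x l IH] hl.
    rewrite (_ : (fun w => _) = fun w => 0 * \1_(setT : set Omega) w); last first.
      by apply/funext => w; rewrite big_nil mul0r.
    have [mT aT] := FP _ (sub_algebraT sF).
    split; first by apply: L2Z => //; exact: L2P_indic.
    by apply: approximableZ => //; exact: L2P_indic.
  rewrite (_ : (fun w => _) = fun w => x.1 * \1_(x.2) w + \sum_(x <- l) x.1 * \1_(x.2) w); last first.
    by apply/funext => w; rewrite big_cons.
  have [mx ax] := FP _ (hl x (or_introl erefl)).
  have [L a] := IH (fun y yl => hl y (or_intror yl)).
  have L1 : L2P (fun w => x.1 * \1_(x.2) w) by apply: L2Z => //; exact: L2P_indic.
  split; first exact: L2D.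
  by apply: approximableD => //; apply: approximableZ => //; exact: L2P_indic.
have [X' VX hX] := aY _ e2.
exists X' => //; rewrite [leRHS]splitr; apply: le_trans (lerD hY hX).
apply: le_trans (n2D measurableT _ _); last 2 first.
- exact: L2B.
- by apply: L2B => //; exact: projectable_L2.
by rewrite le_eqVlt; apply/orP; left; apply/eqP; congr n2; apply/funext => w; ring.
Qed.

End projectable_density.
End weak_projection.

Section game_projection.
Context {R : realType} {d : measure_display} {Omega : measurableType d}.
Context {N n k : nat}.
Variables (Pr : probability Omega R) (m : game R Omega N n k).
Hypothesis W_brownian : standard_brownian Pr (noise m).
Hypothesis hA1 : A1 Pr m.
Local Notation T := (horizon m).
Local Notation leb := (@lebesgue_measure R).
Variable i : 'I_N.

(** At time [a] the player's information is generated by a private part, independent of the whole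
    common noise, and by the common noise up to [a]: the setting of [projectable_dense]. *)
Lemma pb_itoinc_common (s t kappa : R) h M : 0 <= s -> s <= t -> t <= T -> 0 <= kappa ->
  itoinc Pr (Fplayer m i) (W0 m) s t h M ->
  {ae leb, forall r, s <= r <= t -> pb Pr (Fcommon m T) kappa (h r)} ->
  pb Pr (Fcommon m T) (Num.sqrt (t - s) * kappa) M.
Proof.
apply: (pb_itoinc (Fplayer_integrator W_brownian hA1 i) (Fcommon_integrator W_brownian hA1 i)).
- exact: (Fcommon_sub W_brownian).
- by move=> r /andP[_ rT]; exact: Fcommon_mono.
move=> a X /andP[a0 aT].
pose Gp := sigma_of (coords (init m i) `|` path_upto (Wi m i) a).
have sGp : sub_algebra Gp.
  apply: sub_algebra_sigma_of => Y [/(coords_measurable hA1)//|[r /andP[r0 _] ->]].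
  exact: (noise_measurable W_brownian).
apply: (projectable_dense sGp).
- exact: (Fcommon_sub W_brownian).
- exact: (Fcommon_sub W_brownian).
- exact: Fcommon_mono.
- by apply: sigma_ofS => Y hY; left.
- by apply: sigma_ofS => Y hY; right.
- exact: (Fplayer_sub W_brownian hA1).
- move=> A B hA hB; apply: (private_common_independent W_brownian hA1 (i := i)) => //.
  by apply: sigma_ofS hA; apply: setUS; exact: path_upto_all.
- by move=> Y [hY|hY]; [left|right]; exact: sigma_of_measurable_wrt.
Qed.

End game_projection.

(** * Deterministic backward equations *)

Section small_steps.
Context {R : realType}.

Lemma halving_le0 (x B : R) : (forall j, x <= B / 2 ^+ j) -> x <= 0.
Proof.
move=> h; apply/ler_addgt0Pr => e e0; rewrite add0r.
have B0 : 0 <= `|B| + 1 by rewrite addr_ge0.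
have [j hj] : exists j, `|B| / e < 2 ^+ j.
  exists (Num.bound (`|B| / e)).
  have := archi_boundP (divr_ge0 (normr_ge0 B) (ltW e0)).
  move=> /lt_trans; apply; rewrite -natrX ltr_nat; exact: ltn_expl.
apply: le_trans (h j) _; rewrite ler_pdivrMr ?exprn_gt0//.
rewrite ltr_pdivrMr// in hj; apply: le_trans (ler_norm B) _.
by rewrite mulrC ltW.
Qed.

Lemma step_induction (del : R) (S : R -> Prop) : 0 < del -> S 0 ->
  (forall r, 0 <= r -> S r -> S (r + del)) ->
  forall r, exists2 r', r <= r' & S r'.
Proof.
move=> d0 S0 St r; have hk (j : nat) : S (j%:R * del).
  elim: j => [|j IH]; first by rewrite mul0r.
  by rewrite -addn1 natrD mulrDl mul1r; apply: St => //; rewrite mulr_ge0// ltW.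
exists ((Num.bound `|r / del|)%:R * del); last exact: hk.
rewrite -ler_pdivrMr//; apply: le_trans (ler_norm _) _.
by have := archi_boundP (normr_ge0 (r / del)); move/ltW.
Qed.

(** [Q t K] reads: the quantity at time t is bounded by K. Vanishing is expressed by all the bounds
    B / 2^j, so that one induction serves norms and the predicate [pb] alike; on each new interval
    the a priori bound [B] is halved again and again. *)
Lemma small_steps (T del B : R) (Q : R -> R -> Prop) : 0 < del -> 0 <= B ->
  (forall t, 0 <= t <= T -> Q t B) -> (forall j, Q 0 (B / 2 ^+ j)) ->
  (forall r K, 0 <= r -> 0 <= K -> (forall t, 0 <= t <= r -> t <= T -> forall j, Q t (B / 2 ^+ j)) ->
    (forall t, r <= t <= r + del -> t <= T -> Q t K) ->
    forall t, r <= t <= r + del -> t <= T -> Q t (K / 2)) ->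
  forall t, 0 <= t <= T -> forall j, Q t (B / 2 ^+ j).
Proof.
move=> d0 B0 QB Q0 step t /andP[t0 tT].
have [||r' tr' h] := @step_induction del
  (fun r => forall t, 0 <= t <= r -> t <= T -> forall j, Q t (B / 2 ^+ j)) d0 _ _ t.
- by move=> u /le_anti <- _.
- move=> r r0 IH u /andP[u0 urd] uT; have [ur|ur] := leP u r.
    by apply: IH; rewrite // u0 ur.
  have main : forall j u, r <= u <= r + del -> u <= T -> Q u (B / 2 ^+ j).
    elim=> [v /andP[rv _] vT|j IHj v rv vT].
      by rewrite expr0 divr1; apply: QB; rewrite (le_trans r0 rv).
    rewrite exprS invfM mulrCA mulrC; apply: (step r) => //.
    by rewrite divr_ge0// exprn_ge0.
  by move=> j; apply: main => //; rewrite urd andbT ltW.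
by move=> j; apply: h => //; rewrite t0.
Qed.

End small_steps.

(** * Matrix norms and essentially bounded coefficients *)

Section matrix_norm.
Context {R : realType}.

(** The entrywise l1 norm: it dominates every entry, is submultiplicative and is invariant under
    transposition. *)
Definition nrm m n (A : 'M[R]_(m, n)) := \sum_i \sum_j `|A i j|.

Lemma nrm_ge0 m n (A : 'M[R]_(m, n)) : 0 <= nrm A.
Proof. by apply: sumr_ge0 => i _; apply: sumr_ge0. Qed.

Lemma nrm_entry m n (A : 'M[R]_(m, n)) i j : `|A i j| <= nrm A.
Proof.
rewrite /nrm (bigD1 i)//= (bigD1 j)//= -addrA lerDl addr_ge0//.
  exact: sumr_ge0.
by apply: sumr_ge0 => ? _; apply: sumr_ge0.
Qed.

Lemma nrm_le m n (A : 'M[R]_(m, n)) c : (forall i j, `|A i j| <= c) -> nrm A <= (m * n)%:R * c.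
Proof.
move=> h; apply: (@le_trans _ _ (\sum_(i < m) \sum_(j < n) c)).
  by apply: ler_sum => i _; apply: ler_sum => j _.
by rewrite !sumr_const !card_ord mulr_natl -mulrnA mulnC.
Qed.

Lemma nrmD m n (A B : 'M[R]_(m, n)) : nrm (A + B) <= nrm A + nrm B.
Proof.
rewrite /nrm -big_split; apply: ler_sum => i _; rewrite -big_split; apply: ler_sum => j _.
by rewrite mxE ler_normD.
Qed.

Lemma nrmN m n (A : 'M[R]_(m, n)) : nrm (- A) = nrm A.
Proof. by apply: eq_bigr => i _; apply: eq_bigr => j _; rewrite mxE normrN. Qed.

Lemma nrmT m n (A : 'M[R]_(m, n)) : nrm A^T = nrm A.
Proof.
by rewrite /nrm exchange_big; apply: eq_bigr => i _; apply: eq_bigr => j _; rewrite mxE.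
Qed.

Lemma nrm0 m n : nrm (0 : 'M[R]_(m, n)) = 0.
Proof. by rewrite /nrm big1// => i _; rewrite big1// => j _; rewrite mxE normr0. Qed.

Lemma nrm_eq0 m n (A : 'M[R]_(m, n)) : nrm A <= 0 -> A = 0.
Proof.
move=> h; apply/matrixP => i j; rewrite mxE; apply/eqP; rewrite -normr_le0.
exact: le_trans (nrm_entry A i j) h.
Qed.

Lemma nrmM m n p (A : 'M[R]_(m, n)) (B : 'M[R]_(n, p)) : nrm (A *m B) <= nrm A * nrm B.
Proof.
rewrite /nrm mulr_suml; apply: ler_sum => i _.
apply: (@le_trans _ _ (\sum_j \sum_l `|A i l| * `|B l j|)).
  apply: ler_sum => j _; rewrite mxE; apply: le_trans (ler_norm_sum _ _ _) _.
  by apply: ler_sum => l _; rewrite normrM.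
rewrite exchange_big /= mulr_suml; apply: ler_sum => l _.
rewrite -mulr_sumr ler_wpM2l// (bigD1 l)//= lerDl.
by apply: sumr_ge0 => ? _; apply: sumr_ge0.
Qed.

End matrix_norm.

Section time_calculus.
Context {R : realType} (T : R).
Local Notation leb := (@lebesgue_measure R).

Lemma ae_timeS (P Q : R -> Prop) : (forall t, 0 <= t <= T -> P t -> Q t) ->
  ae_time T P -> ae_time T Q.
Proof.
by rewrite /ae_time => h; apply: filterS => t Pt t0; apply: h => //; exact: Pt.
Qed.

Lemma ae_time2 (P P' Q : R -> Prop) : (forall t, 0 <= t <= T -> P t -> P' t -> Q t) ->
  ae_time T P -> ae_time T P' -> ae_time T Q.
Proof.
rewrite /ae_time => h; apply: filterS2 => t Pt Pt' t0.
by apply: h => //; [exact: Pt|exact: Pt'].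
Qed.

Lemma ae_time_all (P : R -> Prop) : (forall t, 0 <= t <= T -> P t) -> ae_time T P.
Proof. by move=> h; apply: aeW => t; exact: h. Qed.

Lemma ae_time_sub (a b : R) (P : R -> Prop) : 0 <= a -> b <= T -> ae_time T P ->
  {ae leb, forall t, a <= t <= b -> P t}.
Proof.
rewrite /ae_time => a0 bT; apply: filterS => t Pt /andP[at_ tb]; apply: Pt.
by rewrite (le_trans a0 at_) (le_trans tb bT).
Qed.

Lemma ae_time_fin (I : finType) (P : I -> R -> Prop) :
  (forall i, ae_time T (P i)) -> ae_time T (fun t => forall i, P i t).
Proof.
move=> h; suff : ae_time T (fun t => forall i, i \in enum I -> P i t).
  by apply: ae_timeS => t _ H i; apply: H; rewrite mem_enum.
elim: (enum I) => [|i s IH]; first exact: ae_time_all.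
apply: ae_time2 (h i) IH => t _ Pi Ps i'; rewrite inE => /orP[/eqP ->//|]; exact: Ps.
Qed.

(* [lip kappa] is stable under the operations of the Riccati equation, inverses
   included, so its right-hand side is Lipschitz. *)
Definition lip (kappa : R -> R) m n (M M' : R -> 'M[R]_(m, n)) :=
  exists2 c : R, 0 <= c &
    ae_time T (fun t => [/\ nrm (M t) <= c, nrm (M' t) <= c & nrm (M t - M' t) <= c * kappa t]).

Lemma Linfty_nrm m n (M : R -> 'M[R]_(m, n)) : Linfty T M ->
  exists2 c : R, 0 <= c & ae_time T (fun t => nrm (M t) <= c).
Proof.
move=> LM.
have h i j : exists c : R, ae_time T (fun t => `|M t i j| <= c) by case: (LM i j).
pose c i j := projT1 (cid (h i j)); pose s := \sum_i \sum_j `|c i j|.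
exists s; first by apply: sumr_ge0 => i _; apply: sumr_ge0.
apply: ae_timeS (ae_time_fin (fun i => ae_time_fin (fun j => projT2 (cid (h i j))))) => t _ H.
by apply: ler_sum => i _; apply: ler_sum => j _; apply: le_trans (H i j) (ler_norm _).
Qed.

Lemma LinftyP m n (M : R -> 'M[R]_(m, n)) (c : R) :
  (forall i j, measurable_fun `[0, T] (fun t => M t i j)) ->
  ae_time T (fun t => nrm (M t) <= c) -> Linfty T M.
Proof.
move=> mM h i j; split=> //; exists c.
by apply: ae_timeS h => t _; apply: le_trans; exact: nrm_entry.
Qed.

Lemma LinftyD m n (M M' : R -> 'M[R]_(m, n)) : Linfty T M -> Linfty T M' ->
  Linfty T (fun t => M t + M' t).
Proof.
move=> LM LM'; have [c c0 h] := Linfty_nrm LM; have [c' c0' h'] := Linfty_nrm LM'.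
apply: (@LinftyP _ _ _ (c + c')).
  move=> i j; rewrite (_ : (fun t => _) = (fun t => M t i j + M' t i j)).
    by apply: measurable_funD; [case: (LM i j)|case: (LM' i j)].
  by apply/funext => t; rewrite mxE.
by apply: ae_time2 h h' => t _ a a'; apply: le_trans (nrmD _ _) (lerD a a').
Qed.

Lemma LinftyN m n (M : R -> 'M[R]_(m, n)) : Linfty T M -> Linfty T (fun t => - M t).
Proof.
move=> LM; have [c c0 h] := Linfty_nrm LM.
apply: (@LinftyP _ _ _ c).
  move=> i j; rewrite (_ : (fun t => _) = (fun t => - M t i j)).
    by apply: measurableT_comp => //; case: (LM i j).
  by apply/funext => t; rewrite mxE.
by apply: ae_timeS h => t _; rewrite nrmN.
Qed.

Lemma LinftyT m n (M : R -> 'M[R]_(m, n)) : Linfty T M -> Linfty T (fun t => (M t)^T).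
Proof.
move=> LM; have [c c0 h] := Linfty_nrm LM.
apply: (@LinftyP _ _ _ c).
  move=> i j; rewrite (_ : (fun t => _) = (fun t => M t j i)); first by case: (LM j i).
  by apply/funext => t; rewrite mxE.
by apply: ae_timeS h => t _; rewrite nrmT.
Qed.

Lemma LinftyM m n p (M : R -> 'M[R]_(m, n)) (M' : R -> 'M[R]_(n, p)) :
  Linfty T M -> Linfty T M' -> Linfty T (fun t => M t *m M' t).
Proof.
move=> LM LM'; have [c c0 h] := Linfty_nrm LM; have [c' c0' h'] := Linfty_nrm LM'.
apply: (@LinftyP _ _ _ (c * c')).
  move=> i j; rewrite (_ : (fun t => _) = (fun t => \sum_l M t i l * M' t l j)).
    apply: measurable_sum => l; apply: measurable_funM; first by case: (LM i l).
    by case: (LM' l j).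
  by apply/funext => t; rewrite mxE.
apply: ae_time2 h h' => t _ a a'; apply: le_trans (nrmM _ _) _.
by apply: ler_pM => //; exact: nrm_ge0.
Qed.

Section lipschitz.
Variable kappa : R -> R.
Hypothesis kappa0 : forall t, 0 <= kappa t.

Lemma lip_refl m n (M : R -> 'M[R]_(m, n)) : Linfty T M -> lip kappa M M.
Proof.
move=> LM; have [c c0 h] := Linfty_nrm LM; exists c => //.
by apply: ae_timeS h => t _ a; split => //; rewrite subrr nrm0 mulr_ge0.
Qed.

Lemma lipD m n (M M' N N' : R -> 'M[R]_(m, n)) : lip kappa M M' -> lip kappa N N' ->
  lip kappa (fun t => M t + N t) (fun t => M' t + N' t).
Proof.
move=> [c c0 h] [c' c0' h']; exists (c + c'); first exact: addr_ge0.
apply: ae_time2 h h' => t _ [a1 a2 a3] [b1 b2 b3]; split.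
- exact: le_trans (nrmD _ _) (lerD a1 b1).
- exact: le_trans (nrmD _ _) (lerD a2 b2).
- by rewrite opprD addrACA mulrDl; exact: le_trans (nrmD _ _) (lerD a3 b3).
Qed.

Lemma lipN m n (M M' : R -> 'M[R]_(m, n)) : lip kappa M M' ->
  lip kappa (fun t => - M t) (fun t => - M' t).
Proof.
move=> [c c0 h]; exists c => //; apply: ae_timeS h => t _ [a1 a2 a3].
by rewrite -opprD !nrmN.
Qed.

Lemma lipT m n (M M' : R -> 'M[R]_(m, n)) : lip kappa M M' ->
  lip kappa (fun t => (M t)^T) (fun t => (M' t)^T).
Proof.
move=> [c c0 h]; exists c => //; apply: ae_timeS h => t _ [a1 a2 a3].
by rewrite -linearB /= !nrmT.
Qed.

Lemma lipM m n p (M M' : R -> 'M[R]_(m, n)) (N N' : R -> 'M[R]_(n, p)) :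
  lip kappa M M' -> lip kappa N N' ->
  lip kappa (fun t => M t *m N t) (fun t => M' t *m N' t).
Proof.
move=> [c c0 h] [c' c0' h']; exists (c * c' + c * c').
  by rewrite addr_ge0// mulr_ge0.
have cc : c * c' <= c * c' + c * c' by rewrite lerDl mulr_ge0.
apply: ae_time2 h h' => t _ [a1 a2 a3] [b1 b2 b3]; split.
- apply: le_trans (nrmM _ _) _; apply: le_trans cc.
  by apply: ler_pM => //; exact: nrm_ge0.
- apply: le_trans (nrmM _ _) _; apply: le_trans cc.
  by apply: ler_pM => //; exact: nrm_ge0.
- have -> : M t *m N t - M' t *m N' t = M t *m (N t - N' t) + (M t - M' t) *m N' t.
    by rewrite mulmxBr mulmxBl addrA subrK.
  apply: le_trans (nrmD _ _) _; rewrite mulrDl; apply: lerD.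
    by apply: le_trans (nrmM _ _) _; rewrite -mulrA; apply: ler_pM => //; exact: nrm_ge0.
  apply: le_trans (nrmM _ _) _; rewrite -mulrA [c' * _]mulrC mulrA.
  by apply: ler_pM => //; exact: nrm_ge0.
Qed.

(** By M^-1 - M'^-1 = M^-1 (M' - M) M'^-1, inversion is Lipschitz where both inverses are bounded.
    The bounded inverses of [solves_P] enter the uniqueness of P here. *)
Lemma lip_inv n (M M' : R -> 'M[R]_n) : bounded_inverse T M -> bounded_inverse T M' ->
  lip kappa M M' -> lip kappa (fun t => invmx (M t)) (fun t => invmx (M' t)).
Proof.
move=> [uM LM] [uM' LM'] [c c0 h].
have [b b0 hb] := Linfty_nrm LM; have [b' b0' hb'] := Linfty_nrm LM'.
exists (b + b' + b * c * b'); first by rewrite !addr_ge0// !mulr_ge0.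
have H := ae_time2 (fun t _ p q => conj p q) (ae_time2 (fun t _ p q => conj p q) uM uM')
  (ae_time2 (fun t _ p q => conj p q) hb hb').
apply: ae_time2 H h => t _ [[u u'] [hbt hbt']] [a1 a2 a3]; split.
- by apply: le_trans hbt _; rewrite -addrA lerDl addr_ge0// !mulr_ge0.
- by apply: le_trans hbt' _; rewrite addrAC lerDr addr_ge0// !mulr_ge0.
- have -> : invmx (M t) - invmx (M' t) = invmx (M t) *m (M' t - M t) *m invmx (M' t).
    by rewrite mulmxBr mulVmx// mulmxBl mul1mx -mulmxA mulmxV// mulmx1.
  apply: (@le_trans _ _ (b * (c * kappa t) * b')).
    apply: le_trans (nrmM _ _) _; apply: ler_pM; rewrite ?nrm_ge0//.
    apply: le_trans (nrmM _ _) _; apply: ler_pM; rewrite ?nrm_ge0//.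
    by rewrite -nrmN opprB.
  rewrite mulrA mulrAC ler_wpM2r// lerDr addr_ge0//.
Qed.

End lipschitz.
End time_calculus.

(** * Uniqueness for backward ordinary differential equations *)

Section backward_equations.
Context {R : realType} (T : R).
Local Notation leb := (@lebesgue_measure R).

Lemma backward_ode_incr m n (Y H : R -> 'M[R]_(m, n)) YT (s t : R) i j :
  backward_ode T Y H YT -> 0 <= s -> s <= t -> t <= T ->
  Y s i j = Y t i j + \int[leb]_(r in `[s, t]) H r i j.
Proof.
move=> [IH eY] s0 st tT; have sT := le_trans st tT.
have I1 : leb.-integrable `[s, T] (EFin \o (fun r => H r i j)).
  apply: integrableS (IH i j) => //; apply: subset_itvr; by rewrite bnd_simp.
have := @Rintegral_itvB _ (fun r => H r i j) (BLeft s) (BRight T) t I1.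
rewrite !bnd_simp => /(_ st tT); rewrite Rintegral_itv_obnd_cbnd; last first.
  by apply: integrableS I1 => //; apply: subset_itvr; rewrite bnd_simp.
move=> e; rewrite (eY s) ?s0//  (eY t) ?(le_trans s0 st)//.
by rewrite -e; ring.
Qed.

(** The terms are integrable along the given solution, which bounds it whatever their growth in Y;
    the halving starts from this bound. *)
Lemma backward_ode_bounded m n (Y H : R -> 'M[R]_(m, n)) YT :
  backward_ode T Y H YT -> exists2 c : R, 0 <= c & forall t, 0 <= t <= T -> nrm (Y t) <= c.
Proof.
move=> hY; have [IH _] := hY.
pose c := nrm YT + \sum_i \sum_j \int[leb]_(r in `[0, T]) `|H r i j|.
have I0 i j : 0 <= \int[leb]_(r in `[0, T]) `|H r i j| by exact: Rintegral_ge0.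
exists ((m * n)%:R * c).
  rewrite mulr_ge0// addr_ge0 ?nrm_ge0//; apply: sumr_ge0 => i _; exact: sumr_ge0.
move=> t /andP[t0 tT]; apply: nrm_le => i j.
have [_ ->] := hY; last by rewrite t0.
apply: le_trans (ler_normD _ _) _; apply: lerD; first exact: nrm_entry.
have It : leb.-integrable `[t, T] (EFin \o (fun r => H r i j)).
  by apply: integrableS (IH i j) => //; apply: subset_itvr; rewrite bnd_simp.
apply: (@le_trans _ _ (\int[leb]_(r in `[0, T]) `|H r i j|)).
  apply: le_trans (le_normr_Rintegral _ It) _ => //.
  apply: fine_le.
  - by apply: integrable_fin_num => //; exact: integrable_abse It.
  - by apply: integrable_fin_num => //; exact: integrable_abse (IH i j).
  - apply: ge0_subset_integral => //.
    + by case/integrableP: (integrable_abse (IH i j)).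
    + by apply: subset_itvr; rewrite bnd_simp.
rewrite (bigD1 i)//= (bigD1 j)//= -addrA lerDl addr_ge0//.
  exact: sumr_ge0.
by apply: sumr_ge0 => ? _; exact: sumr_ge0.
Qed.

Lemma Linfty_backward_ode m n (Y H : R -> 'M[R]_(m, n)) YT : 0 <= T ->
  backward_ode T Y H YT -> Linfty T Y.
Proof.
move=> T0 hY; have [c c0 h] := backward_ode_bounded hY.
apply: (@LinftyP _ _ _ _ _ c); last exact: ae_time_all.
move=> i j; have [IH _] := hY.
apply: (@eq_measurable_fun _ _ (measurableTypeR R) _ _
    (fun t => Y 0 i j - \int[leb]_(r in `[0, t]) H r i j)).
  move=> t; rewrite inE /= in_itv /= => /andP[t0 tT].
  by rewrite (@backward_ode_incr _ _ Y H YT 0 t)// addrK.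
apply: measurable_funB => //.
apply: subspace_continuous_measurable_fun => //.
exact: (parameterized_integral_continuous T0 (IH i j)).
Qed.

Lemma Linfty_continuous m n (Y : R -> 'M[R]_(m, n)) : 
  (forall i j, {within `[0, T], continuous (fun t => Y t i j)}) -> Linfty T Y.
Proof.
move=> cY i j; split; first by apply: subspace_continuous_measurable_fun => //; exact: cY.

have [T0|T0] := leP 0 T; last first.
  by exists 0; apply: ae_time_all => t /andP[t0 tT]; move: (le_trans t0 tT); rewrite leNgt T0.
have [c _ hc] := EVT_max T0 (cY i j); have [c' _ hc'] := EVT_min T0 (cY i j).
exists (`|Y c i j| + `|Y c' i j|); apply: ae_time_all => t tT.
have tI : t \in `[0, T] by rewrite in_itv.
have := hc t tI; have := hc' t tI; rewrite ler_norml => h1 h2.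
have := ler_norm (Y c i j); have := ler_norm (- Y c' i j); rewrite normrN => h3 h4.
have := normr_ge0 (Y c i j); have := normr_ge0 (Y c' i j) => h5 h6.
by apply/andP; split; lra.
Qed.

(* The distance of the solutions is halved on a short interval before a time at which
   they agree. *)
Lemma backward_ode_uniq m n (Y H Y' H' : R -> 'M[R]_(m, n)) YT : 0 <= T ->
  backward_ode T Y H YT -> backward_ode T Y' H' YT ->
  lip T (fun t => nrm (Y t - Y' t)) H H' -> forall t, 0 <= t <= T -> Y t = Y' t.
Proof.
move=> T0 hY hY' [c c0 lH].
have [b b0 hb] := backward_ode_bounded hY; have [b' b0' hb'] := backward_ode_bounded hY'.
pose kap t := nrm (Y t - Y' t).
(* Makes [(m * n) c K del] at most [K / 2]; the factor [m * n] comes from [nrm_le], and the 1 keeps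
   the denominator positive. *)
pose del := (2 * (m * n)%:R * c + 1)^-1.
have den0 : 0 < 2 * (m * n)%:R * c + 1 by rewrite ltr_wpDl// !mulr_ge0.
have del0 : 0 < del by rewrite invr_gt0.
(* The value is prescribed at T, so time is reversed to apply [small_steps]. *)
have key : forall t, 0 <= t <= T -> forall j, kap (T - t) <= (b + b') / 2 ^+ j.
  apply: (@small_steps _ T del (b + b') (fun t K => kap (T - t) <= K)) => //.
  - exact: addr_ge0.
  - move=> t /andP[t0 tT]; have tT' : 0 <= T - t <= T by rewrite subr_ge0 tT gerBl.
    apply: le_trans (nrmD _ _) _; rewrite nrmN.
    by apply: lerD; [exact: hb|exact: hb'].
  - move=> j; rewrite subr0 /kap; have [_ e] := hY; have [_ e'] := hY'.
    suff -> : Y T - Y' T = 0 by rewrite nrm0 divr_ge0// ?addr_ge0 ?exprn_ge0.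
    apply/matrixP => a a'; rewrite !mxE e ?T0 ?lexx// e' ?T0 ?lexx//.
    by rewrite set_itv1 !Rintegral_set1 subrr.
  move=> r K r0 K0 zero hK t /andP[rt trd] tT.
  have rT := le_trans rt tT.
  have z0 : kap (T - r) = 0.
    apply/le_anti/andP; split; last exact: nrm_ge0.
    by apply: (@halving_le0 _ _ (b + b')) => j; apply: zero; rewrite ?r0 ?lexx.
  have st : T - t <= T - r by rewrite lerD2l lerN2.
  have s0 : 0 <= T - t by rewrite subr_ge0.
  have uT : T - r <= T by rewrite gerBl.
  have ent i j : `|(Y (T - t) - Y' (T - t)) i j| <= del * (c * K).
    have e := @backward_ode_incr _ _ Y H YT _ _ i j hY s0 st uT.
    have e' := @backward_ode_incr _ _ Y' H' YT _ _ i j hY' s0 st uT.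
    have eq0 : Y (T - r) i j - Y' (T - r) i j = 0.
      have := nrm_eq0 (_ : kap (T - r) <= 0); rewrite z0 lexx => /(_ isT)/matrixP/(_ i j).
      by rewrite !mxE.
    have sub : `[T - t, T - r] `<=` `[0, T] by apply: subset_itv; rewrite bnd_simp.
    have I : leb.-integrable `[T - t, T - r] (EFin \o (fun s => H s i j)).
      by apply: integrableS (hY.1 i j).
    have I' : leb.-integrable `[T - t, T - r] (EFin \o (fun s => H' s i j)).
      by apply: integrableS (hY'.1 i j).
    have -> : (Y (T - t) - Y' (T - t)) i j =
        \int[leb]_(s in `[T - t, T - r]) (H s i j - H' s i j).
      by rewrite !mxE e e' RintegralB// opprD addrACA eq0 add0r.
    have ID : leb.-integrable `[T - t, T - r] (EFin \o (fun s => H s i j - H' s i j)).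
      exact: (integrableB (mitv _ _) I I').
    apply: le_trans (le_normr_Rintegral _ ID) _ => //.
    have Ic : leb.-integrable `[T - t, T - r] (EFin \o cst (c * K)).
      have := L2_mul (mitv (T - t) (T - r)) (L2Z (mitv _ _) (c * K) (L2_cst1 _ _)) (L2_cst1 _ _).
      by apply: eq_integrable => // s _; rewrite !mulr1.
    apply: (@le_trans _ _ (\int[leb]_(s in `[T - t, T - r]) cst (c * K) s)).
      apply: fine_le.
      - by apply: integrable_fin_num => //; exact: integrable_abse ID.
      - exact: integrable_fin_num.
      - apply: ae_ge0_le_integral => //.
        + by case/integrableP: (integrable_abse ID).
        + by move=> s _; rewrite lee_fin mulr_ge0.
        + by case/integrableP: Ic.
        + apply: filterS (ae_time_sub s0 uT lH) => s hs; rewrite /= in_itv /= => sI.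
          rewrite lee_fin; have [_ _ h3] := hs sI.
          have {h3} := le_trans (nrm_entry _ i j) h3; rewrite !mxE => /le_trans; apply.
          apply: ler_wpM2l => //; have /andP[s1 s2] := sI.
          have := hK (T - s); rewrite /kap subKr; apply.
            by rewrite lerBrDr -lerBrDl s2 /= (le_trans _ trd)// lerBlDr -lerBlDl.
          by rewrite gerBl (le_trans s0).
    rewrite Rintegral_cst//.
    have -> : fine (leb `[T - t, T - r]) = t - r.
      rewrite lebesgue_measure_itv /= lte_fin ltrD2l ltrN2.
      case: ltP => [_|tr]; first by rewrite /=; ring.
      by have -> : t = r by [apply/le_anti/andP]; rewrite subrr.
    rewrite mulrC ler_wpM2r ?mulr_ge0// lerBlDl//.
  apply: le_trans (nrm_le ent) _.
  rewrite /del mulrCA ler_pdivrMl//.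
  have : 0 <= (m * n)%:R * (c * K) by rewrite !mulr_ge0.
  have -> : (2 * (m * n)%:R * c + 1) * (K / 2) = (m * n)%:R * (c * K) + K / 2 by field.
  by move=> _; rewrite lerDl divr_ge0.
move=> t /andP[t0 tT]; apply/eqP; rewrite -subr_eq0; apply/eqP/nrm_eq0.
apply: (@halving_le0 _ _ (b + b')) => j.
have := key (T - t); rewrite /kap subKr; apply.
by rewrite subr_ge0 tT gerBl.
Qed.

End backward_equations.

(** * The Riccati equations (P) and (K) *)

Section riccati.
Context {R : realType} {d : measure_display} {Omega : measurableType d}.
Context {N n k : nat}.
Variables (Pr : probability Omega R) (m : game R Omega N n k).
Hypothesis T_gt0 : 0 < horizon m.
Hypothesis hA1 : A1 Pr m.
Local Notation T := (horizon m).

Lemma riccati_uniq P Pc : solves_P m P -> solves_P m Pc ->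
  forall t, 0 <= t <= T -> P t = Pc t.
Proof.
move=> [hP iP] [hPc iPc]; have T0 := ltW T_gt0.
pose kap t := nrm (P t - Pc t); have kap0 t : 0 <= kap t by exact: nrm_ge0.
have lP : lip T kap P Pc.
  have [b b0 hb] := backward_ode_bounded hP; have [b' b0' hb'] := backward_ode_bounded hPc.
  (* The added 1 makes the constant at least 1, as bounding the difference by itself requires. *)
  exists (b + b' + 1); first by rewrite !addr_ge0.
  apply: ae_time_all => t tT; split.
  - by apply: le_trans (hb t tT) _; rewrite -addrA lerDl addr_ge0.
  - by apply: le_trans (hb' t tT) _; rewrite addrAC lerDr addr_ge0.
  - by rewrite ler_peMl ?kap0// lerDr addr_ge0.
have lc := lip_refl kap0.
have lR : lip T kap (fun t => calR (coef m t) (P t)) (fun t => calR (coef m t) (Pc t)).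
  rewrite /calR; do !apply: lipD; do ?apply: lipM => //; do ?apply: lipT; apply: lc;
  by case: hA1.
have lRi := lip_inv kap0 iP iPc lR.
have lPt : lip T kap (fun t => Ptilde (coef m t) (P t)) (fun t => Ptilde (coef m t) (Pc t)).
  by rewrite /Ptilde; do !apply: lipD; do ?apply: lipM => //; do ?apply: lipT; apply: lc;
    case: hA1.
apply: (backward_ode_uniq T0 hP hPc).
rewrite /P_terms; do !apply: lipD; try apply: lipN; do ?apply: lipM => //; do ?apply: lipT => //;
  by apply: lc; case: hA1.
Qed.

(** Makes [Kc] a competitor in the uniqueness statement of (A5), which concerns [P] rather than
    [Pc]. *)
Lemma solves_K_eq P Pc K : (forall t, 0 <= t <= T -> P t = Pc t) ->
  solves_K m Pc K -> solves_K m P K.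
Proof.
move=> e [[dK [cK hK]] [KT [uK LK]]]; split; last split => //.
- exists dK; split; first exact: cK.
  apply: (ae_timeS (P := fun t => dK t + K_terms (coef m t) (Pc t) (K t) = 0) _ hK).
  by move=> t tT; rewrite e.
- split; first by apply: ae_timeS uK => t tT; rewrite e.
  move=> i j; have [mL [c hc]] := LK i j; split.
    apply: eq_measurable_fun mL => t; rewrite inE /= in_itv /= => tT.
    by rewrite e.
  by exists c; apply: ae_timeS hc => t tT; rewrite e.
Qed.

End riccati.

(** * Linear stochastic equations *)

Section vector_processes.
Context {d} {Omega : measurableType d} {R : realType}.
Variable Pr : probability Omega R.
Local Notation leb := (@lebesgue_measure R).
Local Notation E X := (\int[Pr]_w (X w)).
Local Notation L2P := (L2 Pr setT).
Local Notation n2P := (n2 Pr setT).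
Local Notation ipP := (ip Pr setT).
Local Notation L2t := (L2t Pr).
Local Notation n2t := (n2t Pr).
Local Notation vproc q := (R -> Omega -> 'cV[R]_q).
Local Notation "h `_[ l ]" := (fun r w => h r w l ord0) (at level 3, format "h `_[ l ]").

Lemma ae_dtP_filter : Filter (nbhs (almost_everywhere (dtP Pr))).
Proof. exact: (@ae_filter_ringOfSetsType _ _ _ (dtP Pr)). Qed.

Lemma slab_tonelli2_measurable (a b : R) (f : measurableTypeR R * Omega -> \bar R) :
  measurable_fun (slab a b) f -> (forall p, slab a b p -> 0 <= f p)%E ->
  measurable_fun setT (fun w => \int[leb]_(r in `[a, b]) f (r, w))%E.
Proof.
move=> mf f0.
have h : measurable_fun setT (fubini_G leb (f \_ (slab a b))).
  apply: measurable_fun_fubini_tonelli_G.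
    exact: (measurable_restrictT _ (measurable_slab a b)).1.
  by move=> p; rewrite /patch; case: ifPn => // /set_mem; exact: f0.
apply: (eq_measurable_fun (fubini_G leb (f \_ (slab a b)))) => // w _.
rewrite /fubini_G [RHS]integral_mkcond.
by under eq_integral do rewrite patch_slab.
Qed.

Definition vL2t (a b : R) q (h : vproc q) := forall l, L2t a b h`_[l].
Definition vn2t (a b : R) q (h : vproc q) := \sum_l n2t a b h`_[l].
Definition vn2 q (X : Omega -> 'cV[R]_q) := \sum_l n2P (fun w => X w l ord0).

Lemma vn2t_ge0 (a b : R) q (h : vproc q) : 0 <= vn2t a b h.
Proof. by apply: sumr_ge0 => l _; exact: n2_ge0. Qed.

Lemma n2t_vn2t (a b : R) q (h : vproc q) l : n2t a b h`_[l] <= vn2t a b h.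
Proof. by rewrite /vn2t (bigD1 l)//= lerDl; apply: sumr_ge0 => j _; exact: n2_ge0. Qed.

Lemma vL2tS (a b a' b' : R) q (h : vproc q) : a' <= a -> b <= b' -> vL2t a' b' h -> vL2t a b h.
Proof. by move=> aa bb L l; apply: L2tS (L l). Qed.

Lemma vn2tS (a b a' b' : R) q (h : vproc q) : a' <= a -> b <= b' -> vL2t a' b' h ->
  vn2t a b h <= vn2t a' b' h.
Proof. by move=> aa bb L; apply: ler_sum => l _; apply: n2tS (L l). Qed.

Lemma vL2tD (a b : R) q (h h' : vproc q) : vL2t a b h -> vL2t a b h' ->
  vL2t a b (fun r w => h r w + h' r w) /\
  vn2t a b (fun r w => h r w + h' r w) <= vn2t a b h + vn2t a b h'.
Proof.
move=> L L'.
have e l : (fun r w => h r w + h' r w)`_[l] = fun r w => h r w l ord0 + h' r w l ord0.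
  by apply/funext => r; apply/funext => w; rewrite mxE.
split; first by move=> l; rewrite e; exact: (L2D (measurable_slab a b) (L l) (L' l)).
rewrite /vn2t -big_split; apply: ler_sum => l _; rewrite e.
exact: (n2D (measurable_slab a b) (L l) (L' l)).
Qed.

Lemma vL2tN (a b : R) q (h : vproc q) : vL2t a b h ->
  vL2t a b (fun r w => - h r w) /\ vn2t a b (fun r w => - h r w) = vn2t a b h.
Proof.
move=> L.
have e l : (fun r w => - h r w)`_[l] = fun r w => - h r w l ord0.
  by apply/funext => r; apply/funext => w; rewrite mxE.
split; last by apply: eq_bigr => l _; rewrite e; exact: (n2N (measurable_slab a b) (L l)).
move=> l; rewrite e; have := L2Z (measurable_slab a b) (-1) (L l).
by congr L2; apply/funext => p; rewrite mulN1r.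
Qed.

(** The constant is the same for every subinterval, so the length of the steps can be chosen once
    for all. *)
Lemma Linfty_mulmx (T : R) p q (M : R -> 'M[R]_(p, q)) : Linfty T M ->
  exists2 C : R, 0 <= C & forall (a b : R) (h : vproc q), 0 <= a -> b <= T ->
    vL2t a b h -> vL2t a b (fun r w => M r *m h r w) /\
    vn2t a b (fun r w => M r *m h r w) <= C * vn2t a b h.
Proof.
move=> LM; have [c c0 hc] := Linfty_nrm LM.
exists (p%:R * c); first by rewrite mulr_ge0.
move=> a b h a0 bT Lh.
have e l : (fun r w => M r *m h r w)`_[l] = fun r w => \sum_j M r l j * h r w j ord0.
  by apply/funext => r; apply/funext => w; rewrite mxE.
have one l j : L2t a b (fun r w => M r l j * h r w j ord0) /\
    n2t a b (fun r w => M r l j * h r w j ord0) <= c * n2t a b h`_[j].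
  have [mM _] := LM l j.
  have := @L2_bounded_mul _ _ _ (dtP Pr) (slab a b) (measurable_slab a b) c
    (fun p => h p.1 p.2 j ord0) (fun p => M p.1 l j).
  rewrite (ger0_norm c0); apply; last exact: Lh.
  - have m1 : measurable_fun (slab a b) (fst : measurableTypeR R * Omega -> measurableTypeR R).
      exact: measurable_funTS.
    apply: (measurable_comp (mitv 0 T) _ mM m1).
    move=> _ [[r w] [/= rI _] <-]; move: rI; rewrite !in_itv /= => /andP[ar rb].
    by rewrite (le_trans a0 ar) (le_trans rb bT).
  - apply: (@filterS _ _ ae_dtP_filter) (ae_time_slab Pr (ae_time_sub a0 bT hc)) => x hx Dx.
    by apply: le_trans (hx Dx); exact: nrm_entry.
split.
  move=> l; rewrite e; apply: (L2_sum (measurable_slab a b)) => j _; exact: (one l j).1.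
rewrite {1}/vn2t; apply: (@le_trans _ _ (\sum_(l < p) c * vn2t a b h)).
  apply: ler_sum => l _; rewrite e.
  apply: le_trans (n2_sum (measurable_slab a b) _ _) _; first by move=> j _; exact: (one l j).1.
  by rewrite /vn2t mulr_sumr; apply: ler_sum => j _; exact: (one l j).2.
by rewrite sumr_const card_ord -mulrA mulr_natl.
Qed.

(** Tonelli turns the iterated integral of [L2_adapted] into an integral over the product, and each
    component is dominated by the full norm. *)
Lemma L2_adapted_vL2t (T : R) F q (h : vproc q) : L2_adapted Pr T F h -> vL2t 0 T h.
Proof.
move=> [mh _ Ih] l; apply: L2_finite_integral; first exact: mh.
rewrite slab_tonelli2; last 2 first.
- by apply/measurable_EFinP; apply: measurable_funX; exact: mh.
- by move=> p _; rewrite lee_fin sqr_ge0.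
have msq : measurable_fun (slab 0 T) (fun p => (sqnorm (h p.1 p.2))%:E).
  apply/measurable_EFinP; apply: measurable_sum => j; apply: measurable_funX; exact: mh.
apply: le_lt_trans Ih.
have mw j w : @measurable_fun _ _ (measurableTypeR R) _ `[0, T] (fun r => h r w j ord0).
  exact: (measurable_path w (mh j)).
apply: ge0_le_integral => //.
- by move=> w _; apply: integral_ge0 => r _; rewrite lee_fin sqr_ge0.
- apply: (@slab_tonelli2_measurable 0 T (fun p => (h p.1 p.2 l ord0 ^+ 2)%:E)) => [|p _].
    by apply/measurable_EFinP; apply: measurable_funX; exact: mh.
  by rewrite lee_fin sqr_ge0.
- apply: (@slab_tonelli2_measurable 0 T (fun p => (sqnorm (h p.1 p.2))%:E)) => // p _.
  by rewrite lee_fin sumr_ge0// => j _; rewrite sqr_ge0.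
move=> w _; apply: ge0_le_integral => //.
- by move=> r _; rewrite lee_fin sqr_ge0.
- by apply/measurable_EFinP; apply: measurable_funX; exact: mw.
- by apply/measurable_EFinP; apply: measurable_sum => j; apply: measurable_funX; exact: mw.
- move=> r _; rewrite lee_fin /sqnorm (bigD1 l)//= lerDl.
  by apply: sumr_ge0 => j _; rewrite sqr_ge0.
Qed.

Lemma pythagoras_le X Y : L2P X -> L2P Y -> ipP X Y = 0 ->
  n2P X <= n2P (fun w => X w + Y w) /\ n2P Y <= n2P (fun w => X w + Y w).
Proof.
move=> LX LY o; have LD := L2D measurableT LX LY.
have e : n2P (fun w => X w + Y w) ^+ 2 = n2P X ^+ 2 + n2P Y ^+ 2.
  rewrite !n2_sqr ipDl// ![ipP _ (fun w => X w + Y w)]ipC !ipDl// o.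
  by rewrite (ipC _ _ Y X) o addr0 add0r.
by split; rewrite -(ler_pXn2r (ltn0Sn 1)) ?nnegrE ?n2_ge0// e ?lerDl ?lerDr sqr_ge0.
Qed.

Lemma small_time (C : R) : 0 <= C -> exists2 del : R, 0 < del &
  C * (del + Num.sqrt del) <= 2^-1.
Proof.
move=> C0; have D0 : 0 < 4 * C + 1 by rewrite ltr_wpDl// mulr_ge0.
(* With [del = s^2] the sum [del + sqrt del] is at most [2 s], and [4 C s <= 1]. *)
pose s := (4 * C + 1)^-1; have s0 : 0 < s by rewrite invr_gt0.
have s1 : s <= 1 by rewrite invf_le1// lerDr mulr_ge0.
exists (s ^+ 2); first by rewrite exprn_gt0.
rewrite sqrtr_sqr gtr0_norm//.
have ss : s ^+ 2 <= s by rewrite expr2 ler_piMl// ltW.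
apply: (@le_trans _ _ (C * (s + s))); first by rewrite ler_wpM2l// lerD2r.
have : (4 * C + 1) * s = 1 by rewrite mulfV// gt_eqF.
by nra.
Qed.

Lemma tint_eq0 (f : R -> Omega -> R) (t : R) w : tint f t t w = 0.
Proof. by rewrite /tint set_itv1 Rintegral_set1. Qed.

Lemma forward_increment (T : R) (x x0 a J : R -> Omega -> R) (s t : R) :
  0 <= s -> s <= t -> t <= T -> L2t 0 T a ->
  (forall t, 0 <= t <= T -> {ae Pr, forall w, x t w = x0 0 w + tint a 0 t w + J t w}) ->
  {ae Pr, forall w, x t w = x s w + tint a s t w + (J t w - J s w)}.
Proof.
move=> s0 st tT La e; have t0 := le_trans s0 st; have sT := le_trans st tT.
have La' : L2t 0 t a by apply: L2tS La.
have es := e s; have et := e t; rewrite s0 sT in es; rewrite t0 tT in et.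
apply: (@filterS3 _ _ _ _ _ _ _ _ (es isT) (et isT) (tint_split s0 st La')).
by move=> w -> -> ->; ring.
Qed.

Lemma backward_increment (T : R) (x a J : R -> Omega -> R) (y : Omega -> R) (s t : R) :
  0 <= s -> s <= t -> t <= T -> L2t 0 T a ->
  (forall t, 0 <= t <= T -> {ae Pr, forall w, x t w = y w + tint a t T w - (J T w - J t w)}) ->
  {ae Pr, forall w, x s w = x t w + tint a s t w - (J t w - J s w)}.
Proof.
move=> s0 st tT La e; have t0 := le_trans s0 st; have sT := le_trans st tT.
have La' : L2t s T a by apply: L2tS La.
have es := e s; have et := e t; rewrite s0 sT in es; rewrite t0 tT in et.
apply: (@filterS3 _ _ _ _ _ _ _ _ (es isT) (et isT) (tint_split st tT La')).
by move=> w -> -> ->; ring.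
Qed.

Lemma n2P_ae0 (X : Omega -> R) : L2P X -> n2P X <= 0 -> {ae Pr, forall w, X w = 0}.
Proof.
move=> LX h; have /(n2_eq0 measurableT LX) : n2P X = 0 by apply/le_anti; rewrite h n2_ge0.
by apply: filterS => w; apply.
Qed.

(** * Linear backward stochastic equations *)

Section bsde.
Variables (T : R) (F : R -> set (set Omega)) (W : R -> Omega -> R).
Hypothesis itg : integrator Pr T F W.
Variables (q : nat) (X Z h I : vproc q) (C : R).
Hypotheses (T0 : 0 <= T) (C0 : 0 <= C).
Hypotheses (LX : vL2t 0 T X) (LZ : vL2t 0 T Z) (Lh : vL2t 0 T h).
Hypothesis hC : forall a b : R, 0 <= a -> a <= b -> b <= T ->
  vn2t a b h <= C * (vn2t a b X + vn2t a b Z).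
Hypothesis mX : forall t, 0 <= t <= T -> measurable_vec (F t) (X t).
Hypothesis hI : forall s t : R, 0 <= s -> s <= t -> t <= T -> forall l,
  itoinc Pr F W s t Z`_[l] (fun w => I t w l ord0 - I s w l ord0).
Hypothesis eX : forall s t : R, 0 <= s -> s <= t -> t <= T -> forall l,
  {ae Pr, forall w, X s w l ord0 =
     X t w l ord0 + tint h`_[l] s t w - (I t w l ord0 - I s w l ord0)}.

(* [X_s] is orthogonal to the increment of the martingale, so both are bounded by their sum,
   the time integral. *)
Lemma bsde_step (s t : R) : 0 <= s -> s <= t -> t <= T ->
  (forall l, {ae Pr, forall w, X t w l ord0 = 0}) -> forall l,
  [/\ L2P (fun w => X s w l ord0),
     n2P (fun w => X s w l ord0) <= Num.sqrt (t - s) * n2t s t h`_[l] &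
     n2t s t Z`_[l] <= Num.sqrt (t - s) * n2t s t h`_[l]].
Proof.
move=> s0 st tT X0 l; have s0T : 0 <= s <= T by rewrite s0 (le_trans st).
have [Lt nt] := tint_L2 st (L2tS s0 tT (Lh l)).
have [_ LM _] := hI s0 st tT l.
have mXs : measurable_fun setT (fun w => X s w l ord0).
  by apply: (measurable_wrt_fun (itg_sub itg s0T)); exact: mX.
have e : {ae Pr, forall w, X s w l ord0 + (I t w l ord0 - I s w l ord0) = tint h`_[l] s t w}.
  by apply: filterS2 (X0 l) (eX s0 st tT l) => w -> ->; ring.
have LXs : L2P (fun w => X s w l ord0).
  have [] // := n2_eq_ae measurableT mXs (L2B measurableT Lt LM).
  by apply: filterS e => w <- _; ring.
have [LS nS] := n2_eq_ae measurableT (proj1 (L2D measurableT LXs LM)) Lt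
  (filterS (fun w h _ => h) e).
have o := itoinc_orth itg s0 tT (hI s0 st tT l) (mX s0T l) LXs.
have [p1 p2] := pythagoras_le LXs LM o; rewrite nS in p1 p2.
split => //; first exact: le_trans nt.
by rewrite -(itoinc_isometry itg s0 tT (hI s0 st tT l)); exact: le_trans nt.
Qed.

(** Everything is measured by the size [a] of the drift [h] on the interval: Z is at most [sqrt del]
    times [a], X at most [del] times [a], and [hC] returns [a <= a / 2]. *)
Lemma bsde_interval (del s t : R) : C * (del + Num.sqrt del) <= 2^-1 -> 0 < del ->
  0 <= s -> s <= t -> t <= T -> t - s <= del ->
  (forall l, {ae Pr, forall w, X t w l ord0 = 0}) ->
  (forall u, s <= u <= t -> forall l, {ae Pr, forall w, X u w l ord0 = 0}) /\ vn2t s t Z = 0.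
Proof.
move=> Cd d0 s0 st tT tsd X0; set a := vn2t s t h.
have a0 : 0 <= a by exact: vn2t_ge0.
have sd : Num.sqrt (t - s) <= Num.sqrt del by rewrite ler_wsqrtr.
have nZ : vn2t s t Z <= Num.sqrt del * a.
  rewrite /a /vn2t mulr_sumr; apply: ler_sum => l _.
  have [_ _] := bsde_step s0 st tT X0 l; move=> /le_trans; apply.
  by rewrite ler_wpM2r// n2_ge0.
have step u l : s <= u <= t -> L2P (fun w => X u w l ord0) /\
    n2P (fun w => X u w l ord0) <= Num.sqrt (t - s) * n2t s t h`_[l].
  move=> /andP[su ut]; have u0 := le_trans s0 su.
  have [L n _] := bsde_step u0 ut tT X0 l; split => //; apply: le_trans n _.
  apply: ler_pM; rewrite ?sqrtr_ge0 ?n2_ge0//.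
    by rewrite ler_wsqrtr// lerD2l lerN2.
  by apply: n2tS su _ _ => //; apply: L2tS (Lh l).
have nX : vn2t s t X <= del * a.
  rewrite /a /vn2t mulr_sumr; apply: ler_sum => l _.
  have [|||_ n] := @n2t_slices_le _ _ _ Pr s t X`_[l] (Num.sqrt (t - s) * n2t s t h`_[l]) st.
  - by rewrite mulr_ge0 ?sqrtr_ge0 ?n2_ge0.
  - by case: (L2tS s0 tT (LX l)).
  - by move=> u; exact: step.
  apply: le_trans n _; rewrite mulrA -expr2 sqr_sqrtr ?subr_ge0//.
  by rewrite ler_wpM2r// n2_ge0.
have a00 : a = 0.
  apply/le_anti; rewrite a0 andbT.
  have h1 := hC s0 st tT; rewrite -/a in h1.
  have h2 : C * (vn2t s t X + vn2t s t Z) <= C * (del + Num.sqrt del) * a.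
    by rewrite -mulrA ler_wpM2l// mulrDl lerD.
  have h3 : C * (del + Num.sqrt del) * a <= 2^-1 * a by rewrite ler_wpM2r.
  have := le_trans h1 (le_trans h2 h3); lra.
split.
  move=> u su l; have [L n] := step u l su; apply: n2P_ae0 => //; apply: le_trans n _.
  have : n2t s t h`_[l] <= 0 by rewrite -a00; exact: n2t_vn2t.
  by move=> n0; apply: mulr_ge0_le0 => //; exact: sqrtr_ge0.
by apply/le_anti; rewrite vn2t_ge0 andbT (le_trans nZ)// a00 mulr0.
Qed.

Hypothesis XT : forall l, {ae Pr, forall w, X T w l ord0 = 0}.

Lemma bsde_zero :
  (forall t, 0 <= t <= T -> forall l, {ae Pr, forall w, X t w l ord0 = 0}) /\
  ae_time T (fun t => {ae Pr, forall w, forall l, Z t w l ord0 = 0}).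
Proof.
have [del d0 Cd] := small_time C0.
(* Both unknowns vanish on [T - r, T]; the restriction to times of [0, T] lets [r] exceed T. *)
pose S r := (forall t, 0 <= t <= T -> T - r <= t -> forall l, {ae Pr, forall w, X t w l ord0 = 0}) /\
  {ae leb, forall t, T - r <= t <= T -> 0 <= t -> {ae Pr, forall w, forall l, Z t w l ord0 = 0}}.
have Zae (s t : R) : 0 <= s -> t <= T -> vn2t s t Z = 0 ->
    {ae leb, forall r, s <= r <= t -> {ae Pr, forall w, forall l, Z r w l ord0 = 0}}.
  move=> s0 tT Z0.
  have Zl l : {ae leb, forall r, s <= r <= t -> {ae Pr, forall w, Z r w l ord0 = 0}}.
    apply: (@slab_ae_slices _ _ _ Pr s t (fun r w => Z r w l ord0 = 0)).
    apply: (n2_eq0 (measurable_slab s t)); first exact: L2tS (LZ l).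
    by apply/le_anti; rewrite n2_ge0 andbT -Z0; exact: n2t_vn2t.
  have : {ae leb, forall r, forall l, l \in enum 'I_q -> s <= r <= t -> {ae Pr, forall w, Z r w l ord0 = 0}}.
    elim: (enum 'I_q) => [|l0 e IH]; first by apply: aeW.
    apply: filterS2 (Zl l0) IH => r h1 h2 l; rewrite inE => /orP[/eqP ->//|]; exact: h2.
  apply: filterS => r hr sr.
  have : {ae Pr, forall w, forall l, l \in enum 'I_q -> Z r w l ord0 = 0}.
    have {hr} : forall l, l \in enum 'I_q -> {ae Pr, forall w, Z r w l ord0 = 0}.
      by move=> l le; exact: hr.
    elim: (enum 'I_q) => [_|l0 e IH hr]; first by apply: aeW.
    have h0 := hr l0 (mem_head _ _).
    have {}IH : {ae Pr, forall w, forall l, l \in e -> Z r w l ord0 = 0}.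
      by apply: IH => l le; apply: hr; rewrite inE le orbT.
    by apply: filterS2 h0 IH => w h1 h2 l; rewrite inE => /orP[/eqP ->//|]; exact: h2.
  by apply: filterS => w hw l; apply: hw; rewrite mem_enum.
have [||r Tr [SX SZ]] := @step_induction _ del S d0 _ _ T.
- split; rewrite subr0.
    by move=> t /andP[_ tT] Tt l; have -> : t = T by [apply/le_anti; rewrite tT]; exact: XT.
  have TTd : T - T <= del by rewrite subrr ltW.
  have [_] := bsde_interval Cd d0 T0 (lexx T) (lexx T) TTd XT.
  move=> /(Zae T T T0 (lexx T)); apply: filterS => t ht tT _; exact: ht.
- move=> r r0 [SX SZ].
  have [Tr|Tr] := ltP (T - r) 0.
    split; first by move=> t tT _; apply: SX => //; case/andP: tT => t0 _; rewrite (le_trans (ltW Tr)).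
    apply: filterS SZ => t ht /andP[_ tT] t0; apply: ht => //.
    by rewrite tT andbT (le_trans (ltW Tr)).
  (* The last step might leave [0, T], hence the truncation at 0. *)
  pose s := Num.max 0 (T - r - del).
  have s0 : 0 <= s by rewrite le_max lexx.
  have sr : s <= T - r by rewrite ge_max Tr gerBl ltW.
  have rT : T - r <= T by rewrite gerBl.
  have sd : T - r - s <= del by rewrite lerBlDl -lerBlDr le_max lexx orbT.
  have X0 l : {ae Pr, forall w, X (T - r) w l ord0 = 0} by apply: SX; rewrite ?Tr.
  have [hX hZ] := bsde_interval Cd d0 s0 sr rT sd X0.
  have sle t : 0 <= t -> T - (r + del) <= t -> s <= t by move=> t0 h'; rewrite ge_max t0 -addrA -opprD.
  split.
    move=> t /andP[t0 tT] rt; have [h'|h'] := leP (T - r) t; first by apply: SX; rewrite ?t0.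
    by apply: hX; rewrite (ltW h') sle.
  apply: filterS2 SZ (Zae _ _ s0 rT hZ) => t h1 h2 /andP[rt tT] t0.
  have [h'|h'] := leP (T - r) t; first by apply: h1; rewrite ?h'.
  by apply: h2; rewrite (ltW h') sle.
split.
  by move=> t tT; apply: SX => //; case/andP: tT => t0 _; rewrite (le_trans _ t0)// subr_le0.
rewrite /ae_time; apply: filterS SZ => t ht /andP[t0 tT]; apply: ht => //.
by rewrite tT andbT (le_trans _ t0)// subr_le0.
Qed.

End bsde.
End vector_processes.

Section forward_equations.
Context {d} {Omega : measurableType d} {R : realType}.
Variable Pr : probability Omega R.
Local Notation leb := (@lebesgue_measure R).
Local Notation L2P := (L2 Pr setT).
Local Notation n2P := (n2 Pr setT).
Local Notation n2t := (n2t Pr).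
Local Notation vL2t := (vL2t Pr).
Local Notation vn2t := (vn2t Pr).
Local Notation vn2 := (vn2 Pr).
Local Notation vproc q := (R -> Omega -> 'cV[R]_q).
Local Notation "h `_[ l ]" := (fun r w => h r w l ord0) (at level 3, format "h `_[ l ]").

(** * Linear forward stochastic equations *)

Section sde.
Variables (T : R) (F : R -> set (set Omega)) (W0 W1 : R -> Omega -> R).
Hypotheses (itg0 : integrator Pr T F W0) (itg1 : integrator Pr T F W1).
Variables (q : nat) (p a b0 b1 J0 J1 : vproc q) (C : R).
Hypotheses (T0 : 0 <= T) (C0 : 0 <= C).
Hypotheses (Lp : vL2t 0 T p) (La : vL2t 0 T a).
Hypothesis hC : forall s t : R, 0 <= s -> s <= t -> t <= T ->
  [/\ vn2t s t a <= C * vn2t s t p, vn2t s t b0 <= C * vn2t s t p &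
      vn2t s t b1 <= C * vn2t s t p].
Hypothesis mp : forall t, 0 <= t <= T -> forall l, measurable_fun setT (fun w => p t w l ord0).
Hypothesis hJ0 : forall s t : R, 0 <= s -> s <= t -> t <= T -> forall l,
  itoinc Pr F W0 s t b0`_[l] (fun w => J0 t w l ord0 - J0 s w l ord0).
Hypothesis hJ1 : forall s t : R, 0 <= s -> s <= t -> t <= T -> forall l,
  itoinc Pr F W1 s t b1`_[l] (fun w => J1 t w l ord0 - J1 s w l ord0).
Hypothesis ep : forall s t : R, 0 <= s -> s <= t -> t <= T -> forall l,
  {ae Pr, forall w, p t w l ord0 = p s w l ord0 + tint a`_[l] s t w
     + (J0 t w l ord0 - J0 s w l ord0) + (J1 t w l ord0 - J1 s w l ord0)}.
Hypothesis p0 : forall l, {ae Pr, forall w, p 0 w l ord0 = 0}.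

Lemma sde_step (s t : R) : 0 <= s -> s <= t -> t <= T ->
  (forall l, {ae Pr, forall w, p s w l ord0 = 0}) ->
  (forall l, L2P (fun w => p t w l ord0)) /\
  vn2 (p t) <= (Num.sqrt (t - s) + 2) * C * vn2t s t p.
Proof.
move=> s0 st tT ps.
have one l : L2P (fun w => p t w l ord0) /\ n2P (fun w => p t w l ord0) <=
    Num.sqrt (t - s) * n2t s t a`_[l] + n2t s t b0`_[l] + n2t s t b1`_[l].
  have [Lt nt] := tint_L2 st (L2tS s0 tT (La l)).
  have i0 := hJ0 s0 st tT l; have i1 := hJ1 s0 st tT l.
  have [_ L0 _] := i0; have [_ L1 _] := i1.
  have L01 := L2D measurableT (L2D measurableT Lt L0) L1.
  have t0T : 0 <= t <= T by rewrite (le_trans s0 st).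
  have [L n] : L2P (fun w => p t w l ord0) /\ n2P (fun w => p t w l ord0) =
      n2P (fun w => tint a`_[l] s t w + (J0 t w l ord0 - J0 s w l ord0)
        + (J1 t w l ord0 - J1 s w l ord0)).
    apply: n2_eq_ae => //; first exact: mp.
    by apply: filterS2 (ps l) (ep s0 st tT l) => w h1 h2 _; rewrite h2 h1 add0r.
  split => //; rewrite n -(itoinc_isometry itg0 s0 tT i0) -(itoinc_isometry itg1 s0 tT i1).
  apply: le_trans (n2D measurableT (L2D measurableT Lt L0) L1) _; rewrite lerD2r.
  by apply: le_trans (n2D measurableT Lt L0) _; rewrite lerD2r.
split; first by move=> l; exact: (one l).1.
apply: (@le_trans _ _ (Num.sqrt (t - s) * vn2t s t a + vn2t s t b0 + vn2t s t b1)).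
  rewrite /vn2t mulr_sumr -!big_split; apply: ler_sum => l _; exact: (one l).2.
have [ha h0 h1] := hC s0 st tT.
have : Num.sqrt (t - s) * vn2t s t a <= Num.sqrt (t - s) * (C * vn2t s t p).
  by rewrite ler_wpM2l// sqrtr_ge0.
by rewrite -mulrA mulrDl; lra.
Qed.

(** The stochastic integrals of [sde_step] bring no small factor; the smallness comes from
    integrating the bound [K] at each time over a short interval, which yields [sqrt del]. *)
Lemma sde_zero : forall t, 0 <= t <= T -> forall l, {ae Pr, forall w, p t w l ord0 = 0}.
Proof.
pose B := (Num.sqrt T + 2) * C * vn2t 0 T p.
have B0 : 0 <= B by rewrite !mulr_ge0 ?addr_ge0 ?sqrtr_ge0 ?vn2t_ge0.
(* [q] counts the components, and the factor 2 covers the constant [C q (del + 2 sqrt del)] obtained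
   below. *)
have [del d0 Cd] : exists2 del : R, 0 < del & (2 * C * q%:R) * (del + Num.sqrt del) <= 2^-1.
  by apply: small_time; rewrite !mulr_ge0.
have Lall t : 0 <= t <= T -> forall l, L2P (fun w => p t w l ord0).
  by move=> /andP[t0 tT]; have [] := sde_step (lexx 0) t0 tT p0.
have comp t l : n2P (fun w => p t w l ord0) <= vn2 (p t).
  by rewrite /vn2 (bigD1 l)//= lerDl; apply: sumr_ge0 => j _; exact: n2_ge0.
have zero t : 0 <= t <= T -> (forall j, vn2 (p t) <= B / 2 ^+ j) ->
    forall l, {ae Pr, forall w, p t w l ord0 = 0}.
  move=> tT /halving_le0 h l; apply: n2P_ae0; first exact: Lall.
  exact: le_trans (comp t l) h.
suff H : forall t, 0 <= t <= T -> forall j, vn2 (p t) <= B / 2 ^+ j.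
  by move=> t tT; apply: zero => //; exact: H.
apply: (@small_steps _ T del B (fun t K => vn2 (p t) <= K)) => //.
- move=> t /andP[t0 tT]; have [_] := sde_step (lexx 0) t0 tT p0; move=> /le_trans; apply.
  rewrite /B subr0; apply: ler_pM; rewrite ?mulr_ge0 ?addr_ge0 ?sqrtr_ge0 ?vn2t_ge0//.
    by rewrite ler_wpM2r// lerD2r ler_wsqrtr.
  exact: vn2tS.
- move=> j; apply: (@le_trans _ _ 0); last by rewrite divr_ge0// exprn_ge0.
  rewrite /vn2 big1// => l _.
  have zT : 0 <= (0 : R) <= T by rewrite lexx.
  have z : {ae Pr, forall w, setT w -> p 0 w l ord0 = 0} by apply: filterS (p0 l) => w h _.
  by have [_ ->] := n2_0_ae measurableT (mp zT l) z.
move=> r K r0 K0 zr hK t /andP[rt trd] tT.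
have rT := le_trans rt tT.
have pr : forall l, {ae Pr, forall w, p r w l ord0 = 0}.
  apply: zero; first by rewrite r0.
  by apply: zr; rewrite ?r0 ?lexx.
have [_ h] := sde_step r0 rt tT pr.
have tr : t - r <= del by rewrite lerBlDl.
have nq : vn2t r t p <= q%:R * (Num.sqrt del * K).
  apply: (@le_trans _ _ (\sum_(l < q) Num.sqrt del * K)).
    apply: ler_sum => l _.
    have [|||_ n] := @n2t_slices_le _ _ _ Pr r t p`_[l] K rt => //.
    - by case: (L2tS r0 tT (Lp l)).
    - move=> u /andP[ru ut]; split; first by apply: Lall; rewrite (le_trans r0 ru) (le_trans ut tT).
      apply: le_trans (comp u l) (hK u _ _); last exact: le_trans tT.
      by rewrite ru (le_trans ut).
    apply: le_trans n _; apply: ler_pM; rewrite ?sqrtr_ge0//.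
    by rewrite ler_wsqrtr.
  by rewrite sumr_const card_ord mulr_natl.
apply: le_trans h _.
have sd : Num.sqrt (t - r) <= Num.sqrt del by rewrite ler_wsqrtr.
apply: (@le_trans _ _ ((Num.sqrt del + 2) * C * (q%:R * (Num.sqrt del * K)))).
  apply: ler_pM; rewrite ?mulr_ge0 ?addr_ge0 ?sqrtr_ge0 ?vn2t_ge0//.
  by rewrite ler_wpM2r// lerD2r.
have sdd : Num.sqrt del * Num.sqrt del = del by rewrite -expr2 sqr_sqrtr// ltW.
have -> : (Num.sqrt del + 2) * C * (q%:R * (Num.sqrt del * K)) =
    C * q%:R * (Num.sqrt del * Num.sqrt del + 2 * Num.sqrt del) * K by ring.
rewrite sdd.
have h1 : C * q%:R * (del + 2 * Num.sqrt del) <= 2^-1.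
  apply: le_trans Cd.
  have -> : 2 * C * q%:R * (del + Num.sqrt del) =
    C * q%:R * (del + 2 * Num.sqrt del) + C * q%:R * del by ring.
  by rewrite lerDl !mulr_ge0// ltW.
by rewrite [leRHS]mulrC; apply: ler_wpM2r.
Qed.

End sde.

(** * Conditional mean of a linear equation given the common noise *)

Section conditional_mean.
Variables (T : R) (H : set (set Omega)) (q : nat) (M M0 : R -> 'M[R]_q) (y : vproc q).
Variables (A1 A0 : R -> R -> 'I_q -> Omega -> R).
Hypothesis T0 : 0 <= T.
Hypotheses (LM : Linfty T M) (LM0 : Linfty T M0).
Hypothesis Ly : vL2t 0 T y.
Hypothesis Lt : forall t, 0 <= t <= T -> forall l, L2P (fun w => y t w l ord0).
Variable B : R.
Hypothesis B0 : 0 <= B.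
Hypothesis hB : forall t, 0 <= t <= T -> forall l, n2P (fun w => y t w l ord0) <= B.
Hypothesis ey : forall s t : R, 0 <= s -> s <= t -> t <= T -> forall l,
  {ae Pr, forall w, y t w l ord0 = y s w l ord0 +
    tint (fun r w => M r *m y r w)`_[l] s t w + A1 s t l w + A0 s t l w}.
Hypothesis hA1 : forall s t : R, 0 <= s -> s <= t -> t <= T -> forall l,
  L2P (A1 s t l) /\ pb Pr H 0 (A1 s t l).
Hypothesis hA0 : forall s t : R, 0 <= s -> s <= t -> t <= T -> forall l,
  L2P (A0 s t l) /\ forall k : R, 0 <= k ->
    {ae leb, forall r, s <= r <= t -> pb Pr H k ((fun r w => M0 r *m y r w)`_[l] r)} ->
    pb Pr H (Num.sqrt (t - s) * k) (A0 s t l).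
Hypothesis y0 : forall l, pb Pr H 0 (fun w => y 0 w l ord0).

Lemma pb_mulmx (G : 'M[R]_q) (c K : R) (X : Omega -> 'cV[R]_q) : nrm G <= c -> 0 <= K ->
  (forall l, L2P (fun w => X w l ord0)) -> (forall l, pb Pr H K (fun w => X w l ord0)) ->
  forall l, pb Pr H (c * K) (fun w => (G *m X w) l ord0).
Proof.
move=> Gc K0 LX hX l.
rewrite (_ : (fun w => _) = fun w => \sum_j G l j * X w j ord0); last first.
  by apply/funext => w; rewrite mxE.
apply: (@pbW _ _ _ _ _ (\sum_j `|G l j| * K)).
  rewrite -mulr_suml ler_wpM2r//; apply: le_trans Gc.
  rewrite /nrm [leRHS](bigD1 l)//= lerDl.
  by apply: sumr_ge0 => ? _; apply: sumr_ge0.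
apply: (@pb_sum _ _ _ _ _ _ _ (fun j => `|G l j| * K) (fun j w => G l j * X w j ord0)) => j.
  exact: L2Z.
exact: pbZ.
Qed.

Lemma pb_halving (X : Omega -> R) : (forall j, pb Pr H (B / 2 ^+ j) X) -> pb Pr H 0 X.
Proof.
move=> h Y mY LY; rewrite mul0r; apply: (@halving_le0 _ _ (B * n2P Y)) => j.
by apply: le_trans (h j Y mY LY) _; rewrite mulrAC.
Qed.

(** Deterministic matrices commute with conditional expectation, so [pb] bounds of [y] pass to its
    drift and to its common integral, and the estimate closes on [y] without an equation for the
    conditional mean. *)
Lemma conditional_mean_zero : forall t, 0 <= t <= T -> forall l,
  pb Pr H 0 (fun w => y t w l ord0).
Proof.

have [c c0 hc] := Linfty_nrm LM; have [c' c0' hc'] := Linfty_nrm LM0.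
have [del d0 Cd] : exists2 del : R, 0 < del & (c + c') * (del + Num.sqrt del) <= 2^-1.
  by apply: small_time; exact: addr_ge0.
suff K : forall t, 0 <= t <= T -> forall j, forall l, pb Pr H (B / 2 ^+ j) (fun w => y t w l ord0).
  by move=> t tT l; apply: pb_halving => j; exact: K.
apply: (@small_steps _ T del B (fun t K => forall l, pb Pr H K (fun w => y t w l ord0))) => //.
- move=> t tT l; apply: (pbW (hB tT l)); apply: pb_n2; exact: Lt.
- by move=> j l; apply: (pbW _ (y0 l)); rewrite divr_ge0// exprn_ge0.
move=> r K r0 K0 zr hK t /andP[rt trd] tT l.
have rT := le_trans rt tT.
have tr : t - r <= del by rewrite lerBlDl.
have yr : pb Pr H 0 (fun w => y r w l ord0).
  by apply: pb_halving => j; apply: zr; rewrite ?r0 ?lexx.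
have [C1 _ hC1] := Linfty_mulmx Pr LM.
have [LMy _] := hC1 r t y r0 tT (vL2tS r0 tT Ly).
have slice (G : R -> 'M[R]_q) (cG : R) : ae_time T (fun t => nrm (G t) <= cG) ->
    {ae leb, forall u, r <= u <= t -> pb Pr H (cG * K) ((fun r w => G r *m y r w)`_[l] u)}.
  move=> hG; apply: filterS (ae_time_sub r0 tT hG) => u hu ru.
  have uT : 0 <= u <= T by case/andP: ru => ru ut; rewrite (le_trans r0 ru) (le_trans ut tT).
  apply: pb_mulmx => //; [exact: hu|by move=> j; exact: Lt|].
  apply: hK; case/andP: ru uT => ru ut /andP[_ uT] //.
  by rewrite ru (le_trans ut).
have pt := pb_tint rt (LMy l) (mulr_ge0 c0 K0) (slice M c hc).
have [L0 /(_ (c' * K) (mulr_ge0 c0' K0) (slice M0 c' hc')) p0] := hA0 r0 rt tT l.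
have [L1 p1] := hA1 r0 rt tT l.
have [Ltt _] := tint_L2 rt (LMy l).
have tT' : 0 <= t <= T by rewrite (le_trans r0 rt).
have rT' : 0 <= r <= T by rewrite r0.
have Lyr := Lt rT' l.
apply: (@pbW _ _ _ _ _ (0 + (t - r) * (c * K) + 0 + Num.sqrt (t - r) * (c' * K))).
  rewrite add0r addr0.
  have sd : Num.sqrt (t - r) <= Num.sqrt del by rewrite ler_wsqrtr.
  apply: (@le_trans _ _ (del * (c * K) + Num.sqrt del * (c' * K))).
    by apply: lerD; apply: ler_wpM2r => //; exact: mulr_ge0.
  rewrite [leRHS]mulrC; apply: le_trans (ler_wpM2r K0 Cd).
  have -> : (c + c') * (del + Num.sqrt del) * K =
    (del * (c * K) + Num.sqrt del * (c' * K)) + (c * Num.sqrt del + c' * del) * K by ring.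
  by rewrite lerDl mulr_ge0// addr_ge0// mulr_ge0// ?sqrtr_ge0// ltW.
apply: (pb_eq_ae _ _ (ey r0 rt tT l)).
- by case: (Lt tT' l).
- by do !apply: (L2D measurableT).
- do !apply: pbD => //; by do !apply: (L2D measurableT).
Qed.

End conditional_mean.
End forward_equations.

(** * Versions and increments of processes *)

Section process_tools.
Context {d} {Omega : measurableType d} {R : realType}.
Variable Pr : probability Omega R.
Local Notation leb := (@lebesgue_measure R).
Local Notation E X := (\int[Pr]_w (X w)).
Local Notation L2P := (L2 Pr setT).
Local Notation L2t := (L2t Pr).
Local Notation n2t := (n2t Pr).
Local Notation vL2t := (vL2t Pr).
Local Notation vn2t := (vn2t Pr).
Local Notation vproc q := (R -> Omega -> 'cV[R]_q).
Local Notation "h `_[ l ]" := (fun r w => h r w l ord0) (at level 3, format "h `_[ l ]").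

Lemma ae_ord q (P : 'I_q -> Omega -> Prop) :
  (forall l, {ae Pr, forall w, P l w}) -> {ae Pr, forall w, forall l, P l w}.
Proof.
move=> h; have : {ae Pr, forall w, forall j : nat, forall jq : (j < q)%N, P (Ordinal jq) w}.
  apply/ae_foralln => j.
  have [jq|jq] : (j < q)%N \/ ~ (j < q)%N by case: (j < q)%N; [left|right].
  2: by apply: aeW => w jq'; case: (jq jq').
  by apply: filterS (h (Ordinal jq)) => w hw jq'; rewrite (bool_irrelevance jq' jq).
by apply: filterS => w hw l; have := hw l (ltn_ord l); congr P; exact: val_inj.
Qed.

Lemma ae_colP q (X Y : Omega -> 'cV[R]_q) :
  (forall l, {ae Pr, forall w, X w l ord0 = Y w l ord0}) -> {ae Pr, forall w, X w = Y w}.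
Proof.
by move=> /ae_ord; apply: filterS => w h; apply/matrixP => l j; rewrite (ord1 j).
Qed.

(** Clamped to [0, T], the rationals remain dense there and include both end points, so T, possibly
    irrational, is no special case. *)
Lemma within_continuous_eq0 (T : R) (f : R -> R) : 0 < T ->
  {within `[0, T], continuous f} ->
  (forall q : rat, f (Num.max 0 (Num.min T (ratr q))) = 0) ->
  forall t, 0 <= t <= T -> f t = 0.
Proof.
move=> T0 cf f0 t tT; apply/eqP/negPn/negP => ft.
have /subspace_continuousP/(_ t) := cf.
rewrite /= in_itv /= => /(_ tT)/cvgrPdist_lt/(_ `|f t|).
rewrite normr_gt0 => /(_ ft); rewrite near_withinE => -[e /= e0 he].
have [q] : exists q, ratr q \in `]t - e, t + e[ by apply: rat_in_itvoo; lra.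
rewrite in_itv /= => /andP[q1 q2].
move: (ratr q) q1 q2 (f0 q) => c q1 q2 fc; have /andP[t0 tT'] := tT.
have H : `|t - Num.max 0 (Num.min T c)| < e.
  rewrite ltr_norml; apply/andP.
  have [h|h] := leP T c; [have [h'|h'] := leP 0 T|have [h'|h'] := leP 0 c]; split; lra.
have cI : Num.max 0 (Num.min T c) \in `[0, T].
  by rewrite in_itv /= le_max lexx ge_max ge_min lexx (ltW T0).
have : `|f t - f (Num.max 0 (Num.min T c))| < `|f t| by exact: (he _ H cI).
by rewrite fc subr0 ltxx.
Qed.

Lemma continuous_indistinguishable (T : R) q (X Y : vproc q) : 0 < T ->
  as_continuous Pr T X -> as_continuous Pr T Y ->
  (forall t, 0 <= t <= T -> forall l, {ae Pr, forall w, X t w l ord0 = Y t w l ord0}) ->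
  {ae Pr, forall w, forall t, 0 <= t <= T -> X t w = Y t w}.
Proof.
move=> T0 cX cY e.
(* [unpickle] is partial; its default value 0 merely repeats a rational. *)
pose r (j : nat) : R := Num.max 0 (Num.min T (ratr (odflt 0 (unpickle j)))).
have rT j : 0 <= r j <= T.
  by rewrite le_max lexx ge_max ge_min lexx (ltW T0).
have h : {ae Pr, forall w, forall j, X (r j) w = Y (r j) w}.
  by apply/ae_foralln => j; apply: ae_colP => l; exact: e.
apply: filterS3 h cX cY => w hw cXw cYw t tT; apply/matrixP => l j; rewrite (ord1 j).
apply/eqP; rewrite -subr_eq0; apply/eqP.
apply: (@within_continuous_eq0 T (fun t => X t w l ord0 - Y t w l ord0)) => //.
  by move=> u; apply: (@cvgB _ R); [exact: cXw|exact: cYw].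
by move=> p; have := hw (pickle p); rewrite /r pickleK /= => ->; rewrite subrr.
Qed.

(** An integral is given up to null sets at each time, so even at 0, where all simple integrals
    vanish, it is zero only almost surely. Initial conditions are read off the integral equations in
    this way. *)
Lemma ito1_at0 (T : R) F W h I : 0 <= T -> is_ito1 Pr T F W h I ->
  {ae Pr, forall w, I 0 w = 0}.
Proof.
move=> T0 [mI [hs [simp _ cI]]].
have zT : 0 <= (0 : R) <= T by rewrite lexx.
have small (e : R) : 0 < e -> (\int[Pr]_w ((I 0 w) ^+ 2)%:E < e%:E)%E.
  move=> e0; have [j hj] := filter_ex (ecvg0_near e0 (cI 0 zT)).
  move: hj; congr (_ < _)%E; apply: eq_integral => w _.
  by rewrite (simple_ito0 W w (simp j)) sub0r sqrrN.
have LI : L2P (I 0).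
  apply: L2_finite_integral => //; first exact: mI.
  by apply: lt_trans (small 1 ltr01) _; rewrite ltry.
apply: n2P_ae0 => //; apply: le0_eps => e e0.
rewrite -(ler_pXn2r (ltn0Sn 1)) ?nnegrE ?n2_ge0 ?(ltW e0)//.
by rewrite -lee_fin (n2E measurableT LI) ltW// small// exprn_gt0.
Qed.

Lemma n2t_0_ae (s t : R) (f : R -> Omega -> R) : L2t s t f ->
  {ae leb, forall r, s <= r <= t -> {ae Pr, forall w, f r w = 0}} -> n2t s t f = 0.
Proof.
move=> Lf h; have [[m _] <-] := n2P_slices Lf.
apply: (proj2 (n2_0_ae (mitv s t) m _)).
apply: filterS2 h (L2t_slices Lf) => r hr Lr; rewrite /= in_itv /= => rst.
have [mr _] := Lr rst; apply: (proj2 (n2_0_ae measurableT mr _)).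
by apply: filterS (hr rst) => w ->.
Qed.

Lemma vn2t_eq (s t : R) q (h h' : vproc q) : (forall r, s <= r <= t -> forall w, h r w = h' r w) ->
  vL2t s t h -> vL2t s t h' /\ vn2t s t h' = vn2t s t h.
Proof.
move=> e L.
have H l : L2t s t h'`_[l] /\ n2t s t h'`_[l] = n2t s t h`_[l].
  have e' : {in slab s t, (fun p => h p.1 p.2 l ord0) =1 (fun p => h' p.1 p.2 l ord0)}.
    by move=> [r w]; rewrite inE => -[/= + _]; rewrite in_itv /= => rst; rewrite e.
  apply: (n2_eq_ae (measurable_slab s t) _ (L l)).
    by apply: (eq_measurable_fun (fun p => h p.1 p.2 l ord0)) => //; case: (L l).
  by apply: aeW => p Dp; rewrite e' ?inE.
split; first by move=> l; exact: (H l).1.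
by apply: eq_bigr => l _; exact: (H l).2.
Qed.

Lemma ito_increment (T : R) F W q (h I : vproc q) : integrator Pr T F W ->
  is_ito Pr T F W h I -> forall s t : R, 0 <= s -> s <= t -> t <= T -> forall l,
  itoinc Pr F W s t h`_[l] (fun w => I t w l ord0 - I s w l ord0).
Proof.
move=> itg [Lh hI] s t s0 st tT l.
apply: (@itoinc_of_ito1 _ _ _ Pr T F W itg s t h`_[l] I`_[l]) => //.
exact: (L2_adapted_vL2t Lh l).
Qed.

Lemma itoinc_diff (T : R) F W q (h I h' I' g : vproc q) : integrator Pr T F W ->
  (forall s t : R, 0 <= s -> s <= t -> t <= T -> forall l,
    itoinc Pr F W s t h`_[l] (fun w => I t w l ord0 - I s w l ord0)) ->
  (forall s t : R, 0 <= s -> s <= t -> t <= T -> forall l,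
    itoinc Pr F W s t h'`_[l] (fun w => I' t w l ord0 - I' s w l ord0)) ->
  (forall r w, g r w = h r w - h' r w) ->
  forall s t : R, 0 <= s -> s <= t -> t <= T -> forall l,
  itoinc Pr F W s t g`_[l] (fun w => (I t w - I' t w) l ord0 - (I s w - I' s w) l ord0).
Proof.
move=> itg H H' e s t s0 st tT l.
have := itoincB itg s0 tT (H s t s0 st tT l) (H' s t s0 st tT l).
congr (itoinc _ _ _ _ _ _ _); last by apply/funext => w; rewrite !mxE; ring.
by apply/funext => r; apply/funext => w; rewrite e !mxE.
Qed.

Section control.
Variables (T : R) (kappa : R -> R -> R).
Hypothesis kappa0 : forall s t, 0 <= kappa s t.

(** The analogue of [lip] for processes: [kappa s t] is the size of the unknowns on [s, t], and the
    constant is uniform in the interval. It is stable under sums and bounded deterministic factors,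
    so the shape of an expression yields its estimate. *)
Definition ctrl q (h : vproc q) := vL2t 0 T h /\ exists2 C : R, 0 <= C &
  forall s t : R, 0 <= s -> s <= t -> t <= T -> vn2t s t h <= C * kappa s t.

Lemma ctrlD q (h h' : vproc q) : ctrl h -> ctrl h' -> ctrl (fun r w => h r w + h' r w).
Proof.
move=> [L [C C0 hC]] [L' [C' C0' hC']]; split; first exact: (vL2tD L L').1.
exists (C + C'); first exact: addr_ge0.
move=> s t s0 st tT; have [_ n] := vL2tD (vL2tS s0 tT L) (vL2tS s0 tT L').
by apply: le_trans n _; rewrite mulrDl lerD ?hC ?hC'.
Qed.

Lemma ctrlN q (h : vproc q) : ctrl h -> ctrl (fun r w => - h r w).
Proof.
move=> [L [C C0 hC]]; split; first exact: (vL2tN L).1.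
by exists C => // s t s0 st tT; have [_ ->] := vL2tN (vL2tS s0 tT L); exact: hC.
Qed.

Lemma ctrlM p q (M : R -> 'M[R]_(p, q)) (h : vproc q) : Linfty T M -> ctrl h ->
  ctrl (fun r w => M r *m h r w).
Proof.
move=> LM [L [C C0 hC]]; have [C' C0' hC'] := Linfty_mulmx Pr LM.
split; first exact: (hC' 0 T h (lexx 0) (lexx T) L).1.
exists (C' * C); first exact: mulr_ge0.
move=> s t s0 st tT; have [_ n] := hC' s t h s0 tT (vL2tS s0 tT L).
by apply: le_trans n _; rewrite -mulrA ler_wpM2l// hC.
Qed.

Lemma ctrl_eq q (h h' : vproc q) : (forall r, 0 <= r <= T -> forall w, h r w = h' r w) ->
  ctrl h -> ctrl h'.
Proof.
move=> e [L [C C0 hC]]; split; first exact: (vn2t_eq e L).1.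
exists C => // s t s0 st tT.
have e' : forall r, s <= r <= t -> forall w, h r w = h' r w.
  by move=> r /andP[sr rt] w; rewrite e// (le_trans s0 sr) (le_trans rt tT).
by have [_ ->] := vn2t_eq e' (vL2tS s0 tT L); exact: hC.
Qed.

End control.

Lemma vL2t_mulmx (T : R) p q (M : R -> 'M[R]_(p, q)) (h : vproc q) : Linfty T M ->
  vL2t 0 T h -> vL2t 0 T (fun r w => M r *m h r w).
Proof.
move=> LM L; have [C' C0' hC'] := Linfty_mulmx Pr LM.
exact: (hC' 0 T h (lexx 0) (lexx T) L).1.
Qed.

Lemma tint_diff (T s t : R) q (h h' g : vproc q) : 0 <= s -> t <= T ->
  vL2t 0 T h -> vL2t 0 T h' ->
  (forall r, 0 <= r <= T -> forall w, g r w = h r w - h' r w) -> forall l,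
  {ae Pr, forall w, tint h`_[l] s t w - tint h'`_[l] s t w = tint g`_[l] s t w}.
Proof.
move=> s0 tT L L' e l.
apply: filterS2 (path_integrable (L2tS s0 tT (L l))) (path_integrable (L2tS s0 tT (L' l))).
move=> w I I'; rewrite /tint -RintegralB//; apply: eq_Rintegral => r.
rewrite inE /= in_itv /= => /andP[sr rt]; rewrite e ?mxE//.
by rewrite (le_trans s0 sr) (le_trans rt tT).
Qed.

Lemma square_integrable_L2 q (X : Omega -> 'cV[R]_q) :
  (forall l, measurable_fun setT (fun w => X w l ord0)) -> square_integrable Pr X ->
  forall l, L2P (fun w => X w l ord0).
Proof.
move=> mX IX l; apply: L2_finite_integral => //; apply: le_lt_trans IX.
apply: ge0_le_integral => //.
- by move=> w _; rewrite lee_fin sqr_ge0.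
- by apply/measurable_EFinP; apply: measurable_funX.
- by apply/measurable_EFinP; apply: measurable_sum => j; apply: measurable_funX.
- move=> w _; rewrite lee_fin /sqnorm (bigD1 l)//= lerDl.
  by apply: sumr_ge0 => j _; rewrite sqr_ge0.
Qed.

End process_tools.

(** * The two methods *)

Lemma add_mxE {R : realType} p q (A B : 'M[R]_(p, q)) i j : (A + B) i j = A i j + B i j.
Proof. by rewrite mxE. Qed.

Lemma opp_mxE {R : realType} p q (A : 'M[R]_(p, q)) i j : (- A) i j = - A i j.
Proof. by rewrite mxE. Qed.

(** * Differences of the coefficients along two solutions *)

Section expressions.
Context {R : realType} {n k : nat}.
Variables (c : coeffs R n k) (a : inputs R n k) (P K : 'M[R]_n).

(** Expands all products and compares entries, where the remaining matrix products are atoms for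
    [ring]. *)
Ltac mxring := rewrite ?(mulmxDr, mulmxBr, mulmxDl, mulmxBl, mulmxN, mulNmx, mulmxA);
  apply/matrixP => ? ?; rewrite !(add_mxE, opp_mxE); ring.

Lemma PhiB phi beta phi' beta' :
  Phi c a P K phi beta - Phi c a P K phi' beta' =
  (cB c)^T *m (phi - phi') + (cDt c)^T *m (beta - beta').
Proof. by rewrite /Phi; mxring. Qed.

Definition phi_gain : 'M[R]_(n, k) :=
  ((P + K) *m cB c - (cC c)^T *m P *m cD c - (cCt c)^T *m (P + K) *m cDt c)
    *m invmx (calRK c P K).

Lemma phi_termsB phi beta phi' beta' :
  phi_terms c a P K phi beta - phi_terms c a P K phi' beta' =
  (cA c)^T *m (phi - phi')
  - phi_gain *m ((cB c)^T *m (phi - phi') + (cDt c)^T *m (beta - beta'))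
  + (cCt c)^T *m (beta - beta').
Proof.
rewrite -(PhiB phi beta phi' beta') /phi_terms -/phi_gain.
move: phi_gain (Phi _ _ _ _ _ _) (Phi _ _ _ _ _ _) => G F F'.
by mxring.
Qed.

Lemma feedbackB phi beta phi' beta' x z x' z' :
  feedback c a P K phi' beta' x' z' - feedback c a P K phi beta x z =
  - (invmx (calR c P) *m Ptilde c P) *m (x' - x)
  + (invmx (calR c P) *m Ptilde c P - Theta c P K) *m (z' - z)
  - invmx (calRK c P K) *m ((cB c)^T *m (phi' - phi) + (cDt c)^T *m (beta' - beta)).
Proof.
rewrite -PhiB /feedback -/(Theta c P K).
move: (Phi _ _ _ _ _ _) (Phi _ _ _ _ _ _) (Theta _ _ _) => G F F'.
by mxring.
Qed.

Lemma driftB x z u x' z' u' :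
  drift c a x' z' u' - drift c a x z u =
  cA c *m (x' - x) + cB c *m (u' - u) + cE c *m (z' - z).
Proof. by rewrite /drift; mxring. Qed.

Lemma private_diffusionB x z u x' z' u' :
  private_diffusion c a x' z' u' - private_diffusion c a x z u =
  cC c *m (x' - x) + cD c *m (u' - u) + cF c *m (z' - z).
Proof. by rewrite /private_diffusion; mxring. Qed.

Lemma common_diffusionB x z u x' z' u' :
  common_diffusion c a x' z' u' - common_diffusion c a x z u =
  cCt c *m (x' - x) + cDt c *m (u' - u) + cFt c *m (z' - z).
Proof. by rewrite /common_diffusion; mxring. Qed.

(** The feedback equals [- invmx calR *m Ptilde *m (x - z) - Theta *m z - ell]. Its last two terms
    are those of the mean-field equation, so every inhomogeneous term cancels. *)
Lemma drift_feedback phi beta x z :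
  drift c a x z (feedback c a P K phi beta x z)
  - ((cA c + cE c - cB c *m Theta c P K) *m z + in_f a - cB c *m ell c a P K phi beta) =
  (cA c - cB c *m (invmx (calR c P) *m Ptilde c P)) *m (x - z).
Proof.
rewrite /drift /feedback /ell -/(Theta c P K).
move: (Phi _ _ _ _ _ _) (Theta _ _ _) => G F.
by mxring.
Qed.

Lemma common_diffusion_feedback phi beta x z :
  common_diffusion c a x z (feedback c a P K phi beta x z)
  - ((cCt c + cFt c - cDt c *m Theta c P K) *m z + in_gt a - cDt c *m ell c a P K phi beta) =
  (cCt c - cDt c *m (invmx (calR c P) *m Ptilde c P)) *m (x - z).
Proof.
rewrite /common_diffusion /feedback /ell -/(Theta c P K).
move: (Phi _ _ _ _ _ _) (Theta _ _ _) => G F.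
by mxring.
Qed.

End expressions.

Lemma time_integralE {R : realType} n (s t : R) (h : R -> 'cV[R]_n) l :
  time_integral s t h l ord0 = \int[@lebesgue_measure R]_(r in `[s, t]) (h r l ord0).
Proof. by rewrite mxE. Qed.

Lemma eq_time_integral {R : realType} n (s t : R) (h h' : R -> 'cV[R]_n) :
  (forall r, s <= r <= t -> h r = h' r) -> time_integral s t h = time_integral s t h'.
Proof.
move=> e; apply/colP => l; rewrite !time_integralE; apply: eq_Rintegral => r.
by rewrite inE /= in_itv /= => /e ->.
Qed.

(** Syntax-directed: sums, products, transposes and the named gains are decomposed down to the
    coefficients of (A1) and the hypotheses on the unknowns. [vl2] and [ctl] do the same for
    processes. *)
Ltac linf := lazymatch goal with
  | |- Linfty _ (fun t => GRing.add (@?a t) (@?b t)) => refine (LinftyD _ _); linf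
  | |- Linfty _ (fun t => GRing.opp (@?a t)) => refine (LinftyN _); linf
  | |- Linfty _ (fun t => mulmx (@?a t) (@?b t)) => refine (LinftyM _ _); linf
  | |- Linfty _ (fun t => trmx (@?a t)) => refine (LinftyT _); linf
  | |- Linfty _ (fun t => Ptilde (@?a t) (@?b t)) => rewrite /Ptilde; linf
  | |- Linfty _ (fun t => Ktilde (@?a t) (@?b t) (@?c t)) => rewrite /Ktilde; linf
  | |- Linfty _ (fun t => Theta (@?a t) (@?b t) (@?c t)) => rewrite /Theta; linf
  | |- Linfty _ (fun t => phi_gain (@?a t) (@?b t) (@?c t)) => rewrite /phi_gain; linf
  | |- Linfty _ (fun t => cA _) => eapply A1_A; eassumption
  | |- Linfty _ (fun t => cB _) => eapply A1_B; eassumption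
  | |- Linfty _ (fun t => cC _) => eapply A1_C; eassumption
  | |- Linfty _ (fun t => cD _) => eapply A1_D; eassumption
  | |- Linfty _ (fun t => cE _) => eapply A1_E; eassumption
  | |- Linfty _ (fun t => cF _) => eapply A1_F; eassumption
  | |- Linfty _ (fun t => cCt _) => eapply A1_Ct; eassumption
  | |- Linfty _ (fun t => cDt _) => eapply A1_Dt; eassumption
  | |- Linfty _ (fun t => cFt _) => eapply A1_Ft; eassumption
  | |- Linfty _ (fun t => cQ _) => eapply A1_Q; eassumption
  | |- Linfty _ (fun t => cR _) => eapply A1_R; eassumption
  | |- _ => assumption
  end.

Ltac vl2 := lazymatch goal with
  | |- vL2t _ _ _ (fun r w => GRing.add (@?a r w) (@?b r w)) => refine (proj1 (vL2tD _ _)); vl2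
  | |- vL2t _ _ _ (fun r w => GRing.opp (@?a r w)) => refine (proj1 (vL2tN _)); vl2
  | |- vL2t _ _ _ (fun r w => mulmx (@?a r) (@?b r w)) => refine (vL2t_mulmx _ _); [linf | vl2]
  | |- vL2t _ _ _ (fun r w => in_f _) => eapply L2_adapted_vL2t; eapply A1_f; eassumption
  | |- vL2t _ _ _ (fun r w => in_g _) => eapply L2_adapted_vL2t; eapply A1_g; eassumption
  | |- vL2t _ _ _ (fun r w => in_gt _) => eapply L2_adapted_vL2t; eapply A1_gt; eassumption
  | |- vL2t _ _ _ (fun r w => in_eta1 _) => eapply L2_adapted_vL2t; eapply A1_eta1; eassumption
  | |- vL2t _ _ _ (fun r w => in_eta2 _) => eapply L2_adapted_vL2t; eapply A1_eta2; eassumption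
  | |- _ => assumption
  end.

Ltac ctl := lazymatch goal with
  | |- ctrl _ _ _ (fun r w => GRing.add (@?a r w) (@?b r w)) => refine (ctrlD _ _); ctl
  | |- ctrl _ _ _ (fun r w => GRing.opp (@?a r w)) => refine (ctrlN _); ctl
  | |- ctrl _ _ _ (fun r w => mulmx (@?a r) (@?b r w)) => refine (ctrlM _ _); [linf | ctl]
  | |- _ => assumption
  end.

(** * Uniqueness for the adjoint equation *)

Section adjoint_equation.
Context {R : realType} {d : measure_display} {Omega : measurableType d}.
Context {N n k : nat}.
Variables (Pr : probability Omega R) (m : game R Omega N n k).
Hypothesis W_brownian : standard_brownian Pr (noise m).
Hypothesis hA1 : A1 Pr m.
Hypothesis T_gt0 : 0 < horizon m.
Local Notation T := (horizon m).
Local Notation vproc q := (R -> Omega -> 'cV[R]_q).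
Local Notation "h `_[ l ]" := (fun r w => h r w l ord0) (at level 3, format "h `_[ l ]").

Variable i : 'I_N.

Lemma phi_terms_L2 P K phi beta : Linfty T P -> Linfty T K ->
  Linfty T (fun t => invmx (calRK (coef m t) (P t) (K t))) ->
  vL2t Pr 0 T phi -> vL2t Pr 0 T beta ->
  vL2t Pr 0 T (fun s w => phi_terms (coef m s) (input m s w) (P s) (K s) (phi s w) (beta s w)).
Proof. by move=> LP LK LiRK Lphi Lbeta; rewrite /phi_terms /Phi; vl2. Qed.

Lemma solves_phi_eq P K P' K' phi beta : (forall t, 0 <= t <= T -> P t = P' t) ->
  (forall t, 0 <= t <= T -> K t = K' t) ->
  solves_phi Pr m P' K' phi beta -> solves_phi Pr m P K phi beta.
Proof.
move=> eP eK [Lphi cphi [I0 hI0 e]]; split; [exact: Lphi|exact: cphi|].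
exists I0; first exact: hI0.
move=> t /andP[t0 tT].
have tT' : 0 <= t <= T by rewrite t0.
have ti w : time_integral t T (fun s => phi_terms (coef m s) (input m s w) (P' s) (K' s)
      (phi s w) (beta s w)) =
    time_integral t T (fun s => phi_terms (coef m s) (input m s w) (P s) (K s)
      (phi s w) (beta s w)).
  apply: eq_time_integral => s /andP[ts sT].
  have s0T : 0 <= s <= T by rewrite sT andbT (le_trans t0).
  by rewrite (eP s s0T) (eK s s0T).
move: (e t tT'); apply: filterS => w; rewrite ti.
exact.
Qed.

Lemma adjoint_uniq P K phi beta phi' beta' : Linfty T P -> Linfty T K ->
  Linfty T (fun t => invmx (calRK (coef m t) (P t) (K t))) ->
  solves_phi Pr m P K phi beta -> solves_phi Pr m P K phi' beta' ->
  (forall t, 0 <= t <= T -> forall l, {ae Pr, forall w, phi t w l ord0 = phi' t w l ord0}) /\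
  ae_time T (fun t => {ae Pr, forall w, beta t w = beta' t w}).
Proof.
move=> LP LK LiRK [Aphi cphi [I hI e]] [Aphi' cphi' [I' hI' e']].
have T0 := ltW T_gt0.
have itg := Fcommon_integrator W_brownian hA1 i.
have Lphi := L2_adapted_vL2t Aphi; have Lphi' := L2_adapted_vL2t Aphi'.
have Lbeta := L2_adapted_vL2t (proj1 hI); have Lbeta' := L2_adapted_vL2t (proj1 hI').
pose X : vproc n := fun t w => phi t w - phi' t w.
pose Z : vproc n := fun t w => beta t w - beta' t w.
have LX : vL2t Pr 0 T X by rewrite /X; vl2.
have LZ : vL2t Pr 0 T Z by rewrite /Z; vl2.
(* [bsde_zero] asks for a drift bounded by X and Z together. *)
pose kap (s t : R) := vn2t Pr s t X + vn2t Pr s t Z.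
have cX : ctrl Pr T kap X.
  by split => //; exists 1 => // s t _ _ _; rewrite mul1r lerDl vn2t_ge0.
have cZ : ctrl Pr T kap Z.
  by split => //; exists 1 => // s t _ _ _; rewrite mul1r lerDr vn2t_ge0.
pose h : vproc n := fun r w => (cA (coef m r))^T *m X r w
  - phi_gain (coef m r) (P r) (K r) *m ((cB (coef m r))^T *m X r w + (cDt (coef m r))^T *m Z r w)
  + (cCt (coef m r))^T *m Z r w.
have [Lh [C C0 hC]] : ctrl Pr T kap h by rewrite /h; ctl.
pose J : vproc n := fun t w => I t w - I' t w.
have Lph := phi_terms_L2 LP LK LiRK Lphi Lbeta.
have Lph' := phi_terms_L2 LP LK LiRK Lphi' Lbeta'.
have mX t : 0 <= t <= T -> measurable_vec (Fcommon m t) (X t).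
  move=> tT l; rewrite (_ : (fun w => _) = fun w => phi t w l ord0 - phi' t w l ord0).
    apply: measurable_wrtB; first exact: (Fcommon_sub W_brownian).
      by case: Aphi => _ mphi _; exact: mphi.
    by case: Aphi' => _ mphi _; exact: mphi.
  by apply/funext => w; rewrite !mxE.
have eX t : 0 <= t <= T -> forall l, {ae Pr, forall w, X t w l ord0 =
    0 + tint h`_[l] t T w - (J T w l ord0 - J t w l ord0)}.
  move=> tT l; have /andP[t0 tT'] := tT.
  have td := tint_diff t0 (lexx T) Lph Lph' (g := h)
    (fun r rT w => esym (phi_termsB _ _ _ _ _ _ _ _)) l.
  apply: filterS3 (e t tT) (e' t tT) td => w h1 h2 <-.
  rewrite /X h1 h2 !(add_mxE, opp_mxE) !time_integralE /tint.
  by ring.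
have XT l : {ae Pr, forall w, X T w l ord0 = 0}.
  have TT : 0 <= T <= T by rewrite lexx T0.
  by apply: filterS (eX T TT l) => w ->; rewrite tint_eq0 !mxE; ring.
have hJ : forall s t : R, 0 <= s -> s <= t -> t <= T -> forall l,
    itoinc Pr (Fcommon m) (W0 m) s t Z`_[l] (fun w => J t w l ord0 - J s w l ord0).
  have hh := @itoinc_diff _ _ _ Pr T _ _ _ beta I beta' I' Z itg (ito_increment itg hI)
    (ito_increment itg hI') (fun _ _ => erefl).
  by move=> s t s0 st tT l; exact: (hh s t s0 st tT l).
have eX' : forall s t : R, 0 <= s -> s <= t -> t <= T -> forall l,
    {ae Pr, forall w, X s w l ord0 = X t w l ord0 + tint h`_[l] s t w - (J t w l ord0 - J s w l ord0)}.
  move=> s t s0 st tT l.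
  apply: (@backward_increment _ _ _ Pr T X`_[l] h`_[l] J`_[l] (fun=> 0) s t s0 st tT (Lh l)).
  by move=> u uT; exact: eX.
have [X0 Z0] := bsde_zero itg T0 C0 LX LZ Lh hC mX hJ eX' XT.
split.
  move=> t tT l; apply: filterS (X0 t tT l) => w; rewrite /X !mxE => /eqP.
  by rewrite subr_eq0 => /eqP.
apply: ae_timeS Z0 => t tT; apply: filterS => w Zw; apply/matrixP => l j; rewrite (ord1 j).
by have := Zw l; rewrite /Z !mxE => /eqP; rewrite subr_eq0 => /eqP.
Qed.

End adjoint_equation.

(** * The mean field of the direct method as a conditional mean *)

Section mean_field.
Context {R : realType} {d : measure_display} {Omega : measurableType d}.
Context {N n k : nat}.
Variables (Pr : probability Omega R) (m : game R Omega N n k).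
Hypothesis W_brownian : standard_brownian Pr (noise m).
Hypothesis hA1 : A1 Pr m.
Hypothesis T_gt0 : 0 < horizon m.
Local Notation T := (horizon m).
Local Notation vproc q := (R -> Omega -> 'cV[R]_q).
Local Notation L2P := (L2 Pr setT).
Local Notation n2P := (n2 Pr setT).
Local Notation "h `_[ l ]" := (fun r w => h r w l ord0) (at level 3, format "h `_[ l ]").
Variable i : 'I_N.
Variables (P K : R -> 'M[R]_n) (phi beta : vproc n).
Hypotheses (LP : Linfty T P) (LK : Linfty T K).
Hypothesis LiR : Linfty T (fun t => invmx (calR (coef m t) (P t))).
Hypothesis LiRK : Linfty T (fun t => invmx (calRK (coef m t) (P t) (K t))).
Hypotheses (Lphi : vL2t Pr 0 T phi) (Lbeta : vL2t Pr 0 T beta).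

Lemma strategy_L2 x z : vL2t Pr 0 T x -> vL2t Pr 0 T z ->
  vL2t Pr 0 T (strategy m P K phi beta x z).
Proof. by move=> Lx Lz; rewrite /strategy /feedback /Phi; vl2. Qed.

Lemma drift_L2 x z u : vL2t Pr 0 T x -> vL2t Pr 0 T z -> vL2t Pr 0 T u ->
  vL2t Pr 0 T (fun s w => drift (coef m s) (input m s w) (x s w) (z s w) (u s w)).
Proof. by move=> Lx Lz Lu; rewrite /drift; vl2. Qed.

Lemma init_L2 l : L2P (fun w => init m i w l ord0).
Proof.
apply: square_integrable_L2; last exact: (A1_init_L2 hA1).
by move=> j; exact: (A1_init_meas hA1).
Qed.

Lemma state_sde_at0 F u z x : state_sde Pr m F i u z x ->
  {ae Pr, forall w, x 0 w = init m i w}.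
Proof.
move=> [_ _ [Ii [I0 [[_ hIi] [_ hI0] e]]]]; have T0 := ltW T_gt0.
have z0 : 0 <= (0 : R) <= T by rewrite lexx.
apply: ae_colP => l.
move: (e 0 z0) (ito1_at0 T0 (hIi l)) (ito1_at0 T0 (hI0 l)).
apply: filterS3 => w -> h1 h2; rewrite !add_mxE h1 h2 time_integralE.
by rewrite set_itv1 Rintegral_set1 !addr0.
Qed.

Lemma state_measurable u z x t : 0 <= t <= T -> state_sde Pr m (Fplayer m i) i u z x ->
  forall l, measurable_fun setT (fun w => x t w l ord0).
Proof.
move=> tT [[_ mx _] _ _] l; apply: (measurable_wrt_fun (Fplayer_sub W_brownian hA1 i t)).
exact: mx.
Qed.

Lemma common_measurable (z : vproc n) t : 0 <= t <= T -> L2_adapted Pr T (Fcommon m) z ->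
  forall l, measurable_fun setT (fun w => z t w l ord0).
Proof.
move=> tT [_ mz _] l; apply: (measurable_wrt_fun (Fcommon_sub W_brownian t)).
exact: mz.
Qed.

Lemma init_mean_pb l :
  pb Pr (Fcommon m T) 0 (fun w => init m i w l ord0 - mean_vec Pr (init m i) l ord0).
Proof.
move=> Y mY LY; rewrite mul0r.
have sC := Fcommon_sub W_brownian T.
pose Gp := sigma_of (coords (init m i) `|` all_path (Wi m i)).
have sG : sub_algebra Gp.
  apply: sub_algebra_sigma_of => X [/(coords_measurable hA1)//|[r r0 ->]].
  exact: (noise_measurable W_brownian).
have mxi : measurable_wrt Gp (fun w => init m i w l ord0).
  by apply: sigma_of_measurable_wrt; left; exists l.
have Lxi := init_L2 l.
have [_ e] := independent_mul sG sC (private_common_independent W_brownian hA1 (i := i)) mxi mY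
  (L2P_integrable Lxi) (L2P_integrable LY).
have Lc : L2P (fun=> mean_vec Pr (init m i) l ord0).
  by apply: L2P_bounded => //; exists `|mean_vec Pr (init m i) l ord0|.
rewrite ipBl// /ip e [X in _ - X](_ : _ = mean_vec Pr (init m i) l ord0 * \int[Pr]_w Y w).
  by rewrite mxE subrr normr0.
by rewrite -RintegralZl//; exact: L2P_integrable.
Qed.

Lemma state_conditional_mean x xbar : mean_field_sde Pr m P K phi beta xbar ->
  state_sde Pr m (Fplayer m i) i (strategy m P K phi beta x xbar) xbar x ->
  forall t, 0 <= t <= T -> forall l,
    pb Pr (Fcommon m T) 0 (fun w => (x t w - xbar t w) l ord0).
Proof.
move=> hbar hx; have T0 := ltW T_gt0.
have x0 := state_sde_at0 hx.
have [Axb _ [Ib [AIb hIb] eb]] := hbar.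
have [Ax _ [Ii [I0 [hIi hI0 ex]]]] := hx.
have Lx := L2_adapted_vL2t Ax; have Lxb := L2_adapted_vL2t Axb.
have Lu := strategy_L2 Lx Lxb.
have Ldr := drift_L2 Lx Lxb Lu.
have Ldrb : vL2t Pr 0 T (fun s w =>
    (cA (coef m s) + cE (coef m s) - cB (coef m s) *m Theta (coef m s) (P s) (K s)) *m xbar s w
    + in_f (input m s w)
    - cB (coef m s) *m ell (coef m s) (input m s w) (P s) (K s) (phi s w) (beta s w)).
  by rewrite /ell /Phi; vl2.
pose M s := cA (coef m s) - cB (coef m s) *m (invmx (calR (coef m s) (P s)) *m Ptilde (coef m s) (P s)).
pose M0 s := cCt (coef m s) - cDt (coef m s) *m (invmx (calR (coef m s) (P s)) *m Ptilde (coef m s) (P s)).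
have LM : Linfty T M by rewrite /M; linf.
have LM0 : Linfty T M0 by rewrite /M0; linf.
pose y : vproc n := fun t w => x t w - xbar t w.
have Ly : vL2t Pr 0 T y by rewrite /y; vl2.
have LMy : vL2t Pr 0 T (fun r w => M r *m y r w) by vl2.
have itgi := Fplayer_integrator_private W_brownian hA1 i.
have itg0 := Fplayer_integrator W_brownian hA1 i.
have itgc := Fcommon_integrator W_brownian hA1 i.
have inci := ito_increment itgi hIi.
have inc0 := ito_increment itg0 hI0.
(* The integral in the equation of [xbar] is adapted to the common noise; it is read in the player's
   filtration so that it can be subtracted from that of [x]. *)
have incb : forall s t : R, 0 <= s -> s <= t -> t <= T -> forall l,
    itoinc Pr (Fplayer m i) (W0 m) s t (fun s w =>
       ((cCt (coef m s) + cFt (coef m s) - cDt (coef m s) *m Theta (coef m s) (P s) (K s)) *m xbar s w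
           + in_gt (input m s w)
           - cDt (coef m s) *m ell (coef m s) (input m s w) (P s) (K s) (phi s w) (beta s w)) l ord0)
      (fun w => Ib t w l ord0 - Ib s w l ord0).
  move=> s t s0 st tT l; apply: (itoinc_sub s0 tT) (ito_increment itgc (conj AIb hIb) s0 st tT l).
  by move=> r _; exact: Fcommon_Fplayer.
have incd := @itoinc_diff _ _ _ Pr T _ _ _ _ I0 _ Ib (fun r w => M0 r *m y r w) itg0 inc0 incb
  (fun r w => esym (common_diffusion_feedback _ _ _ _ _ _ _ _)).
pose J t w := Ii t w + (I0 t w - Ib t w).
have eJ t : 0 <= t <= T -> forall l, {ae Pr, forall w, y t w l ord0 =
    (init m i w l ord0 - mean_vec Pr (init m i) l ord0)
    + tint (fun r w => M r *m y r w)`_[l] 0 t w + J t w l ord0}.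
  move=> tT l; have /andP[t0 tT'] := tT.
  have td := tint_diff (lexx 0) tT' Ldr Ldrb (g := fun r w => M r *m y r w)
    (fun r rT w => esym (drift_feedback _ _ _ _ _ _ _ _)) l.
  move: (ex t tT) (eb t tT i) td; apply: filterS3 => w h1 h2 <-.
  rewrite /y h1 h2 !(add_mxE, opp_mxE) !time_integralE /tint.
  by ring.
have ey : forall s t : R, 0 <= s -> s <= t -> t <= T -> forall l,
    {ae Pr, forall w, y t w l ord0 = y s w l ord0 + tint (fun r w => M r *m y r w)`_[l] s t w
      + (Ii t w l ord0 - Ii s w l ord0)
      + ((I0 t w - Ib t w) l ord0 - (I0 s w - Ib s w) l ord0)}.
  move=> s t s0 st tT l.
  have := @forward_increment _ _ _ Pr T y`_[l]
    (fun _ w => init m i w l ord0 - mean_vec Pr (init m i) l ord0)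
    (fun r w => M r *m y r w)`_[l] J`_[l] s t s0 st tT (LMy l) (fun t tT => eJ t tT l).
  apply: filterS => w ->; rewrite /J !(add_mxE (Ii _ _)).
  by ring.
have y0 l : {ae Pr, forall w, y 0 w l ord0 = init m i w l ord0 - mean_vec Pr (init m i) l ord0}.
  have z0 : 0 <= (0 : R) <= T by rewrite lexx.
  move: (eb 0 z0 i) x0 (ito1_at0 T0 (hIb l)); apply: filterS3 => w h1 h2 h3.
  rewrite /y h1 h2 !(add_mxE, opp_mxE) h3 time_integralE.
  by rewrite set_itv1 Rintegral_set1 !addr0.
have Lxi l : L2P (fun w => init m i w l ord0 - mean_vec Pr (init m i) l ord0).
  apply: L2B => //; first exact: init_L2.
  by apply: L2P_bounded => //; exists `|mean_vec Pr (init m i) l ord0|.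
have my t : 0 <= t <= T -> forall l, measurable_fun setT (fun w => y t w l ord0).
  move=> tT l; rewrite (_ : (fun w => _) = fun w => x t w l ord0 - xbar t w l ord0).
    by apply: measurable_funB; [exact: (state_measurable tT hx)|exact: common_measurable].
  by apply/funext => w; rewrite !mxE.
have Ly0 l : L2P (fun w => y 0 w l ord0) /\ n2P (fun w => y 0 w l ord0) =
    n2P (fun w => init m i w l ord0 - mean_vec Pr (init m i) l ord0).
  apply: n2_eq_ae => //; first by apply: my; rewrite lexx.
  by move: (y0 l); apply: filterS => w h _.
(* A bound of [y] uniform in time, from its equation over [0, t]; the halving starts from it. *)
pose B := \sum_l (n2P (fun w => y 0 w l ord0)
   + Num.sqrt T * n2t Pr 0 T (fun r w => M r *m y r w)`_[l]
   + n2t Pr 0 T (fun r w => private_diffusion (coef m r) (input m r w) (x r w) (xbar r w)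
        (strategy m P K phi beta x xbar r w))`_[l]
   + n2t Pr 0 T (fun r w => M0 r *m y r w)`_[l]).
have Bpos l : 0 <= n2P (fun w => y 0 w l ord0)
   + Num.sqrt T * n2t Pr 0 T (fun r w => M r *m y r w)`_[l]
   + n2t Pr 0 T (fun r w => private_diffusion (coef m r) (input m r w) (x r w) (xbar r w)
        (strategy m P K phi beta x xbar r w))`_[l]
   + n2t Pr 0 T (fun r w => M0 r *m y r w)`_[l].
  by rewrite !addr_ge0 ?mulr_ge0 ?sqrtr_ge0 ?n2_ge0.
have B0 : 0 <= B by apply: sumr_ge0 => l _; exact: Bpos.
have LB t : 0 <= t <= T -> forall l, L2P (fun w => y t w l ord0) /\ n2P (fun w => y t w l ord0) <= B.
  move=> /andP[t0 tT] l; have z0 := lexx (0 : R).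
  have [Lt nt] := tint_L2 t0 (vL2tS z0 tT LMy l).
  have i1 := inci 0 t z0 t0 tT l; have i2 := incd 0 t z0 t0 tT l.
  have [Lp' L1 _] := i1; have [L0' L2_ _] := i2.
  have L01 := L2D measurableT (Ly0 l).1 Lt.
  have L012 := L2D measurableT L01 L1.
  have tT' : 0 <= t <= T by rewrite t0.
  have [L e] : L2P (fun w => y t w l ord0) /\ n2P (fun w => y t w l ord0) =
      n2P (fun w => y 0 w l ord0 + tint (fun r w => M r *m y r w)`_[l] 0 t w
      + (Ii t w l ord0 - Ii 0 w l ord0)
      + ((I0 t w - Ib t w) l ord0 - (I0 0 w - Ib 0 w) l ord0)).
    apply: n2_eq_ae => //; first exact: my.
      exact: L2D.
    by move: (ey 0 t z0 t0 tT l); apply: filterS => w h _.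
  split => //; rewrite e /B (bigD1 l)//=.
  apply: (@le_trans _ _ (n2P (fun w => y 0 w l ord0)
     + Num.sqrt T * n2t Pr 0 T (fun r w => M r *m y r w)`_[l]
     + n2t Pr 0 T (fun r w => private_diffusion (coef m r) (input m r w) (x r w) (xbar r w)
          (strategy m P K phi beta x xbar r w))`_[l]
     + n2t Pr 0 T (fun r w => M0 r *m y r w)`_[l])); last first.
    by rewrite lerDl; apply: sumr_ge0 => j _; exact: Bpos.
  apply: le_trans (n2D measurableT L012 L2_) _; apply: lerD; last first.
    rewrite (itoinc_isometry itg0 z0 tT i2); apply: n2tS => //.
    exact: (vL2t_mulmx LM0 Ly l).
  apply: le_trans (n2D measurableT L01 L1) _; apply: lerD; last first.
    rewrite (itoinc_isometry itgi z0 tT i1); apply: n2tS => //.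
    exact: (L2_adapted_vL2t (proj1 hIi) l).
  apply: le_trans (n2D measurableT (Ly0 l).1 Lt) _; rewrite lerD2l.
  apply: le_trans nt _; rewrite subr0; apply: ler_pM; rewrite ?sqrtr_ge0 ?n2_ge0//.
    by rewrite ler_wsqrtr.
  by apply: n2tS => //; exact: LMy.
have cmz := @conditional_mean_zero _ _ _ Pr T (Fcommon m T) n M M0 y
  (fun s t l w => Ii t w l ord0 - Ii s w l ord0)
  (fun s t l w => (I0 t w - Ib t w) l ord0 - (I0 s w - Ib s w) l ord0) LM LM0 Ly
  (fun t tT l => (LB t tT l).1) B B0 (fun t tT l => (LB t tT l).2) ey.
move=> t tT l; apply: (cmz _ _ _ t tT l) => {t tT l}.
- move=> s t s0 st tT l; have i1 := inci s t s0 st tT l; have [_ L1 _] := i1; split => //.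
  move=> Y mY LY; rewrite mul0r ipC.
  (* For [Gplayer] the whole common noise is known from the start, so [Y] is known at time [s] and
     orthogonal to the private increment. *)
  have i1' := itoinc_sub s0 tT (fun r rT => @Fplayer_Gplayer _ _ _ _ _ _ m i r (proj2 (andP rT))) i1.
  rewrite (itoinc_orth (Gplayer_integrator W_brownian hA1 i) s0 tT i1' _ LY) ?normr0//.
  by apply: measurable_wrtS mY; exact: Fcommon_Gplayer.
- move=> s t s0 st tT l; have i2 := incd s t s0 st tT l; have [_ L2_ _] := i2; split => //.
  by move=> kap kap0 h; exact: (pb_itoinc_common W_brownian hA1 s0 st tT kap0 i2 h).
- move=> l; apply: (pb_eq_ae _ (Lxi l) (y0 l)); last exact: init_mean_pb.
  by apply: my; rewrite lexx.
Qed.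

End mean_field.

(** * Comparison of the two closed-loop systems *)

Section comparison.
Context {R : realType} {d : measure_display} {Omega : measurableType d}.
Context {N n k : nat}.
Variables (Pr : probability Omega R) (m : game R Omega N n k).
Hypothesis W_brownian : standard_brownian Pr (noise m).
Hypothesis hA1 : A1 Pr m.
Hypothesis T_gt0 : 0 < horizon m.
Local Notation T := (horizon m).
Local Notation vproc q := (R -> Omega -> 'cV[R]_q).
Local Notation L2P := (L2 Pr setT).
Local Notation n2P := (n2 Pr setT).
Local Notation ipP := (ip Pr setT).
Local Notation "h `_[ l ]" := (fun r w => h r w l ord0) (at level 3, format "h `_[ l ]").

Lemma cond_exp_orth G X Y Z : sub_algebra G -> is_cond_exp Pr G X Y -> L2P X -> L2P Y ->
  measurable_wrt G Z -> L2P Z -> ipP (fun w => X w - Y w) Z = 0.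
Proof.
move=> sG [IX IY _ e] LX LY mZ LZ.
apply: (ip_orth_sets sG (L2B measurableT LX LY)) => // A GA.
have mA : measurable A by case: sG => _; apply.
have indE (f : Omega -> R) : ipP f (\1_A) = \int[Pr]_(w in A) f w.
  rewrite /ip [RHS]Rintegral_mkcond; apply: eq_Rintegral => w _.
  by rewrite /patch indicE; case: (w \in A); rewrite ?mulr1 ?mulr0.
by rewrite (ipBl measurableT LX LY (L2P_indic Pr mA)) !indE e// subrr.
Qed.

Variable i : 'I_N.
Variables (P K : R -> 'M[R]_n) (phi beta phi' beta' : vproc n).
Hypotheses (LP : Linfty T P) (LK : Linfty T K).
Hypothesis LiR : Linfty T (fun t => invmx (calR (coef m t) (P t))).
Hypothesis LiRK : Linfty T (fun t => invmx (calRK (coef m t) (P t) (K t))).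
Hypotheses (Lphi : vL2t Pr 0 T phi) (Lbeta : vL2t Pr 0 T beta).
Hypotheses (Lphi' : vL2t Pr 0 T phi') (Lbeta' : vL2t Pr 0 T beta').
Hypothesis ephi : ae_time T (fun t => {ae Pr, forall w, phi t w = phi' t w}).
Hypothesis ebeta : ae_time T (fun t => {ae Pr, forall w, beta t w = beta' t w}).
Variables (x xbar x' z : vproc n) (u' : vproc k).
Hypothesis hbar : mean_field_sde Pr m P K phi beta xbar.
Hypothesis hx : state_sde Pr m (Fplayer m i) i (strategy m P K phi beta x xbar) xbar x.
Hypothesis hx' : state_sde Pr m (Fplayer m i) i u' z x'.
Hypothesis Az : L2_adapted Pr T (Fcommon m) z.
Hypothesis hz : forall t, 0 <= t <= T -> is_cond_exp_vec Pr (Fcommon m t) (x' t) (z t).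
Hypothesis hu' : forall t, 0 <= t <= T -> forall w,
  u' t w = strategy m P K phi' beta' x' z t w.

(* [z - xbar] is orthogonal both to [x' - z] and to [x - xbar], hence dominated by
   the distance of the states. *)
Lemma mean_field_gap_le : ae_time T (fun t => forall l,
  [/\ L2P (fun w => (z t w - xbar t w) l ord0), L2P (fun w => (x' t w - x t w) l ord0) &
  n2P (fun w => (z t w - xbar t w) l ord0) <= n2P (fun w => (x' t w - x t w) l ord0)]).
Proof.
have [Ax _ _] := hx; have [Ax' _ _] := hx'; have [Ab _ _] := hbar.
have S q (h : vproc q) : vL2t Pr 0 T h ->
    ae_time T (fun t => forall l, L2P (fun w => h t w l ord0)).
  by move=> L; apply: ae_time_fin => l; exact: (L2t_slices (L l)).
have H := ae_time2 (fun t _ p q => conj p q)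
  (ae_time2 (fun t _ p q => conj p q) (S _ _ (L2_adapted_vL2t Ax)) (S _ _ (L2_adapted_vL2t Ax')))
  (ae_time2 (fun t _ p q => conj p q) (S _ _ (L2_adapted_vL2t Ab)) (S _ _ (L2_adapted_vL2t Az))).
apply: ae_timeS H => t tT [[Sx Sx'] [Sb Sz]] l.
have {}Sx := Sx l; have {}Sx' := Sx' l; have {}Sb := Sb l; have {}Sz := Sz l.
have diffE (f g : Omega -> 'cV[R]_n) :
    (fun w => (f w - g w) l ord0) = fun w => f w l ord0 - g w l ord0.
  by apply/funext => w; rewrite !mxE.
have sub := state_conditional_mean W_brownian hA1 T_gt0 LP LK LiR LiRK Lphi Lbeta hbar hx tT l.
rewrite diffE in sub; rewrite !diffE.
have Lw := L2B measurableT Sz Sb; have Lp := L2B measurableT Sx' Sx.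
have Lxb := L2B measurableT Sx Sb; have Lxz := L2B measurableT Sx' Sz.
have mw : measurable_wrt (Fcommon m t) (fun w => z t w l ord0 - xbar t w l ord0).
  apply: measurable_wrtB; first exact: (Fcommon_sub W_brownian).
    by case: Az => _ + _; apply.
  by case: Ab => _ + _; apply.
(* The consistency condition is tested with the common noise up to t, the conditional mean of
   [x - xbar] with the common noise up to T. *)
have mwT : measurable_wrt (Fcommon m T) (fun w => z t w l ord0 - xbar t w l ord0).
  by apply: measurable_wrtS mw; apply: Fcommon_mono; case/andP: tT.
have o1 := cond_exp_orth (Fcommon_sub W_brownian t) (hz tT l) Sx' Sz mw Lw.
have o2 : ipP (fun w => x t w l ord0 - xbar t w l ord0) (fun w => z t w l ord0 - xbar t w l ord0) = 0.
  by apply/eqP; rewrite -normr_le0; have := sub _ mwT Lw; rewrite mul0r.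
split => //; set wl := (fun w => z t w l ord0 - xbar t w l ord0) in Lw o1 o2 *.
(* [x' - x] is [(x' - z) - (x - xbar)] plus [wl], so pairing it with [wl] leaves the squared norm of
   [wl]. *)
have e : n2P wl ^+ 2 = ipP (fun w => x' t w l ord0 - x t w l ord0) wl.
  rewrite n2_sqr [in RHS](_ : (fun w => x' t w l ord0 - x t w l ord0) =
    fun w => ((x' t w l ord0 - z t w l ord0) - (x t w l ord0 - xbar t w l ord0)) + wl w); last first.
    by apply/funext => w; rewrite /wl; ring.
  rewrite (ipDl measurableT (L2B measurableT Lxz Lxb) Lw Lw).
  by rewrite (ipBl measurableT Lxz Lxb Lw) o1 o2 subrr add0r.
have h := le_trans (ler_norm _) (cauchy_schwarz measurableT Lp Lw).
have [->|w0] := eqVneq (n2P wl) 0; first exact: n2_ge0.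
rewrite -(ler_pM2r (_ : 0 < n2P wl)); first by rewrite -expr2 e.
by rewrite lt_neqAle eq_sym w0 n2_ge0.
Qed.

(** The estimates close on [x' - x] alone: [z - xbar] is controlled by it through
    [mean_field_gap_le], the adjoint differences vanish, and the difference of the controls is
    linear in these. [u'] is kept abstract, equal to the feedback on [0, T] only, because [Pc] and
    [Kc] are known to agree with [P] and [K] only there. *)
Lemma strategies_agree : same_process Pr m (strategy m P K phi beta x xbar) u'.
Proof.
have T0 := ltW T_gt0.
have [Ax _ [Ii [I0 [hIi hI0 ex]]]] := hx; have [Ax' _ [Ii' [I0' [hIi' hI0' ex']]]] := hx'.
have [Ab _ _] := hbar.
have Lx := L2_adapted_vL2t Ax; have Lx' := L2_adapted_vL2t Ax'.
have Lb := L2_adapted_vL2t Ab; have Lz := L2_adapted_vL2t Az.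
have Lu : vL2t Pr 0 T (strategy m P K phi beta x xbar) by apply: strategy_L2.
have Lu' : vL2t Pr 0 T u'.
  have L := strategy_L2 hA1 LP LK LiR LiRK Lphi' Lbeta' Lx' Lz.
  by apply: (vn2t_eq _ L).1 => r rT w; rewrite hu'.
pose p : vproc n := fun t w => x' t w - x t w.
pose y : vproc n := fun t w => z t w - xbar t w.
pose X : vproc n := fun t w => phi' t w - phi t w.
pose Z : vproc n := fun t w => beta' t w - beta t w.
pose du : vproc k := fun t w => u' t w - strategy m P K phi beta x xbar t w.
have Lp : vL2t Pr 0 T p by rewrite /p; vl2.
have Ly : vL2t Pr 0 T y by rewrite /y; vl2.
pose kap (s t : R) := vn2t Pr s t p.
have kap0 s t : 0 <= kap s t by exact: vn2t_ge0.
have cp : ctrl Pr T kap p by split => //; exists 1 => // s t _ _ _; rewrite mul1r.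
have gap := mean_field_gap_le.
have cy : ctrl Pr T kap y.
  split => //; exists 1 => // s t s0 st tT; rewrite mul1r; apply: ler_sum => l _.
  have [L1 <-] := n2P_slices (L2tS s0 tT (Ly l)); have [L2_ <-] := n2P_slices (L2tS s0 tT (Lp l)).
  apply: n2_dom => //; first by case: L1.
  apply: filterS (ae_time_sub s0 tT gap) => r hr; rewrite /= in_itv /= => rst.
  by have [_ _ h] := hr rst l; rewrite !ger0_norm ?n2_ge0.
(* Processes that vanish almost everywhere are controlled with constant 0, so the adjoint terms
   leave no inhomogeneity. *)
have czero (h h' : vproc n) : vL2t Pr 0 T h -> vL2t Pr 0 T h' ->
    ae_time T (fun t => {ae Pr, forall w, h t w = h' t w}) ->
    ctrl Pr T kap (fun t w => h' t w - h t w).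
  move=> L L' e; have LB : vL2t Pr 0 T (fun t w => h' t w - h t w) by vl2.
  split => //; exists 0 => // s t s0 st tT; rewrite mul0r /vn2t big1// => l _.
  apply: n2t_0_ae; first exact: (vL2tS s0 tT LB l).
  apply: filterS (ae_time_sub s0 tT e) => r hr rst; move: (hr rst).
  by apply: filterS => w ->; rewrite subrr mxE.
have cX : ctrl Pr T kap X by exact: czero.
have cZ : ctrl Pr T kap Z by exact: czero.
have cu : ctrl Pr T kap du.
  apply: (@ctrl_eq _ _ _ _ _ _ _ (fun r w =>
    - (invmx (calR (coef m r) (P r)) *m Ptilde (coef m r) (P r)) *m p r w
    + (invmx (calR (coef m r) (P r)) *m Ptilde (coef m r) (P r) - Theta (coef m r) (P r) (K r)) *m y r w
    - invmx (calRK (coef m r) (P r) (K r)) *m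
       ((cB (coef m r))^T *m X r w + (cDt (coef m r))^T *m Z r w))).
    by move=> r rT w; rewrite /du hu'// /strategy feedbackB.
  by ctl.
pose a : vproc n := fun r w =>
  cA (coef m r) *m p r w + cB (coef m r) *m du r w + cE (coef m r) *m y r w.
pose b1 : vproc n := fun r w =>
  cC (coef m r) *m p r w + cD (coef m r) *m du r w + cF (coef m r) *m y r w.
pose b0 : vproc n := fun r w =>
  cCt (coef m r) *m p r w + cDt (coef m r) *m du r w + cFt (coef m r) *m y r w.
have [La [Ca Ca0 ha]] : ctrl Pr T kap a by rewrite /a; ctl.
have [_ [C1 C10 h1]] : ctrl Pr T kap b1 by rewrite /b1; ctl.
have [_ [C0 C00 h0]] : ctrl Pr T kap b0 by rewrite /b0; ctl.
have itgi := Fplayer_integrator_private W_brownian hA1 i.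
have itg0 := Fplayer_integrator W_brownian hA1 i.
have inc1 := @itoinc_diff _ _ _ Pr T _ _ _ _ Ii' _ Ii b1 itgi (ito_increment itgi hIi')
  (ito_increment itgi hIi) (fun r w => esym (private_diffusionB _ _ _ _ _ _ _ _)).
have inc0 := @itoinc_diff _ _ _ Pr T _ _ _ _ I0' _ I0 b0 itg0 (ito_increment itg0 hI0')
  (ito_increment itg0 hI0) (fun r w => esym (common_diffusionB _ _ _ _ _ _ _ _)).
have Ldr := drift_L2 hA1 Lx Lb Lu; have Ldr' := drift_L2 hA1 Lx' Lz Lu'.
have eJ t : 0 <= t <= T -> forall l, {ae Pr, forall w, p t w l ord0 = 0 + tint a`_[l] 0 t w
    + ((I0' t w - I0 t w) l ord0 + (Ii' t w - Ii t w) l ord0)}.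
  move=> tT l; have /andP[t0 tT'] := tT.
  have td := tint_diff (lexx 0) tT' Ldr' Ldr (g := a)
    (fun r rT w => esym (driftB _ _ _ _ _ _ _ _)) l.
  move: (ex t tT) (ex' t tT) td; apply: filterS3 => w e1 e2 <-.
  rewrite /p e1 e2 !(add_mxE, opp_mxE) !time_integralE /tint.
  by ring.
have ep : forall s t : R, 0 <= s -> s <= t -> t <= T -> forall l,
    {ae Pr, forall w, p t w l ord0 = p s w l ord0 + tint a`_[l] s t w
     + ((I0' t w - I0 t w) l ord0 - (I0' s w - I0 s w) l ord0)
     + ((Ii' t w - Ii t w) l ord0 - (Ii' s w - Ii s w) l ord0)}.
  move=> s t s0 st tT l.
  have := @forward_increment _ _ _ Pr T p`_[l] (fun _ _ => 0) a`_[l]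
    (fun t w => (I0' t w - I0 t w) l ord0 + (Ii' t w - Ii t w) l ord0) s t s0 st tT (La l)
    (fun t tT => eJ t tT l).
  by apply: filterS => w ->; ring.
have p0 l : {ae Pr, forall w, p 0 w l ord0 = 0}.
  move: (state_sde_at0 T_gt0 hx) (state_sde_at0 T_gt0 hx'); apply: filterS2 => w e1 e2.
  by rewrite /p e1 e2 subrr mxE.
have mp t : 0 <= t <= T -> forall l, measurable_fun setT (fun w => p t w l ord0).
  move=> tT l; rewrite (_ : (fun w => _) = fun w => x' t w l ord0 - x t w l ord0).
    apply: measurable_funB; [exact: (state_measurable W_brownian hA1 tT hx')|].
    exact: (state_measurable W_brownian hA1 tT hx).
  by apply/funext => w; rewrite !mxE.
have hC : forall s t : R, 0 <= s -> s <= t -> t <= T ->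
    [/\ vn2t Pr s t a <= (Ca + C1 + C0) * vn2t Pr s t p,
        vn2t Pr s t b0 <= (Ca + C1 + C0) * vn2t Pr s t p &
        vn2t Pr s t b1 <= (Ca + C1 + C0) * vn2t Pr s t p].
  move=> s t s0 st tT; split.
  - apply: le_trans (ha s t s0 st tT) _; apply: ler_wpM2r; first exact: kap0.
    by rewrite -addrA lerDl addr_ge0.
  - apply: le_trans (h0 s t s0 st tT) _; apply: ler_wpM2r; first exact: kap0.
    by rewrite lerDr addr_ge0.
  - apply: le_trans (h1 s t s0 st tT) _; apply: ler_wpM2r; first exact: kap0.
    by rewrite addrAC lerDr addr_ge0.
have Cpos : 0 <= Ca + C1 + C0 by rewrite !addr_ge0.
have pz := @sde_zero _ _ _ Pr T _ _ _ itg0 itgi n p a b0 b1 (fun t w => I0' t w - I0 t w)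
  (fun t w => Ii' t w - Ii t w) (Ca + C1 + C0) T0 Cpos Lp La hC mp inc0 inc1 ep p0.
have H := ae_time2 (fun t _ p q => conj p q) gap (ae_time2 (fun t _ p q => conj p q) ephi ebeta).
apply: ae_timeS H => t tT [gt [ep' eb']].
have px : {ae Pr, forall w, x' t w = x t w}.
  apply: ae_colP => l; move: (pz t tT l); apply: filterS => w.
  by rewrite /p !(add_mxE, opp_mxE) => /eqP; rewrite subr_eq0 => /eqP.
have yx : {ae Pr, forall w, z t w = xbar t w}.
  apply: ae_colP => l; have [Lw Lpt h] := gt l.
  have n0 : n2P (fun w => (z t w - xbar t w) l ord0) <= 0.
    apply: le_trans h _; rewrite le_eqVlt; apply/orP; left; apply/eqP.
    apply: (proj2 (n2_0_ae measurableT (proj1 Lpt) _)).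
    by move: (pz t tT l); apply: filterS => w e _.
  move: (n2P_ae0 Lw n0); apply: filterS => w.
  by rewrite !(add_mxE, opp_mxE) => /eqP; rewrite subr_eq0 => /eqP.
have A1 : {ae Pr, forall w, x' t w = x t w /\ z t w = xbar t w}.
  by move: px yx; apply: filterS2 => w.
move: A1 ep' eb'; apply: filterS3 => w [e1 e2] e3 e4.
by rewrite hu'// /strategy e1 e2 e3 e4.
Qed.

End comparison.

Theorem mainTheorem7
  (R : realType) (d : measure_display) (Omega : measurableType d)
  (Pr : probability Omega R) (N n k : nat) (m : game R Omega N n k)
  (PN KN PiN SN MN : R -> 'M[R]_n)
  (P K : R -> 'M[R]_n) (phi beta xbar : R -> Omega -> 'cV[R]_n)
  (x : 'I_N -> R -> Omega -> 'cV[R]_n)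
  (Pc Kc : R -> 'M[R]_n) (phic betac : R -> Omega -> 'cV[R]_n)
  (xc zc : 'I_N -> R -> Omega -> 'cV[R]_n)
  (N_gt0 : (0 < N)%N) (T_gt0 : 0 < horizon m)
  (Pr_complete : measure_is_complete Pr)
  (W_brownian : standard_brownian Pr (noise m))
  (hA1 : A1 Pr m) (hA2 : A2 Pr m)
  (hRN : solves_RN m PN KN PiN SN MN) (hA3 : A3 m PN KN)
  (* direct method *)
  (hP : solves_P m P) (hA5 : A5 m P) (hK : solves_K m P K)
  (hA4 : positivity m P K)
  (hphi : solves_phi Pr m P K phi beta)
  (hx : direct_states Pr m P K phi beta xbar x)
  (* fixed-point method *)
  (hPc : solves_P m Pc) (hKc : solves_K m Pc Kc)
  (hA6 : positivity m Pc Kc)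
  (hphic : solves_phi Pr m Pc Kc phic betac)
  (hxc : fixed_point_states Pr m Pc Kc phic betac xc zc) :
  [/\ forall t, 0 <= t <= horizon m -> P t = Pc t,
      forall t, 0 <= t <= horizon m -> K t = Kc t,
      indistinguishable Pr m phi phic &
      forall i : 'I_N,
        same_process Pr m (strategy m P K phi beta (x i) xbar)
                          (strategy m Pc Kc phic betac (xc i) (zc i))].
Proof.
have T0 := ltW T_gt0.
have eP := riccati_uniq T_gt0 hA1 hP hPc.
have hKc' := solves_K_eq eP hKc.
have eK t : 0 <= t <= horizon m -> K t = Kc t.
  (* (A5) compares every solution with a reference solution, which both [K] and [Kc] equal. *)
  by move=> tT; have [K0 _ uK] := hA5; rewrite (uK _ hK t tT) (uK _ hKc' t tT).
have LP : Linfty (horizon m) P by exact: (Linfty_backward_ode T0 (proj1 hP)).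
have LK : Linfty (horizon m) K.
  have [[dK [cK _]] _] := hK.
  by apply: Linfty_continuous => i j; have [] := cK i j.
have LiR := proj2 (proj2 hP).
have LiRK := proj2 (proj2 (proj2 hK)).
have hphic' := solves_phi_eq eP eK hphic.
(* That [W0 m] is an integrator for [Fcommon m] was obtained through the filtration of a player, so
   one is chosen. *)
have i0 := Ordinal N_gt0.
have [ephi ebeta] := adjoint_uniq W_brownian hA1 T_gt0 i0 LP LK LiRK hphi hphic'.
have [Aphi cphi [I hI _]] := hphi; have [Aphic cphic [Ic hIc _]] := hphic.
split => //.
- exact: (continuous_indistinguishable T_gt0 cphi cphic ephi).
- move=> i; have [hbar hxi] := hx; have [Az hz hsc] := hxc i.
  apply: (strategies_agree W_brownian hA1 T_gt0 LP LK LiR LiRK (L2_adapted_vL2t Aphi)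
    (L2_adapted_vL2t (proj1 hI)) (L2_adapted_vL2t Aphic) (L2_adapted_vL2t (proj1 hIc))
    _ ebeta hbar (hxi i) hsc Az hz).
    by apply: ae_time_all => t tT; apply: ae_colP; exact: ephi.
  by move=> t tT w; rewrite /strategy eP// eK.
Qed.
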